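(* Let $0<\alpha<mn$, $1\le p_i<\infty$ for $i=1,\dots,m$, $\frac1p=\frac1{p_1}+\cdots+\frac1{p_m}$, $\vec P=(p_1,\dots,p_m)$, $\frac1m<p<\frac n\alpha$, $\frac1q=\frac1p-\frac\alpha n$, and $\nu_{\vec\omega}=\prod_{i=1}^m\omega_i$. Then for $\vec\omega\in A_{(\vec P,q)}$ there is a constant $C>0$ independent of $\vec f$ such that $$\|\mathcal M_\alpha(\vec f)\,\nu_{\vec\omega}\|_{L^{q,\infty}(\mathbb R^n)}\le C\,[\vec\omega]_{A_{(\vec P,q)}}^{\frac1q}\prod_{i=1}^m\|f_i\|_{L^{p_i}(\omega_i^{p_i})}.$$
   Context: Cubes in $\mathbb R^n$ have sides parallel to the axes. $\vec\omega=(\omega_1,\dots,\omega_m)$ is a vector of weights (nonnegative functions on $\mathbb R^n$), $\vec f=(f_1,\dots,f_m)$ with each $f_i$ locally integrable on $\mathbb R^n$; $L^r(w)$ is taken with respect to $w\,dx$; $r'$ is the conjugate exponent of $r$. The weak norm is with respect to Lebesgue measure: $\|g\|_{L^{q,\infty}(\mathbb R^n)}=\sup_{\lambda>0}\lambda\,|\{x\in\mathbb R^n:|g(x)|>\lambda\}|^{1/q}$. Multilinear fractional maximal operator: $$\mathcal M_\alpha(\vec f)(x)=\sup_{Q\ni x}\prod_{i=1}^m\frac1{|Q|^{1-\frac\alpha{mn}}}\int_Q|f_i(y_i)|\,dy_i,$$ the supremum over all cubes $Q$ containing $x$. Class $A_{(\vec P,q)}$: $\vec\omega\in A_{(\vec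 P,q)}$ if $$[\vec\omega]_{A_{(\vec P,q)}}=\sup_Q\Big(\frac1{|Q|}\int_Q\nu_{\vec\omega}^q\Big)\prod_{i=1}^m\Big(\frac1{|Q|}\int_Q\omega_i^{-p_i'}\Big)^{q/p_i'}<\infty,$$ where, if $p_i=1$, $\big(\frac1{|Q|}\int_Q\omega_i^{-p_i'}\big)^{1/p_i'}$ is understood as $(\inf_Q\omega_i)^{-1}$. *)

(* Defs.v *)
From HB Require Import structures.
From mathcomp Require Import all_boot all_order all_algebra.
From mathcomp Require Import all_classical all_reals all_analysis.

Set Implicit Arguments.
Unset Strict Implicit.
Unset Printing Implicit Defensive.

Import Order.TTheory GRing.Theory Num.Theory.
Import numFieldNormedType.Exports.

Local Open Scope classical_set_scope.
Local Open Scope ring_scope.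

(* The product sigma-algebra of the coordinates, as the library has it on tuples;
   for 'rV[R]_n it is the Borel sigma-algebra. *)
Definition rV_display : measure_display. Proof. exact. Qed.

Section BorelRn.
Context {R : realType}.

Section sigma_algebra.
Variable n : nat.

Definition rV_coord (i : 'I_n) (x : 'rV[R]_n) : R := x ord0 i.

Let rV_set0 : g_sigma_preimage rV_coord set0.
Proof. exact: sigma_algebra0. Qed.

Let rV_setC A : g_sigma_preimage rV_coord A -> g_sigma_preimage rV_coord (~` A).
Proof. exact: sigma_algebraC. Qed.

Let rV_bigcup (F : (set 'rV[R]_n)^nat) :
  (forall i, g_sigma_preimage rV_coord (F i)) ->
  g_sigma_preimage rV_coord (\bigcup_i F i).
Proof. exact: sigma_algebra_bigcup. Qed.

HB.instance Definition _ := @isMeasurable.Build rV_display 'rV[R]_n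
  (g_sigma_preimage rV_coord) rV_set0 rV_setC rV_bigcup.

Lemma measurable_rV_coord (i : 'I_n) : measurable_fun [set: 'rV[R]_n] (rV_coord i).
Proof.
move=> _ Y mY; rewrite setTI; apply: sub_sigma_algebra => /=.
rewrite -bigcup_seq/=; exists i => /=; first by rewrite mem_index_enum.
by exists Y => //; rewrite setTI.
Qed.

Lemma measurable_fun_rV d (T : measurableType d) (f : T -> 'rV[R]_n) :
  (forall i, measurable_fun [set: T] (rV_coord i \o f)) ->
  measurable_fun [set: T] f.
Proof.
move=> mf _ A; rewrite setTI.
pose G := [set A : set 'rV[R]_n | measurable (f @^-1` A)].
suff GS : g_sigma_preimage rV_coord `<=` G by move=> mA; exact: GS.
apply: smallest_sub.
  split; rewrite /G/=.
  - by rewrite preimage_set0.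
  - by move=> B; rewrite setTD preimage_setC; exact: measurableC.
  - by move=> F mF; rewrite preimage_bigcup; exact: bigcup_measurable.
move=> B; rewrite -bigcup_seq/= => -[i _ [C mC <-]].
by rewrite /G/= setTI -comp_preimage -[X in measurable X]setTI; exact: mf.
Qed.

End sigma_algebra.

Definition rV_cons n (p : R * 'rV[R]_n) : 'rV[R]_n.+1 :=
  \row_i oapp (fun j => rV_coord j p.2) p.1 (unlift ord0 i).

Lemma measurable_rV_cons n : measurable_fun [set: R * 'rV[R]_n] (@rV_cons n).
Proof.
apply: measurable_fun_rV => i; case: (unliftP ord0 i) => [j|] ->.
- rewrite (_ : _ \o _ = rV_coord j \o snd); last first.
    by apply/funext => p; rewrite /rV_coord /rV_cons/= mxE liftK.
  by apply: measurableT_comp => //; exact: measurable_rV_coord.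
- rewrite (_ : _ \o _ = fst)//.
  by apply/funext => p; rewrite /rV_coord /rV_cons/= mxE unlift_none.
Qed.

Local Notation pushforward_measure :=
  measure_function_pushforward__canonical__measure_function_Measure.

(* [m1 \x^ m2] is the library's product measure that asks for sigma-finiteness
   of its first factor only, so that the recursion needs no further structure.
   It is the usual product measure here, see [borel_lebesgue_box]. *)
Fixpoint borel_lebesgue n : {measure set 'rV[R]_n -> \bar R} :=
  if n is n'.+1 then
    pushforward_measure
      ((@lebesgue_measure R) \x^ (borel_lebesgue n'))%E (@measurable_rV_cons n')
  else \d_(0 : 'rV[R]_0).

Definition box n (a b : 'rV[R]_n) : set 'rV[R]_n :=
  [set x | forall i, a ord0 i < x ord0 i < b ord0 i].

Lemma measurable_box n (a b : 'rV[R]_n) : measurable (box a b).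
Proof.
rewrite (_ : box a b = \bigcap_(i in [set: 'I_n])
    (rV_coord i @^-1` `]a ord0 i, b ord0 i[)); last first.
  apply/seteqP; split => x abx i; first by move=> _; rewrite /= in_itv/=; exact: abx.
  by have := abx i Logic.I; rewrite /= in_itv.
apply: fin_bigcap_measurable; first exact: finite_finset.
by move=> i _; rewrite -[X in measurable X]setTI; exact: measurable_rV_coord.
Qed.

Lemma borel_lebesgue_box n (a b : 'rV[R]_n) :
  (forall i, a ord0 i <= b ord0 i) ->
  borel_lebesgue n (box a b) = (\prod_(i < n) (b ord0 i - a ord0 i))%:E.
Proof.
elim: n => [|n IHn] in a b *.
  move=> _; rewrite big_ord0/= diracE mem_set//=; by move=> [].
move=> ab; rewrite /= /pushforward.
pose a' := \row_(i < n) a ord0 (lift ord0 i).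
pose b' := \row_(i < n) b ord0 (lift ord0 i).
rewrite (_ : _ @^-1` _ = `]a ord0 ord0, b ord0 ord0[%classic `*` box a' b').
  rewrite product_measure2E//; last exact: measurable_box.
  rewrite IHn; last by move=> i; rewrite !mxE.
  rewrite [X in (X * _)%E](lebesgue_measure_itv `]a ord0 ord0, b ord0 ord0[)/= lte_fin big_ord_recl/=.
  under eq_bigr do rewrite !mxE.
  have := ab ord0; rewrite le_eqVlt => /predU1P[->|->].
    by rewrite ltxx subrr mul0r mul0e.
  by rewrite -EFinB -EFinM.
apply/seteqP; split => -[x y]; rewrite /box/=.
  move=> xy; split.
    by rewrite in_itv/=; have := xy ord0; rewrite mxE unlift_none.
  by move=> i; rewrite !mxE; have := xy (lift ord0 i); rewrite mxE liftK.
rewrite in_itv/= => -[xab yab] i; rewrite mxE.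
by case: (unliftP ord0 i) => [j ->|->]//=; have := yab j; rewrite !mxE.
Qed.

(* R^n with its Lebesgue-measurable sets, and the Lebesgue measure on them; the
   underlying type is 'rV[R]_n, but measurability refers to the completed
   sigma-algebra. *)
Definition Rn n : measurableType _ :=
  caratheodory_type (borel_lebesgue n)^*%mu.

Definition lebesgue_rV n : {measure set (Rn n) -> \bar R} :=
  @completed_measure_extension _ _ _ (borel_lebesgue n).

Lemma lebesgue_rV_box n (a b : 'rV[R]_n) :
  (forall i, a ord0 i <= b ord0 i) ->
  lebesgue_rV n (box a b) = (\prod_(i < n) (b ord0 i - a ord0 i))%:E.
Proof.
move=> ab; rewrite -borel_lebesgue_box//.
exact: (measurable_mu_extE (borel_lebesgue n) (measurable_box a b)).
Qed.

Lemma borel_measurable_Rn n (A : set 'rV[R]_n) :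
  measurable A -> measurable (A : set (Rn n)).
Proof. exact: caratheodory_measurable_mu_ext. Qed.

End BorelRn.

Arguments Rn : clear implicits.
Arguments lebesgue_rV : clear implicits.

Section cubes.
Context {R : realType} {n : nat}.
Local Notation mu := (lebesgue_rV R n).

Definition cube (c : 'rV[R]_n) (r : R) : set (Rn R n) :=
  [set x : 'rV[R]_n | forall i, `|x ord0 i - c ord0 i| < r].

(* The cubes are taken open; as they differ from the closed and half-open ones by
   null sets, and each cube is the limit of slightly larger ones, the choice does
   not affect any of the suprema below. *)
Definition cubes : set (set (Rn R n)) :=
  [set Q | exists c r, 0 < r /\ Q = cube c r].

Lemma lebesgue_rV_cube (c : 'rV[R]_n) (r : R) : 0 < r ->
  mu (cube c r) = ((r *+ 2) ^+ n)%:E.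
Proof.
move=> r0.
rewrite (_ : cube c r = box (c - const_mx r) (c + const_mx r)).
  rewrite lebesgue_rV_box => [|i].
    rewrite (eq_bigr (fun=> r *+ 2)) ?prodr_const ?card_ord// => i _.
    by rewrite !mxE opprD opprK addrACA subrr add0r mulr2n.
  by rewrite !mxE lerD2l (le_trans _ (ltW r0))// oppr_le0 ltW.
by apply/seteqP; split => x cx i; have := cx i; rewrite !mxE ltr_distl.
Qed.

Definition locally_integrable_Rn (f : Rn R n -> R) : Prop :=
  measurable_fun setT f /\
  forall K : set 'rV[R]_n, compact K ->
    (\int[mu]_(x in (K : set (Rn R n))) `|f x|%:E < +oo)%E.

Definition weight (w : Rn R n -> R) : Prop :=
  measurable_fun setT w /\ forall x, 0 <= w x.

Local Open Scope ereal_scope.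

Definition weighted_norm (r : R) (w f : Rn R n -> R) : \bar R :=
  (\int[mu]_x (`|f x| `^ r * w x)%:E) `^ r^-1.

Definition weak_norm (q : R) (g : Rn R n -> \bar R) : \bar R :=
  ereal_sup [set l%:E * mu [set x | l%:E < `|g x|] `^ q^-1 |
             l in [set l : R | (0 < l)%R]].

Definition average (Q : set (Rn R n)) (g : Rn R n -> \bar R) : \bar R :=
  (mu Q)^-1 * \int[mu]_(x in Q) g x.

(* Weights are given up to null sets: the infimum of a weight over a cube is the
   essential one, i.e. [ess_inf] for the restriction of the measure to Q. *)
Definition ess_inf_on (Q : set (Rn R n)) (w : Rn R n -> R) : \bar R :=
  ereal_sup [set y | {ae mu, forall x, Q x -> y <= (w x)%:E}].

Definition frac_maximal m (alpha : R) (f : 'I_m -> Rn R n -> R) (x : Rn R n) :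
    \bar R :=
  ereal_sup [set \prod_(i < m)
      ((mu Q `^ (1 - alpha / (m * n)%:R))^-1 * \int[mu]_(y in Q) `|f i y|%:E) |
    Q in [set Q | cubes Q /\ Q x]].

Definition nu m (w : 'I_m -> Rn R n -> R) (x : Rn R n) : R :=
  (\prod_(i < m) w i x)%R.

(* The negative power w `^ (- p') is written ((w `^ p')%:E)^-1 in \bar R, which is
   +oo where w vanishes, whereas [powR] gives 0 there. The inverse of a vanishing
   essential infimum is +oo as well. *)
Definition dual_factor (p q : R) (w : Rn R n -> R) (Q : set (Rn R n)) : \bar R :=
  if p == 1%R then (ess_inf_on Q w)^-1 `^ q
  else let p' := fine (hoelder_conjugate p%:E) in
       average Q (fun x => (w x `^ p')%:E^-1) `^ (q / p').

Definition Apq_char m (P : 'I_m -> R) (q : R) (w : 'I_m -> Rn R n -> R) : \bar R :=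
  ereal_sup [set average Q (fun x => (nu w x `^ q)%:E) *
                 \prod_(i < m) dual_factor (P i) q (w i) Q | Q in cubes].

Definition Apq m (P : 'I_m -> R) (q : R) (w : 'I_m -> Rn R n -> R) : Prop :=
  Apq_char P q w < +oo.

End cubes.

(* Main.v *)
Require Import Defs.
From mathcomp Require Import all_boot all_order all_algebra.
From mathcomp Require Import all_classical all_reals all_analysis.
From mathcomp Require Import measurable_realfun ring lra.

Import Order.TTheory GRing.Theory Num.Theory.
Import numFieldNormedType.Exports.

Local Open Scope classical_set_scope.
Local Open Scope ring_scope.

(** The weight multiplies the maximal function instead of changing the measure, so that
    the level sets are not unions of cubes, and a covering argument has to be combined with
    information on how large the weight is inside of the cubes. Three ideas achieve this.

    First, let [v] be the [q]-th power of the product of the weights. Hoelder's inequality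
    and the A_(P,q) condition bound the product of the mean of [v] over a cube [Q] with the
    [q]-th power of the normalised product of the integrals of the [f i] by
    [W / |Q|] times the product of the [q / P i]-th powers of the integrals of
    [(f i * w i) `^ P i] over [Q] ([dual_key]). The exponents [q / P i] add up to
    [q / p >= 1], so that these bounds are summable over disjoint cubes, and the Vitali
    covering lemma turns them into an estimate of the measure of a union of cubes
    ([mu_cube_union_le]).

    Secondly, if the normalised product of the integrals lies between [B ^ k] and
    [B ^ (k + 1)] on some cube around [x], then [x] has a stopping cube, an almost largest
    cube [Q] around [x] on which the product exceeds [B ^ k]. Such a cube has at least half
    of its measure outside of the level set of [B ^ (k + 1)], again by the covering
    estimate ([stopping_half]). Hence, if for every [k] disjoint stopping cubes of level
    [B ^ k] are given, then all of these cubes contain disjoint sets of comparable measure,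
    and nothing is lost by the summation over [k].

    Thirdly, [v] belongs to the class A_infty ([dual_Ainfty]) and so satisfies a reverse
    Hoelder inequality ([reverse_hoelder_tail]). If, for a point of the level set at height
    [lam] of the [q]-th powers, the product of [B ^ (k * q)] and of the mean of [v] over the
    stopping cube is about [lam * b ^- l], then [v x] is at least about [b ^+ l] times its
    mean there, which happens on a fraction [(eta / b) ^+ l] of the cube only, with some
    [eta < 1]. The covering estimate for these cubes loses [b ^+ l], and the remaining series
    in [eta ^+ l] converges ([level_set_estimate]).

    The reverse Hoelder inequality is proved with the same stopping cubes, applied to the
    averages of [v] itself: the [v]-mass of the level sets of its maximal function decays
    geometrically, and by a weak form of Lebesgue's differentiation theorem
    ([weak_differentiation]) these level sets contain almost all points at which [v] is
    large. *)

(** * Two inequalities for products of powers *)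

(** The graph of the exponential lies above its tangent at the logarithm of the
    product; the inequalities at the points [ln (a i)] are averaged with the weights
    [th i], the remaining weight being put at [ln 1]. *)
Lemma weighted_amgm {R : realType} {I : finType} (a th : I -> R) :
  (forall i, 0 <= a i) -> (forall i, 0 <= th i) -> \sum_i th i <= 1 ->
  \prod_i a i `^ th i <= \sum_i th i * a i + (1 - \sum_i th i).
Proof.
move=> a0 th0 th1.
have [/existsP[i /andP[/eqP ai0 thi0]]|] :=
    boolP [exists i, (a i == 0) && (th i != 0)].
  rewrite (bigD1 i)//= ai0 powR0// mul0r addr_ge0 ?subr_ge0// sumr_ge0// => j _.
  by rewrite mulr_ge0.
rewrite negb_exists => /forallP ath.
pose L := \sum_i th i * ln (a i).
have eqe i : a i `^ th i = expR (th i * ln (a i)).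
  have := ath i; rewrite negb_and negbK /powR => /orP[/negPf -> //|/eqP ->].
  by rewrite eqxx mul0r expR0; case: ifP.
rewrite (eq_bigr _ (fun i _ => eqe i)) -expR_sum -/L.
have tangent i : th i * (expR L * (1 + (ln (a i) - L))) <= th i * a i.
  have [->|thi0] := eqVneq (th i) 0; first by rewrite !mul0r.
  have ai0 : 0 < a i.
    by rewrite lt0r a0 andbT; have := ath i; rewrite negb_and thi0 orbF.
  rewrite ler_wpM2l// (le_trans (ler_wpM2l (expR_ge0 _) (expR_ge1Dx _)))//.
  by rewrite -expRD addrC subrK lnK// posrE.
have tangent1 : expR L * (1 + (0 - L)) <= 1.
  rewrite (le_trans (ler_wpM2l (expR_ge0 _) (expR_ge1Dx _)))//.
  by rewrite -expRD addrC subrK expR0.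
have := lerD (ler_sum (index_enum I) (fun i (_ : true) => tangent i))
  (ler_wpM2l (etrans (subr_ge0 _ _) th1) tangent1).
rewrite mulr1; apply: le_trans.
have -> : \sum_i th i * (expR L * (1 + (ln (a i) - L))) =
    expR L * ((\sum_i th i) * (1 - L) + \sum_i th i * ln (a i)).
  rewrite mulr_suml -big_split/= mulr_sumr.
  by apply: eq_bigr => i _; ring.
by rewrite -/L le_eqVlt; apply/orP; left; apply/eqP; ring.
Qed.

(** Once the entries are divided by their sums over [j] they are at most 1, so that
    lowering the exponents to a total of 1 increases the products, and these are then at
    most weighted sums of the entries, which add up to 1. *)
Lemma sum_prod_powR_le {R : realType} {I J : finType} (a : J -> I -> R) (s : I -> R) :
  (forall j i, 0 <= a j i) -> (forall i, 0 <= s i) -> 1 <= \sum_i s i ->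
  \sum_j \prod_i a j i `^ s i <= \prod_i (\sum_j a j i) `^ s i.
Proof.
move=> a0 s0 s1; set S := \sum_i s i in s1.
have S0 : 0 < S by rewrite (lt_le_trans ltr01).
pose T i := \sum_j a j i.
have T0 i : 0 <= T i by rewrite sumr_ge0.
have aT j i : a j i <= T i by rewrite /T (bigD1 j)//= lerDl sumr_ge0.
have [/existsP[i /andP[/eqP Ti0 si0]]|] :=
    boolP [exists i, (T i == 0) && (s i != 0)].
  rewrite big1 ?prodr_ge0// => [i' _|j _]; first exact: powR_ge0.
  rewrite (bigD1 i)//= (_ : a j i = 0) ?powR0 ?mul0r//.
  by apply/eqP; rewrite eq_le a0 andbT -Ti0 aT.
rewrite negb_exists => /forallP Ts.
pose b j i := a j i / T i.
have b0 j i : 0 <= b j i by rewrite divr_ge0.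
have b1 j i : b j i <= 1.
  rewrite /b; have [->|Ti0] := eqVneq (T i) 0; first by rewrite invr0 mulr0.
  by rewrite ler_pdivrMr ?mul1r// lt0r Ti0 T0.
have aE j i : a j i `^ s i = T i `^ s i * b j i `^ s i.
  have := Ts i; rewrite negb_and negbK => /orP[Ti0|/eqP ->]; last by rewrite !powRr0 mulr1.
  by rewrite -powRM// mulrC divfK.
have prodE j : \prod_i a j i `^ s i = \prod_i T i `^ s i * \prod_i b j i `^ s i.
  by rewrite -big_split/=; apply: eq_bigr => i _.
rewrite (eq_bigr _ (fun j _ => prodE j)).
rewrite -mulr_sumr -[leRHS]mulr1 ler_wpM2l ?prodr_ge0// => [i _|]; first exact: powR_ge0.
have step j : \prod_i b j i `^ s i <= \sum_i (s i / S) * b j i.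
  have -> : \prod_i b j i `^ s i = \prod_i (b j i `^ S) `^ (s i / S).
    by apply: eq_bigr => i _; rewrite -powRrM mulrCA divff ?mulr1// gt_eqF.
  apply: (@le_trans _ _ (\prod_i b j i `^ (s i / S))).
    apply: ler_prod => i _; rewrite powR_ge0/= ge0_ler_powR ?nnegrE ?powR_ge0 ?divr_ge0 ?(ltW S0)//.
    have [->|bji0] := eqVneq (b j i) 0; first by rewrite powR0 ?gt_eqF.
    by rewrite ge1r_powR// lt0r bji0 b0 b1.
  have th1 : \sum_i s i / S = 1 by rewrite -mulr_suml divff// gt_eqF.
  have := weighted_amgm (b j) (fun i => s i / S) (b0 j)
    (fun i => divr_ge0 (s0 i) (ltW S0)); rewrite th1 subrr addr0; exact.
apply: le_trans (ler_sum (index_enum J) (fun j (_ : true) => step j)) _.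
rewrite exchange_big/=.
apply: (@le_trans _ _ (\sum_i s i / S)); last by rewrite -mulr_suml divff// gt_eqF.
apply: ler_sum => i _; rewrite -mulr_sumr -[leRHS]mulr1 ler_wpM2l ?divr_ge0 ?(ltW S0)//.
rewrite /b -mulr_suml -/(T i).
by have [->|Ti0] := eqVneq (T i) 0; rewrite ?mul0r ?divff.
Qed.

Lemma prod_powR_base {R : realType} {I : finType} (a : I -> R) (s : R) :
  (forall i, 0 <= a i) -> \prod_i a i `^ s = (\prod_i a i) `^ s.
Proof.
move=> a0; elim: (index_enum I) => [|i e IHe]; first by rewrite !big_nil powR1.
by rewrite !big_cons IHe powRM// prodr_ge0.
Qed.

Lemma powRK {R : realType} (x k : R) : k != 0 -> 0 <= x -> (x `^ k) `^ k^-1 = x.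
Proof. by move=> k0 x0; rewrite -powRrM mulfV// powRr1. Qed.

Lemma powRVK {R : realType} (x k : R) : k != 0 -> 0 <= x -> (x `^ k^-1) `^ k = x.
Proof. by move=> k0 x0; rewrite -powRrM mulVf// powRr1. Qed.

Lemma powR_scaleK {R : realType} (s z k : R) : k != 0 -> 0 < s -> 0 <= z ->
  s `^ (- k^-1) * (s * z `^ k) `^ k^-1 = z.
Proof.
move=> k0 s0 z0; rewrite powRM ?powR_ge0 ?(ltW s0)// powRK//.
by rewrite mulrA -powRD ?addNr ?powRr0 ?mul1r// (gt_eqF s0) implybT.
Qed.

(** * Cubes and the Vitali covering lemma *)

Section cube_geometry.
Context {R : realType} {n : nat}.
Local Notation mu := (lebesgue_rV R n).
Implicit Types (c x y : 'rV[R]_n) (r : R) (V : set ('rV[R]_n * R)).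

Lemma cubeS c r s : r <= s -> (cube c r `<=` cube c s)%classic.
Proof. by move=> rs x xc i; exact: lt_le_trans (xc i) rs. Qed.

(** For [r <= 2 * r'] this gives the factor 5 of the Vitali covering, and for
    [r <= r'] the factor 3 by which stopping cubes are dilated. *)
Lemma cube_engulf c r c' r' : (cube c r `&` cube c' r' !=set0)%classic ->
  (cube c r `<=` cube c' (2 * r + r'))%classic.
Proof.
move=> [x [xc xc']] y yc i; have := xc i; have := xc' i; have := yc i.
move=> h1 h2 h3; apply: (@le_lt_trans _ _
  (`|y ord0 i - c ord0 i| + `|x ord0 i - c ord0 i| + `|x ord0 i - c' ord0 i|)).
  rewrite (_ : y ord0 i - c' ord0 i = (y ord0 i - c ord0 i) -
    (x ord0 i - c ord0 i) + (x ord0 i - c' ord0 i)); last by ring.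
  by rewrite (le_trans (ler_normD _ _))// lerD2r ler_normB.
by lra.
Qed.

Lemma cube_center c r : 0 < r -> cube c r c.
Proof. by move=> r0 i; rewrite subrr normr0. Qed.

Lemma cube_recenter c r x : cube c r x -> 0 < r ->
  exists2 s, 0 < s & (cube x s `<=` cube c r)%classic.
Proof.
move=> xc r0.
exists (\big[Num.min/r]_i (r - `|x ord0 i - c ord0 i|)).
  by apply/bigmin_gtP; split => // i _; rewrite subr_gt0; exact: xc.
move=> y yx i.
have := lt_le_trans (yx i) (bigmin_le _ i _); rewrite ltrBrDr.
apply: le_lt_trans.
rewrite (_ : y ord0 i - c ord0 i = (y ord0 i - x ord0 i) + (x ord0 i - c ord0 i)).
  exact: ler_normD.
by ring.
Qed.

Lemma cube0 (n0 : (0 < n)%N) c r : r <= 0 -> cube c r = set0.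
Proof.
move=> r0; apply/seteqP; split => // x /(_ (Ordinal n0)).
by rewrite ltNge (le_trans r0).
Qed.

Lemma measurable_cube c r : measurable (cube c r).
Proof.
apply: borel_measurable_Rn.
rewrite (_ : cube c r = box (c - const_mx r) (c + const_mx r)).
  exact: measurable_box.
by apply/seteqP; split => x cx i; have := cx i; rewrite !mxE ltr_distl.
Qed.

Lemma mu_cube (n0 : (0 < n)%N) c r : 0 <= r -> mu (cube c r) = ((2 * r) ^+ n)%:E.
Proof.
rewrite le_eqVlt => /predU1P[<-|r0]; last by rewrite lebesgue_rV_cube// mulr_natl.
by rewrite cube0// measure0 mulr0 expr0n eqn0Ngt n0.
Qed.

Lemma mu_cube_lty (n0 : (0 < n)%N) c r : (mu (cube c r) < +oo)%E.
Proof.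
have [r0|r0] := leP 0 r; first by rewrite mu_cube// ltry.
by rewrite cube0 ?measure0// ltW.
Qed.

(** Zorn's lemma gives a maximal one among the disjoint subfamilies such that every cube
    which meets the subfamily meets one of its cubes of at least half the size. All cubes
    meet it: otherwise a cube disjoint from it could be added, provided that its size is more
    than half of the supremum over the cubes disjoint from it. *)
Lemma vitali_cubes V (M : R) : (forall Q, V Q -> 0 < Q.2 <= M) ->
  exists D, [/\ (D `<=` V)%classic,
    forall P Q, D P -> D Q -> (cube P.1 P.2 `&` cube Q.1 Q.2 !=set0)%classic -> P = Q &
    forall Q, V Q -> exists2 P, D P &
      (cube Q.1 Q.2 `<=` cube P.1 (5 * P.2))%classic].
Proof.
move=> VM.
pose meet (P Q : 'rV[R]_n * R) := (cube P.1 P.2 `&` cube Q.1 Q.2 !=set0)%classic.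
have meetC P Q : meet P Q -> meet Q P by move=> [x []]; exists x.
pose good (D : set ('rV[R]_n * R)) := [/\ (D `<=` V)%classic,
  forall P Q, D P -> D Q -> meet P Q -> P = Q &
  forall Q P, V Q -> D P -> meet Q P -> exists P', [/\ D P', meet Q P' & Q.2 <= 2 * P'.2]].
have [|D [[DV Ddisj Dbig] Dmax]] := @Zorn_bigcup _ good.
  move=> F Fgood Ftot; split.
  - by move=> Q [D FD DQ]; have [DV _ _] := Fgood _ FD; exact: DV.
  - move=> P Q [D1 FD1 D1P] [D2 FD2 D2Q].
    have [D12|D21] := Ftot _ _ FD1 FD2.
      by have [_ + _] := Fgood _ FD2; apply=> //; exact: D12.
    by have [_ + _] := Fgood _ FD1; apply=> //; exact: D21.
  - move=> Q P VQ [D1 FD1 D1P] QP.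
    have [_ _ /(_ _ _ VQ D1P QP)[P' [D1P' QP' PP']]] := Fgood _ FD1.
    by exists P'; split => //; exists D1.
exists D; split => // Q VQ.
suff [P DP QP] : exists2 P, D P & meet Q P.
  have [P' [DP' QP' QP'2]] := Dbig _ _ VQ DP QP.
  exists P' => //; apply: subset_trans (cube_engulf _ _ _ _ QP') _.
  by apply: cubeS; lra.
apply: contrapT => Qno.
pose free := [set Q | V Q /\ forall P, D P -> ~ meet Q P].
have freeQ : free Q by split => // P DP QP; apply: Qno; exists P.
have supS : has_sup [set Q.2 | Q in free].
  split; first by exists Q.2; exists Q.
  by exists M => _ [P [/VM/andP[_ ?] _] <-].
have Q20 : 0 < sup [set Q.2 | Q in free].
  apply: lt_le_trans (_ : Q.2 <= _); first by have /andP[] := VM _ VQ.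
  by apply: sup_upper_bound => //; exists Q.
have [_ [Q0 freeQ0 <-] supQ0] : exists2 r, [set Q.2 | Q in free] r &
    sup [set Q.2 | Q in free] / 2 < r.
  by apply: sup_gt => //; [exact: supS.1 | lra].
have Q0M Q' : free Q' -> Q'.2 <= 2 * Q0.2.
  move=> fQ'; have : Q'.2 <= sup [set Q.2 | Q in free].
    by apply: sup_upper_bound => //; exists Q'.
  by lra.
have VQ0 := freeQ0.1.
have meetQ0 : meet Q0 Q0.
  by exists Q0.1; split; apply: cube_center; have /andP[] := VM _ VQ0.
apply: (Dmax (D `|` [set Q0])).
  split; first by move=> P DP; left.
  move=> /(_ Q0 (or_intror erefl)) DQ0.
  by apply: (freeQ0.2 Q0) => //.
split.
- by move=> P [/DV//|->].
- move=> P P' [DP|->] [DP'|->]//; first exact: Ddisj.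
    by move=> /meetC; move/(freeQ0.2 _ DP).
  by move/(freeQ0.2 _ DP').
- move=> Q' P VQ' DP Q'P.
  have [[P1 DP1 Q'P1]|noQ'] := pselect (exists2 P1, D P1 & meet Q' P1).
    have [P' [DP' ? ?]] := Dbig _ _ VQ' DP1 Q'P1.
    by exists P'; split => //; left.
  case: DP => [DP|PQ0]; first by exfalso; apply: noQ'; exists P.
  exists Q0; split; [by right|by rewrite -PQ0|].
  by apply: Q0M; split => // P' DP' QP'; apply: noQ'; exists P'.
Qed.

Definition ratv (u : 'rV[rat]_n) : 'rV[R]_n := map_mx ratr u.

Lemma cube_rat c r : 0 < r -> exists u, cube c r (ratv u).
Proof.
move=> r0.
have /choice[u uP] : forall i, exists q : rat, `|ratr q - c ord0 i| < r.
  move=> i; have /rat_in_itvoo[q] : c ord0 i - r < c ord0 i + r by lra.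
  by rewrite in_itv/= -ltr_distl => ?; exists q.
by exists (\row_i u i) => i; rewrite !mxE.
Qed.

(** Disjoint cubes contain different rational points, whence the
    enumeration; degenerate cubes fill the unused indices. *)
Lemma vitali_sequence (n0 : (0 < n)%N) V (M : R) : (forall Q, V Q -> 0 < Q.2 <= M) ->
  exists F : nat -> 'rV[R]_n * R,
    [/\ forall j, V (F j) \/ (F j).2 = 0,
        trivIset setT (fun j => cube (F j).1 (F j).2) &
        forall Q, V Q -> (cube Q.1 Q.2 `<=`
          \bigcup_j cube (F j).1 (5 * (F j).2))%classic].
Proof.
move=> VM; have [D [DV Ddisj Dcov]] := vitali_cubes V M VM.
have V0 Q : V Q -> 0 < Q.2 by move=> /VM/andP[].
have /choice[u uP] : forall Q : 'rV[R]_n * R, exists u, V Q -> cube Q.1 Q.2 (ratv u).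
  move=> Q; have [VQ|nVQ] := pselect (V Q); last by exists 0.
  by have [u Qu] := cube_rat Q.1 Q.2 (V0 _ VQ); exists u.
pose S j := [set Q | D Q /\ pickle (u Q) = j].
pose F j : 'rV[R]_n * R := xget (0, 0) (S j).
have FP j : S j (F j) \/ (F j).2 = 0.
  have [[Q SQ]|no] := pselect (exists Q, S j Q); first by left; exact: xgetI SQ.
  by right; rewrite /F xgetPN// => Q SQ; apply: no; exists Q.
exists F; split.
- by move=> j; have [[/DV]|] := FP j; [left|right].
- apply/trivIsetP => i j _ _ ij.
  have [[Di ei]|Fi0] := FP i; last by rewrite Fi0 (cube0 n0 (F i).1)// set0I.
  have [[Dj ej]|Fj0] := FP j; last by rewrite Fj0 (cube0 n0 (F j).1)// setI0.
  apply/eqP; apply: contrapT => /negP /set0P meet.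
  by move/negP: ij; apply; rewrite -ei -ej (Ddisj _ _ Di Dj meet).
- move=> Q /Dcov[P DP QP] x /QP xP; exists (pickle (u P)) => //.
  have [[DF eF]|F0] := FP (pickle (u P)).
    have uPF := pcan_inj pickleK eF.
    rewrite -(Ddisj _ _ DP DF)//; exists (ratv (u P)); split; first exact (uP _ (DV _ DP)).
    by have := uP _ (DV _ DF); rewrite uPF.
  have SP : S (pickle (u P)) P by [].
  have := xgetI (0, 0) SP; rewrite -/(F _) => -[/DV/V0].
  by rewrite F0 ltxx.
Qed.

(** Openness for the maximum norm, expressed by cubes; a countable base of rational
    cubes makes such sets Borel. *)
Definition cube_open (U : set 'rV[R]_n) :=
  forall x, U x -> exists2 r, 0 < r & (cube x r `<=` U)%classic.

Lemma cube_open_bigcup {I} (B : set I) (U : I -> set 'rV[R]_n) :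
  (forall i, B i -> cube_open (U i)) -> cube_open (\bigcup_(i in B) U i).
Proof.
move=> oU x [i Bi Uix]; have [r r0 xr] := oU i Bi x Uix.
by exists r => // y /xr; exists i.
Qed.

Lemma cube_openI (U U' : set 'rV[R]_n) :
  cube_open U -> cube_open U' -> cube_open (U `&` U').
Proof.
move=> oU oU' x [Ux Ux'].
have [r r0 xr] := oU _ Ux; have [s s0 xs] := oU' _ Ux'.
exists (Num.min r s); first by rewrite lt_min r0.
move=> y yx; split; [apply: xr|apply: xs]; apply: cubeS yx;
  by rewrite ge_min lexx ?orbT.
Qed.

Lemma cube_open_cube c r : cube_open (cube c r).
Proof.
move=> x xc; have [r0|r0] := ltP 0 r; first exact: cube_recenter.
have [n0|n0] := ltnP 0 n; first by move: xc; rewrite cube0.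
by exists 1 => // y _ i; have := leq_trans (ltn_ord i) n0.
Qed.

Lemma borel_measurable_cube_open (U : set 'rV[R]_n) : cube_open U -> measurable U.
Proof.
move=> oU.
pose inside j := if unpickle j is Some (u, q) then
  if `[< (cube (ratv u) (ratr q) `<=` U)%classic >] then cube (ratv u) (ratr q)
  else set0 else set0 : set 'rV[R]_n.
suff -> : U = \bigcup_j inside j.
  apply: bigcup_measurable => j _; rewrite /inside.
  case: unpickle => [[u q]|]; last exact: measurable0.
  case: ifP => _; last exact: measurable0.
  rewrite (_ : cube _ _ = box (ratv u - const_mx (ratr q)) (ratv u + const_mx (ratr q))).
    exact: measurable_box.
  by apply/seteqP; split => x cx i; have := cx i; rewrite !mxE ltr_distl.
apply/seteqP; split => x; last first.
  move=> [j _]; rewrite /inside; case: unpickle => [[u q]|]//.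
  by case: asboolP => // + xu; apply.
move=> Ux; have [r r0 xr] := oU x Ux.
have /rat_in_itvoo[q] : r / 4 < r / 3 by lra.
rewrite in_itv/= => /andP[rq qr].
have q0 : 0 < ratr q :> R by lra.
have [u ux] := cube_rat x (ratr q) q0.
have xu : cube (ratv u) (ratr q) x by move=> i; rewrite distrC; exact: ux.
have uU : (cube (ratv u) (ratr q) `<=` U)%classic.
  apply: subset_trans xr; apply: subset_trans (cube_engulf _ _ x (ratr q) _) _.
    by exists x; split => //; exact: cube_center.
  by apply: cubeS; lra.
exists (pickle (u, q)) => //; rewrite /inside pickleK.
by case: asboolP.
Qed.

Lemma measurable_cube_open (U : set 'rV[R]_n) : cube_open U -> measurable (U : set (Rn R n)).
Proof. by move=> /borel_measurable_cube_open; exact: borel_measurable_Rn. Qed.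

End cube_geometry.

(** * Outer regularity by open sets *)

Section outer_regularity.
Context {R : realType} {n : nat}.
Local Notation mu := (lebesgue_rV R n).
Local Open Scope ereal_scope.

Lemma measure_nonincreasing_lt {d} {T : measurableType d} (beta : {measure set T -> \bar R})
    (G : nat -> set T) (e : \bar R) :
  (forall k, measurable (G k)) -> {homo G : k l / (k <= l)%N >-> (l <= k)%O} ->
  beta (G 0%N) < +oo -> beta (\bigcap_k G k) < e -> exists k, beta (G k) < e.
Proof.
move=> mG Gdec G0 Ge.
have cvgG := nonincreasing_cvg_mu G0 mG (bigcapT_measurable mG) Gdec.
have dec : {homo (beta \o G) : k l / (k <= l)%N >-> l <= k}.
  by move=> k l kl; apply: le_measure; rewrite ?inE//; apply/subsetPset/Gdec.
have := cvg_unique _ cvgG (ereal_nonincreasing_cvgn dec) => Ginf.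
by have := Ge; rewrite Ginf // => /ereal_inf_lt[_ [k _ <-] ?]; exists k.
Qed.

(** The approximation is two-sided so that the class of these sets is closed under
    complements. *)
Definition squeezable (beta : {measure set 'rV[R]_n -> \bar R}) (A : set 'rV[R]_n) :=
  forall e : R, (0 < e)%R -> exists U F : set 'rV[R]_n,
    [/\ cube_open U, cube_open (~` F), F `<=` A, A `<=` U & beta (U `\` F) <= e%:E].

(** A countable union of closed sets need not be closed, but finitely many of them
    suffice up to a small measure: this is where [beta] has to be finite. *)
Lemma sigma_algebra_squeezable (beta : {measure set 'rV[R]_n -> \bar R}) :
  beta setT < +oo -> sigma_algebra setT (squeezable beta).
Proof.
move=> betafin; split.
- move=> e e0; exists set0, set0; split => //.
    by rewrite setC0 => x _; exists 1%R.
  by rewrite setD0 measure0 lee_fin ltW.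
- move=> A sA e /sA[U [F [oO oF FA AO OF]]]; exists (~` F), (~` U).
  rewrite setCK setTD; split => //; try exact: subsetC.
  by rewrite setDE setCK setIC -setDE.
- move=> A sA e e0.
  have ek (k : nat) : (0 < e / 2 / (2 ^ k.+1)%:R)%R by rewrite !divr_gt0// ltr0n expn_gt0.
  have /choice[U /choice[F OF]] := fun k => sA k _ (ek k).
  have oO : cube_open (\bigcup_k U k).
    by apply: cube_open_bigcup => k _; have [] := OF k.
  have mO k : measurable (U k) by apply: borel_measurable_cube_open; have [] := OF k.
  have mF k : measurable (F k).
    rewrite -[F k]setCK; apply: measurableC; apply: borel_measurable_cube_open.
    by have [] := OF k.
  have oF N : cube_open (~` \big[setU/set0]_(k < N) F k).
    elim: N => [|N IHN]; first by rewrite big_ord0 setC0 => x _; exists 1%R.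
    rewrite big_ord_recr/= setCU; apply: cube_openI => //.
    by have [] := OF N.
  pose G N := (\bigcup_k U k) `\` \big[setU/set0]_(k < N) F k.
  have mG N : measurable (G N).
    apply: measurableD; first exact: bigcup_measurable.
    exact: bigsetU_measurable.
  have [ | | |N GN] := measure_nonincreasing_lt beta G e%:E mG.
  + move=> k l kl; apply/subsetPset => x [Ox Fx]; split => // Fkx; apply: Fx.
    exact: (subset_bigsetU kl Fkx).
  + apply: le_lt_trans betafin; apply: le_measure => //; rewrite inE//.
    + apply: (@le_lt_trans _ _ (e / 2)%:E); last by rewrite lte_fin ltr_pdivrMr// ltr_pMr// ltr1n.
    apply: le_trans (epsilon_trick0 xpredT _); last by rewrite divr_ge0// ltW.
    apply: (@le_trans _ _ (\sum_(0 <= i <oo) beta (U i `\` F i))); last first.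
      by apply: lee_nneseries => // i _; have [_ _ _ _ +] := OF i.
    apply: measure_sigma_subadditive.
    * by move=> k; apply: measurableD.
    * exact: bigcapT_measurable.
    * move=> x Gx; have [[k _ Okx] _] := Gx 0%N Logic.I.
      exists k => //; split => // Fkx; have [_] := Gx k.+1 Logic.I.
      by apply; rewrite big_ord_recr; right.
  exists (\bigcup_k U k), (\big[setU/set0]_(k < N) F k); split => //.
  + apply: subset_trans (@bigsetU_bigcup _ F N) _ => x [k _ Fkx].
    by exists k => //; have [_ _ + _ _] := OF k; exact.
  + by move=> x [k _ Akx]; exists k => //; have [_ _ _ + _] := OF k; apply.
  + exact: ltW.
Qed.

Lemma squeezable_coord_ray (beta : {measure set 'rV[R]_n -> \bar R}) (i : 'I_n) (a : R) :
  beta setT < +oo -> squeezable beta (rV_coord i @^-1` `]a, +oo[%classic).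
Proof.
move=> betafin e e0.
pose U (b : R) := rV_coord i @^-1` `]b, +oo[%classic : set 'rV[R]_n.
pose F (b : R) := rV_coord i @^-1` `[b, +oo[%classic : set 'rV[R]_n.
have oO b : cube_open (U b).
  move=> x; rewrite /U/= in_itv/= andbT => bx.
  exists (x ord0 i - b)%R; first by rewrite subr_gt0.
  move=> y /(_ i) yx; rewrite /= in_itv/= andbT /rV_coord in bx *.
  by move: yx; rewrite ltr_distl => /andP[]; rewrite subKr.
have oF b : cube_open (~` F b).
  move=> x; rewrite /F/= in_itv/= andbT => /negP; rewrite -ltNge => bx.
  exists (b - x ord0 i)%R; first by rewrite subr_gt0.
  move=> y /(_ i) yx; rewrite /= in_itv/= andbT /rV_coord in bx *.
  apply/negP; rewrite -ltNge.
  by move: yx; rewrite ltr_distl => /andP[_]; rewrite addrC subrK.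
pose G (k : nat) := U a `\` F (a + k.+1%:R^-1)%R.
have mG k : measurable (G k).
  apply: measurableD; first exact: borel_measurable_cube_open.
  rewrite -[F _]setCK; apply: measurableC; exact: borel_measurable_cube_open.
have [ | | |N GN] := measure_nonincreasing_lt beta G e%:E mG.
- move=> k l kl; apply/subsetPset => x; rewrite /G /U /F/= !in_itv/= !andbT.
  move=> [ax /negP xa]; split => //; apply/negP; apply: contra xa; apply: le_trans.
  by rewrite lerD2l lef_pV2 ?posrE// ler_nat ltnS.
- apply: le_lt_trans betafin; apply: le_measure => //; 
    rewrite inE//.
- rewrite (_ : \bigcap_k G k = set0) ?measure0 ?lte_fin//.
  apply/seteqP; split => // x Gx.
  have [] := Gx 0%N Logic.I; rewrite /U/= in_itv/= andbT => ax _.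
  have xa0 : (0 < rV_coord i x - a)%R by rewrite subr_gt0.
  have [N _ /(_ N (leqnn N)) NP] := near_infty_natSinv_lt (PosNum xa0).
  have [_] := Gx N Logic.I; apply; rewrite /F/= in_itv/= andbT.
  by move: NP => /= /ltW; rewrite lerBrDl.
- exists (U a), (F (a + N.+1%:R^-1)%R); split => //; last exact: ltW.
  move=> x; rewrite /F/= !in_itv/= !andbT; apply: lt_le_trans.
  by rewrite ltrDl.
Qed.

Lemma borel_squeezable (beta : {measure set 'rV[R]_n -> \bar R}) (A : set 'rV[R]_n) :
  beta setT < +oo -> measurable A -> squeezable beta A.
Proof.
move=> betafin; apply: smallest_sub; first exact: sigma_algebra_squeezable.
move=> B; rewrite -bigcup_seq/= => -[i _ [C mC <-]]; rewrite setTI.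
have [s0 sC sU] := sigma_algebra_squeezable beta betafin.
pose good := [set C | squeezable beta (rV_coord i @^-1` C)].
suff : good C by [].
have GC := eq_ind _ (fun X : Prop => X) mC _
  (congr1 (fun S : set (set R) => S C) (measurable_realfun.RGenOInfty.measurableE R)).
move: C GC {mC}; apply: smallest_sub.
  split; rewrite /good/=.
  - by rewrite preimage_set0.
  - by move=> B' /sC; rewrite !setTD preimage_setC.
  - by move=> B' /sU; rewrite preimage_bigcup.
by move=> _ [a ->]; exact: squeezable_coord_ray.
Qed.

(** Confining everything to a cube makes the Borel measure finite, so that the
    approximation of Borel sets applies to a Borel cover of [G] of almost the same
    measure. *)
Lemma outer_regularity (n0 : (0 < n)%N) (c : 'rV[R]_n) (r : R) (G : set (Rn R n)) (e : R) :
  (0 < e)%R -> G `<=` cube c r ->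
  exists U : set 'rV[R]_n, [/\ cube_open U, G `<=` U & mu U <= mu G + e%:E].
Proof.
move=> e0 Gcr.
have muG : mu G \is a fin_num.
  rewrite ge0_fin_numE//; apply: (@le_lt_trans _ _ (mu (cube c r))).
    exact: (le_outer_measure (borel_lebesgue n)^*%mu).
  exact: mu_cube_lty.
have [_ [B [mB GB] <-] Be] := lb_ereal_inf_adherent (divr_gt0 e0 (ltr0n _ 2)) muG.
pose beta := mrestr (borel_lebesgue n) (borel_measurable_cube_open _ (cube_open_cube c r)).
have betafin : beta setT < +oo.
  rewrite /beta /mrestr setTI.
  rewrite -(measurable_mu_extE (borel_lebesgue n)); last first.
    exact: (borel_measurable_cube_open _ (cube_open_cube c r)).
  exact: mu_cube_lty.
have mUB : measurable (\bigcup_k B k) by exact: bigcup_measurable.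
have [U [F [oO oF FB BO OF]]] := borel_squeezable beta _ betafin mUB _ (divr_gt0 e0 (ltr0n _ 2)).
exists (U `&` cube c r); split.
- by apply: cube_openI => //; exact: cube_open_cube.
- by move=> x Gx; split; [apply/BO/GB|exact: Gcr].
have mO := borel_measurable_cube_open _ oO.
have mQ := borel_measurable_cube_open _ (cube_open_cube c r).
have mF : measurable F by rewrite -[F]setCK; apply: measurableC; exact: borel_measurable_cube_open.
rewrite /lebesgue_rV/= /completed_measure_extension measurable_mu_extE; last exact: measurableI.
apply: (@le_trans _ _ (borel_lebesgue n (\bigcup_k B k) + beta (U `\` F))).
  rewrite /beta /mrestr.
  apply: (@le_trans _ _ (borel_lebesgue n ((\bigcup_k B k) `|` ((U `\` F) `&` cube c r)))).
    apply: le_measure; rewrite ?inE.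
    - exact: measurableI.
    - by apply: measurableU => //; apply: measurableI => //; apply: measurableD.
    - move=> x [Ox Qx]; have [Bx|nBx] := pselect ((\bigcup_k B k) x); [by left|right].
      by split => //; split => // /FB.
  by apply: measureU2 => //; apply: measurableI => //; apply: measurableD.
rewrite [X in _ <= _ + X%:E]splitr EFinD addeA leeD//.
apply: ltW; apply: le_lt_trans Be.
by apply: measure_sigma_subadditive.
Qed.

End outer_regularity.

(** * The covering estimate *)

Lemma nneseries_le {R : realType} (u : nat -> \bar R) (M : \bar R) :
  (forall j, 0 <= u j)%E -> (forall N, \sum_(j < N) u j <= M)%E ->
  (\sum_(0 <= j <oo) u j <= M)%E.
Proof.
move=> u0 uM; apply: lime_le; first by apply: is_cvg_nneseries => j _ _; exact: u0.
by apply: nearW => N; rewrite big_mkord.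
Qed.

Section mass.
Context {d : measure_display} {T : measurableType d} {R : realType}.
Context (mu : {measure set T -> \bar R}).

Definition mass (f : T -> R) (A : set T) : \bar R := (\int[mu]_(x in A) (f x)%:E)%E.

Definition nonneg_fun (f : T -> R) := measurable_fun setT f /\ forall x, 0 <= f x.

Context (f : T -> R) (f_nn : nonneg_fun f).
Implicit Types (A B : set T).

Local Open Scope ereal_scope.

Lemma nonneg_fun_EFin A : measurable_fun A (fun x => (f x)%:E).
Proof. by apply/measurable_EFinP; apply: measurable_funTS; exact: f_nn.1. Qed.

Lemma mass_ge0 A : 0 <= mass f A.
Proof. by apply: integral_ge0 => x _; rewrite lee_fin; exact: f_nn.2. Qed.

Lemma mass_le A B : measurable A -> measurable B -> A `<=` B -> mass f A <= mass f B.
Proof.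
move=> mA mB AB; apply: ge0_subset_integral => //; first exact: nonneg_fun_EFin.
by move=> x _; rewrite lee_fin; exact: f_nn.2.
Qed.

Lemma mass_bigcup (A : nat -> set T) : (forall j, measurable (A j)) ->
  trivIset setT A -> mass f (\bigcup_j A j) = \sum_(0 <= j <oo) mass f (A j).
Proof.
move=> mA tA; apply: ge0_integral_bigcup => //; first exact: nonneg_fun_EFin.
by move=> x _; rewrite lee_fin; exact: f_nn.2.
Qed.

Lemma mass_disjoint_le (A : nat -> set T) B : (forall j, measurable (A j)) ->
  trivIset setT A -> measurable B -> (forall j, A j `<=` B) ->
  \sum_(0 <= j <oo) mass f (A j) <= mass f B.
Proof.
move=> mA tA mB AB; rewrite -mass_bigcup//; apply: mass_le => //.
  exact: bigcup_measurable.
by move=> x [j _] /AB.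
Qed.

Lemma mass_bigcup_le (A : nat -> set T) : (forall j, measurable (A j)) ->
  mass f (\bigcup_j A j) <= \sum_(0 <= j <oo) mass f (A j).
Proof.
move=> mA.
have mD j : measurable (seqDU A j).
  by apply: measurableD => //; exact: bigsetU_measurable.
rewrite seqDU_bigcup_eq mass_bigcup//.
apply: lee_nneseries => [j _ _|j _]; first exact: mass_ge0.
by apply: mass_le => //; exact: subset_seqDU.
Qed.

Lemma massU A B : measurable A -> measurable B -> [disjoint A & B] ->
  mass f (A `|` B) = mass f A + mass f B.
Proof.
move=> mA mB AB; rewrite /mass ge0_integral_setU//; first exact: nonneg_fun_EFin.
by move=> x _; rewrite lee_fin; exact: f_nn.2.
Qed.

End mass.

Section covering_estimate.
Context {R : realType} {n : nat}.
Local Notation mu := (lebesgue_rV R n).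

Definition cube_union (V : set ('rV[R]_n * R)) : set (Rn R n) :=
  \bigcup_(Q in V) cube Q.1 Q.2.

Lemma cube_open_union (V : set ('rV[R]_n * R)) : cube_open (cube_union V).
Proof. by apply: cube_open_bigcup => Q _; exact: cube_open_cube. Qed.

Lemma measurable_cube_union (V : set ('rV[R]_n * R)) : measurable (cube_union V).
Proof. by apply: measurable_cube_open; exact: cube_open_union. Qed.

Lemma mu_le (A B : set (Rn R n)) : (A `<=` B)%classic -> (mu A <= mu B)%E.
Proof. exact: (le_outer_measure (borel_lebesgue n)^*%mu). Qed.

Lemma mu_bigcup_le (A : nat -> set (Rn R n)) :
  (mu (\bigcup_j A j) <= \sum_(0 <= j <oo) mu (A j))%E.
Proof. exact: (outer_measure_sigma_subadditive (borel_lebesgue n)^*%mu). Qed.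

Lemma mu_disjoint_le (A : nat -> set (Rn R n)) (B : set (Rn R n)) :
  (forall j, measurable (A j)) -> trivIset setT A -> (forall j, (A j `<=` B)%classic) ->
  (\sum_(0 <= j <oo) mu (A j) <= mu B)%E.
Proof.
move=> mA tA AB.
have <- : mu (\bigcup_j A j) = (\sum_(0 <= j <oo) mu (A j))%E.
  by rewrite measure_bigcup//; apply: eq_eseriesl => j; rewrite in_setT.
by apply: mu_le => x [j _ /AB].
Qed.

Lemma radius_le (n0 : (0 < n)%N) (r M : R) : 0 <= M -> (2 * r) ^+ n <= M -> r <= 1 + M.
Proof.
move=> M0 rM; rewrite leNgt; apply/negP => Mr.
have : 2 * r <= (2 * r) ^+ n by rewrite -[leLHS]expr1 ler_weXn2l//; lra.
by move: rM; lra.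
Qed.

(** The powers are summable over disjoint cubes because their exponents
    add up to at least 1; this is where the disjointness obtained from the Vitali
    covering is used. *)
Lemma mu_cube_union_le (n0 : (0 < n)%N) {I : finType} (h : I -> Rn R n -> R) (s : I -> R)
    (U : set (Rn R n)) (K : R) (V : set ('rV[R]_n * R)) :
  (forall i, nonneg_fun (h i)) -> (forall i, mass mu (h i) U < +oo)%E -> measurable U ->
  (forall i, 0 <= s i) -> 1 <= \sum_i s i -> 0 <= K ->
  (forall Q, V Q -> [/\ 0 < Q.2, (cube Q.1 Q.2 `<=` U)%classic &
    (2 * Q.2) ^+ n <= K * \prod_i fine (mass mu (h i) (cube Q.1 Q.2)) `^ s i]) ->
  (mu (cube_union V) <= (5 ^+ n * (K * \prod_i fine (mass mu (h i) U) `^ s i))%:E)%E.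
Proof.
move=> hnn hU mU s0 s1 K0 VP.
pose b i := fine (mass mu (h i) U).
have fb i A : measurable A -> (A `<=` U)%classic -> mass mu (h i) A \is a fin_num.
  move=> mA AU; rewrite ge0_fin_numE ?mass_ge0//.
  exact: (le_lt_trans (mass_le mu _ (hnn i) _ _ mA mU AU)).
have bE i A : measurable A -> (A `<=` U)%classic -> fine (mass mu (h i) A) <= b i.
  by move=> mA AU; rewrite fine_le ?fb// mass_le.
have m0 i A : 0 <= fine (mass mu (h i) A) by rewrite fine_ge0// mass_ge0.
have b0 i : 0 <= b i by exact: m0.
pose M := K * \prod_i b i `^ s i.
have M0 : 0 <= M by rewrite mulr_ge0// prodr_ge0// => i _; exact: powR_ge0.
have radV Q : V Q -> 0 < Q.2 <= 1 + M.
  move=> /VP[Q0 QU QM]; rewrite Q0/=; apply: (radius_le n0) => //.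
  apply: le_trans QM _; rewrite ler_wpM2l// ler_prod// => i _.
  rewrite powR_ge0/= ge0_ler_powR ?nnegrE//.
  by apply: bE => //; exact: measurable_cube.
have [F [FV Fdisj Fcov]] := vitali_sequence n0 V _ radV.
have F0 j : 0 <= (F j).2 by have [/VP[/ltW]|->] := FV j.
have FU j : (cube (F j).1 (F j).2 `<=` U)%classic.
  by have [/VP[]//|->] := FV j; rewrite cube0.
have mF j : measurable (cube (F j).1 (F j).2 : set (Rn R n)) by exact: measurable_cube.
apply: (@le_trans _ _ (mu (\bigcup_j cube (F j).1 (5 * (F j).2)))).
  by apply: mu_le => x [Q VQ Qx]; exact: Fcov Qx.
apply: le_trans (mu_bigcup_le _) _; apply: nneseries_le => [j|N].
  exact: measure_ge0.
rewrite (eq_bigr (fun j : 'I_N => (5 ^+ n * (2 * (F j).2) ^+ n)%:E)) => [|j _]; last first.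
  by rewrite mu_cube// ?mulr_ge0// mulrCA exprMn.
rewrite sumEFin lee_fin -mulr_sumr ler_wpM2l ?exprn_ge0//.
apply: (@le_trans _ _ (\sum_(j < N) K * \prod_i fine (mass mu (h i) (cube (F j).1 (F j).2)) `^ s i)).
  apply: ler_sum => j _; have [/VP[]//|->] := FV j.
  rewrite mulr0 expr0n eqn0Ngt n0/= mulr_ge0// prodr_ge0// => i _; exact: powR_ge0.
rewrite -mulr_sumr ler_wpM2l//.
apply: le_trans (sum_prod_powR_le _ _ _ s0 s1) _ => //.
apply: ler_prod => i _; rewrite powR_ge0/= ge0_ler_powR ?nnegrE ?sumr_ge0//.
rewrite -lee_fin -sumEFin fineK; last exact: fb.
apply: le_trans (mass_disjoint_le mu _ (hnn i) _ _ mF Fdisj mU FU).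
rewrite (eq_bigr (fun j : 'I_N => mass mu (h i) (cube (F j).1 (F j).2))) => [|j _].
  rewrite -(big_mkord xpredT (fun j => mass mu (h i) (cube (F j).1 (F j).2))).
  by apply: nneseries_lim_ge => j _ _; exact: mass_ge0.
by rewrite fineK// fb.
Qed.

End covering_estimate.

(** * Stopping cubes *)

Section stopping_cubes.
Context {R : realType} {n : nat}.
Local Notation mu := (lebesgue_rV R n).

Definition locally_finite (h : Rn R n -> R) :=
  forall (c : 'rV[R]_n) r, (mass mu h (cube c r) < +oo)%E.

Definition cube_mass (h : Rn R n -> R) (Q : 'rV[R]_n * R) : R :=
  fine (mass mu h (cube Q.1 Q.2)).

Lemma cube_mass_ge0 h Q : nonneg_fun h -> 0 <= cube_mass h Q.
Proof. by move=> hn; rewrite fine_ge0// mass_ge0. Qed.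

Lemma cube_massE h Q : nonneg_fun h -> locally_finite h ->
  mass mu h (cube Q.1 Q.2) = (cube_mass h Q)%:E.
Proof. by move=> hn hl; rewrite fineK// ge0_fin_numE ?mass_ge0. Qed.

Lemma cube_massS h (P Q : 'rV[R]_n * R) : nonneg_fun h -> locally_finite h ->
  (cube P.1 P.2 `<=` cube Q.1 Q.2)%classic -> cube_mass h P <= cube_mass h Q.
Proof.
move=> hn hl PQ; rewrite -lee_fin -!cube_massE//.
by apply: mass_le => //; exact: measurable_cube.
Qed.

(** The normalisation by [kap] covers at once the fractional products of averages,
    with [kap = m - alpha / n], and the plain averages, with one function and
    [kap = 1]. *)
Definition level {I : finType} (kap : R) (h : I -> Rn R n -> R) (Q : 'rV[R]_n * R) : R :=
  (\prod_i cube_mass (h i) Q) / ((2 * Q.2) ^+ n) `^ kap.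

Definition upper {I : finType} (kap : R) (h : I -> Rn R n -> R) (t : R) : set (Rn R n) :=
  cube_union [set Q | 0 < Q.2 /\ t < level kap h Q].

(** Up to a factor 2, a stopping cube is the largest cube around [x] on which the
    functional exceeds [t]. *)
Definition stopping {I : finType} (kap : R) (h : I -> Rn R n -> R) (t : R)
    (x : 'rV[R]_n) (Q : 'rV[R]_n * R) :=
  [/\ 0 < Q.2, cube Q.1 Q.2 x, t < level kap h Q &
    forall Q' : 'rV[R]_n * R, 0 < Q'.2 -> cube Q'.1 Q'.2 x -> 2 * Q.2 <= Q'.2 -> level kap h Q' <= t].

Context {I : finType} (kap : R) (h : I -> Rn R n -> R).
Hypothesis n0 : (0 < n)%N.
Hypothesis hnn : forall i, nonneg_fun (h i).
Hypothesis hloc : forall i, locally_finite (h i).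

Lemma level_ge0 Q : 0 <= level kap h Q.
Proof.
by rewrite divr_ge0 ?powR_ge0// prodr_ge0// => i _; exact: cube_mass_ge0.
Qed.

Lemma stopping_exists (t M : R) x : upper kap h t x ->
  (forall Q : 'rV[R]_n * R, 0 < Q.2 -> cube Q.1 Q.2 x -> t < level kap h Q -> Q.2 <= M) ->
  exists Q, stopping kap h t x Q.
Proof.
move=> [Q [/= Q0 tQ] Qx] QM.
pose S := [set Q.2 | Q in [set Q | [/\ 0 < Q.2, cube Q.1 Q.2 x & t < level kap h Q]]].
have supS : has_sup S.
  split; first by exists Q.2; exists Q.
  by exists M => _ [P [P0 Px tP] <-]; exact: QM.
have S0 : 0 < sup S.
  by apply: (lt_le_trans Q0); apply: sup_upper_bound => //; exists Q.
have [_ [P [P0 Px tP] <-] supP] : exists2 r, S r & sup S / 2 < r.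
  by apply: sup_gt => //; [exact: supS.1 | lra].
exists P; split => // P' P'0 P'x PP'; rewrite leNgt; apply/negP => tP'.
have : P'.2 <= sup S by apply: sup_upper_bound => //; exists P'.
by lra.
Qed.

(** Chosen so that [5 ^+ n * 3 ^+ n / jump `^ kap^-1] is one half. *)
Definition jump : R := (2 * 15 ^+ n) `^ kap.

(** Near a stopping cube [Q] the functional cannot become much
    larger than [t] at large scale: a cube of at least the size of [Q] on which it
    exceeds [jump * t] would force, after dilation by 3, a violation of the
    maximality of [Q]. The small cubes lie in [3Q], where the covering estimate
    bounds their union by the value of the functional on [3Q], which is at most [t]. *)
Lemma stopping_half (t : R) x Q : 0 < t -> 0 < kap -> kap <= #|I|%:R ->
  stopping kap h t x Q ->
  (mu (cube Q.1 Q.2 `&` upper kap h (jump * t)) <= ((2 * Q.2) ^+ n / 2)%:E)%E.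
Proof.
move=> t0 kap0 kapI [Q0 Qx tQ Qmax].
have jump0 : 0 < jump by rewrite powR_gt0// mulr_gt0// exprn_gt0.
pose Q3 := (Q.1, 3 * Q.2).
have Q3x : cube Q3.1 Q3.2 x by apply: cubeS Qx; rewrite /=; lra.
have lQ3 : level kap h Q3 <= t by apply: Qmax => //=; lra.
pose V := [set P | [/\ 0 < P.2, (cube P.1 P.2 `<=` cube Q3.1 Q3.2)%classic &
  jump * t < level kap h P]].
apply: (@le_trans _ _ (mu (cube_union V))).
  apply: mu_le => y [Qy [P [/= P0 tP] Py]]; exists P => //; split => //.
  have [PQ|QP] := ltP P.2 Q.2.
    apply: subset_trans (cube_engulf _ _ Q.1 Q.2 _) _; first by exists y.
    by apply: cubeS; rewrite /=; lra.
  exfalso; pose P3 := (P.1, 3 * P.2).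
  have QP3 : (cube Q.1 Q.2 `<=` cube P3.1 P3.2)%classic.
    apply: subset_trans (cube_engulf _ _ P.1 P.2 _) _; first by exists y.
    by apply: cubeS; rewrite /=; lra.
  have lP3 : level kap h P3 <= t by apply: Qmax => //=; [lra|exact: QP3|lra].
  suff : level kap h P <= jump * level kap h P3.
    apply/negP; rewrite -ltNge; apply: le_lt_trans tP.
    by rewrite ler_wpM2l// ltW.
  rewrite /level mulrCA ler_pM ?invr_ge0 ?powR_ge0//.
  - by rewrite prodr_ge0// => i _; exact: cube_mass_ge0.
  - apply: ler_prod => i _; rewrite cube_mass_ge0//= cube_massS//.
    by apply: cubeS; rewrite /=; lra.
  - rewrite /= (_ : 2 * (3 * P.2) = 3 * (2 * P.2)); last by ring.
    have : 0 < 2 * P.2 by lra.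
    move: (2 * P.2) => u u0.
    rewrite exprMn powRM ?exprn_ge0 ?(ltW u0)// invfM mulrA ler_peMl//.
      by rewrite invr_ge0 powR_ge0.
    rewrite ler_pdivlMr ?powR_gt0 ?exprn_gt0// mul1r.
    rewrite /jump ge0_ler_powR ?(ltW kap0) ?nnegrE ?mulr_ge0 ?exprn_ge0//.
    apply: (@le_trans _ _ (15 ^+ n)); first by rewrite lerXn2r ?nnegrE//; lra.
    by rewrite ler_peMl ?exprn_ge0//; lra.
have kn0 : kap != 0 by rewrite gt_eqF.
have Jt0 : 0 < jump * t by rewrite mulr_gt0.
apply: le_trans (mu_cube_union_le n0 h (fun=> kap^-1) (cube Q3.1 Q3.2)
   ((jump * t) `^ (- kap^-1)) V hnn _ _ _ _ _ _) _.
- by move=> i; exact: hloc.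
- exact: measurable_cube.
- by move=> _; rewrite invr_ge0 ltW.
- by rewrite sumr_const -mulr_natr ler_pdivlMl// mulr1.
- exact: powR_ge0.
- move=> P [P0 PQ3 tP]; split => //.
  rewrite prod_powR_base => [|i]; last exact: cube_mass_ge0.
  have P2n : 0 <= (2 * P.2) ^+ n by rewrite exprn_ge0//; lra.
  rewrite powRN -[leLHS](powRK _ kap)// ler_pdivlMl ?powR_gt0//.
  rewrite -powRM ?powR_ge0//; last exact: ltW.
  have c0 : 0 <= \prod_i cube_mass (h i) P.
    by rewrite prodr_ge0// => i _; exact: cube_mass_ge0.
  rewrite ge0_ler_powR ?invr_ge0 ?nnegrE ?(ltW kap0)//.
    by rewrite mulr_ge0 ?powR_ge0 ?(ltW Jt0).
  rewrite -ler_pdivlMr; first exact: ltW.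
  by rewrite powR_gt0// exprn_gt0//; lra.
- rewrite lee_fin prod_powR_base => [|i]; last exact: cube_mass_ge0.
  rewrite -[X in _ * (_ * X `^ _) <= _]/(\prod_i cube_mass (h i) Q3).
  have Q2n : 0 < (2 * Q.2) ^+ n by rewrite exprn_gt0//; lra.
  have -> : (2 * Q.2) ^+ n / 2 = 5 ^+ n * ((jump * t) `^ (- kap^-1) *
      ((jump * t) * (3 ^+ n * (2 * Q.2) ^+ n / (2 * 15 ^+ n)) `^ kap) `^ kap^-1).
    rewrite powR_scaleK//; last by rewrite divr_ge0 ?mulr_ge0 ?exprn_ge0//; lra.
    rewrite (_ : 15 = 3 * 5 :> R); last by rewrite -natrM.
    rewrite [(3 * 5) ^+ n]exprMn; field.
    by rewrite !expf_eq0 !pnatr_eq0/= !andbF.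
  rewrite ler_wpM2l ?exprn_ge0// ler_wpM2l ?powR_ge0//.
  have c0 : 0 <= \prod_i cube_mass (h i) Q3.
    by rewrite prodr_ge0// => i _; exact: cube_mass_ge0.
  have z0 : 0 < 3 ^+ n * (2 * Q.2) ^+ n by rewrite mulr_gt0// exprn_gt0.
  have w0 : 0 < 2 * 15 ^+ n :> R by rewrite mulr_gt0// exprn_gt0.
  rewrite ge0_ler_powR ?invr_ge0 ?nnegrE ?(ltW kap0)//.
    by rewrite mulr_ge0 ?powR_ge0 ?(ltW Jt0).
  rewrite mulrAC -powRM ?(ltW w0) ?divr_ge0 ?(ltW z0)// mulrC.
  rewrite mulrCA divff ?mulr1 ?gt_eqF// -ler_pdivrMr ?powR_gt0//.
  by move: lQ3; rewrite /level /= (_ : 2 * (3 * Q.2) = 3 * (2 * Q.2)) ?exprMn//; ring.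
Qed.
End stopping_cubes.

Section stopping_remainder.
Context {R : realType} {n : nat}.
Local Notation mu := (lebesgue_rV R n).

Lemma stopping_remainder (n0 : (0 < n)%N) {I : finType} (kap : R) (h : I -> Rn R n -> R)
    (t : R) x Q : (forall i, nonneg_fun (h i)) -> (forall i, locally_finite (h i)) ->
  0 < t -> 0 < kap -> kap <= #|I|%:R -> stopping kap h t x Q ->
  (((2 * Q.2) ^+ n / 2)%:E <= mu (cube Q.1 Q.2 `\` upper kap h (@jump R n kap * t)))%E.
Proof.
move=> hn hl t0 kap0 kapI sQ; have := stopping_half kap h n0 hn hl t x Q t0 kap0 kapI sQ.
have [/ltW Q0 _ _ _] := sQ; set U := upper _ _ _.
have mQ : measurable (cube Q.1 Q.2 : set (Rn R n)) by exact: measurable_cube.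
have mU : measurable U by exact: measurable_cube_union.
have split_mu : (mu (cube Q.1 Q.2 `&` U) + mu (cube Q.1 Q.2 `\` U) = ((2 * Q.2) ^+ n)%:E)%E.
  rewrite -(mu_cube n0 Q.1 Q.2 Q0) -[in RHS](setUIDK (cube Q.1 Q.2) U).
  rewrite measureU//; [exact: measurableI|exact: measurableD|].
  by apply/seteqP; split => // y [[_ ?] [_]].
have finI : mu (cube Q.1 Q.2 `&` U) \is a fin_num.
  rewrite ge0_fin_numE// (le_lt_trans _ (mu_cube_lty n0 Q.1 Q.2))//.
  by apply: mu_le => y [].
have finD : mu (cube Q.1 Q.2 `\` U) \is a fin_num.
  rewrite ge0_fin_numE// (le_lt_trans _ (mu_cube_lty n0 Q.1 Q.2))//.
  by apply: mu_le => y [].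
move: split_mu; rewrite -(fineK finI) -(fineK finD) -EFinD => -[e].
by rewrite !lee_fin; lra.
Qed.

End stopping_remainder.

(** * A weak differentiation theorem *)

Section weak_differentiation.
Context {R : realType} {n : nat}.
Local Notation mu := (lebesgue_rV R n).

Definition avg_upper (f : Rn R n -> R) (t : R) : set (Rn R n) :=
  upper 1 (fun _ : 'I_1 => f) t.

Lemma level1E (f : Rn R n -> R) (Q : 'rV[R]_n * R) : 0 <= Q.2 ->
  level 1 (fun _ : 'I_1 => f) Q = cube_mass f Q / (2 * Q.2) ^+ n.
Proof. by move=> Q0; rewrite /level big_ord1 powRr1// exprn_ge0// mulr_ge0. Qed.

Definition cutoff (v : Rn R n -> R) (A : set (Rn R n)) (x : Rn R n) : R := v x * \1_A x.

Lemma nonneg_fun_cutoff v (A : set (Rn R n)) : measurable A -> nonneg_fun v ->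
  nonneg_fun (cutoff v A).
Proof.
move=> mA [mv v0]; split; last by move=> x; rewrite mulr_ge0// indicE ler0n.
by apply: measurable_funM => //; exact: measurable_indic.
Qed.

Lemma mass_cutoff v (A B : set (Rn R n)) : measurable A -> measurable B ->
  mass mu (cutoff v A) B = mass mu v (A `&` B).
Proof.
move=> mA mB; rewrite /mass integral_mkcondl.
apply: eq_integral => x _; rewrite /cutoff patchE indicE.
by case: ifP => _; rewrite ?mulr1 ?mulr0.
Qed.

Lemma locally_finite_cutoff v (A : set (Rn R n)) : measurable A -> nonneg_fun v ->
  locally_finite v -> locally_finite (cutoff v A).
Proof.
move=> mA vn vl c r; have mQ := @measurable_cube R n c r.
rewrite mass_cutoff//; apply: le_lt_trans (vl c r).
by apply: mass_le => //; exact: measurableI.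
Qed.

Lemma measurable_ge_set (v : Rn R n -> R) (s : R) : measurable_fun setT v ->
  measurable [set x | s <= v x].
Proof.
move=> mv; have := mv measurableT `[s, +oo[%classic (measurable_itv _).
by rewrite setTI; congr measurable; apply/seteqP; split => x /=; rewrite in_itv/= andbT.
Qed.

(** A weak form of Lebesgue's differentiation theorem, in which losing a
    constant factor replaces the density of continuous functions by the outer
    regularity of the measure: if all the averages of [v] around the points of [G]
    were at most [t], a Vitali covering of [G] inside an open set of almost the same
    measure would bound the integral of [v] over [G] by [5 ^ n * t] times the
    measure of [G]. *)
Lemma weak_differentiation (n0 : (0 < n)%N) (v : Rn R n -> R) c r (t : R) :
  nonneg_fun v -> locally_finite v -> 0 < t ->
  mu (cube c r `&` [set x | (5 ^+ n + 1) * t <= v x]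
      `\` avg_upper (cutoff v (cube c r)) t) = 0%E.
Proof.
move=> vn vl t0; set Q0 := cube c r; set G := (X in mu X).
have mQ0 : measurable Q0 by exact: measurable_cube.
have mG : measurable G.
  apply: measurableD; last exact: measurable_cube_union.
  by apply: measurableI => //; apply: measurable_ge_set; exact: vn.1.
have GQ0 : (G `<=` Q0)%classic by move=> x [[]].
have muGfin : mu G \is a fin_num.
  rewrite ge0_fin_numE ?measure_ge0//.
  by apply: le_lt_trans (mu_cube_lty n0 c r); exact: mu_le.
have fivet0 : 0 < 5 ^+ n * t by rewrite mulr_gt0// exprn_gt0.
suff small e : 0 < e -> fine (mu G) <= 5 ^+ n * e.
  apply/eqP; rewrite eq_le measure_ge0 andbT -(fineK muGfin) lee_fin.
  apply/ler_addgt0Pr => e e0; rewrite add0r.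
  have := small (e / 5 ^+ n) (divr_gt0 e0 (exprn_gt0 _ (ltr0n _ 5))).
  by rewrite mulrC divfK// expf_neq0.
move=> e0; have [U [oU GU Ue]] := outer_regularity n0 c r G e e0 GQ0.
pose V := [set Q : 'rV[R]_n * R | [/\ G Q.1, 0 < Q.2 <= 1 & (cube Q.1 Q.2 `<=` U)%classic]].
have VM Q : V Q -> 0 < Q.2 <= 1 by case.
have [F [FV Fdisj Fcov]] := vitali_sequence n0 V 1 VM.
have F0 j : 0 <= (F j).2 by have [/VM/andP[/ltW]|->] := FV j.
have mF j s : measurable (cube (F j).1 s : set (Rn R n)) by exact: measurable_cube.
have GF : (G `<=` \bigcup_j (G `&` cube (F j).1 (5 * (F j).2)))%classic.
  move=> x Gx; have [s s0 xs] := oU x (GU x Gx).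
  have Vx : V (x, Num.min s 1).
    split => //=; first by rewrite lt_min s0 ltr01/= ge_min lexx orbT.
    by apply: subset_trans xs; apply: cubeS; rewrite ge_min lexx.
  have [j _ xj] : (\bigcup_j cube (F j).1 (5 * (F j).2)) x.
    by apply: Fcov Vx _ _; apply: cube_center; rewrite lt_min s0 ltr01.
  by exists j.
have lower : (((5 ^+ n + 1) * t)%:E * mu G <= mass mu v G)%E.
  rewrite -(integral_cst mu mG); apply: ge0_le_integral => //.
  - by move=> x _; rewrite lee_fin ltW// mulr_gt0// ltr_wpDl// ?exprn_ge0.
  - exact: nonneg_fun_EFin.
  - by move=> x [[_ ?] _]; rewrite lee_fin.
have upper_bound : (mass mu v G <= (5 ^+ n * t)%:E * mu U)%E.
  apply: (@le_trans _ _ (mass mu v (\bigcup_j (G `&` cube (F j).1 (5 * (F j).2))))).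
    apply: mass_le => //; apply: bigcup_measurable => j _; exact: measurableI.
  apply: le_trans (mass_bigcup_le _ _ vn _ _) _ => [j|]; first exact: measurableI.
  apply: (@le_trans _ _ (\sum_(0 <= j <oo) (5 ^+ n * t)%:E * mu (cube (F j).1 (F j).2))%E).
    apply: lee_nneseries => [j _ _|j _]; first exact: mass_ge0.
    rewrite mu_cube// -EFinM.
    have [[[[_ _] noup] /andP[r0 _] _]|->] := FV j; last first.
      rewrite mulr0 cube0// setI0 mulr0 expr0n eqn0Ngt n0 mulr0.
      by rewrite /mass integral_set0.
    apply: (@le_trans _ _ (mass mu v (Q0 `&` cube (F j).1 (5 * (F j).2)))).
      by apply: mass_le => //; [exact: measurableI..|exact: setSI].
    rewrite -mass_cutoff//.
    rewrite (cube_massE _ ((F j).1, 5 * (F j).2) (nonneg_fun_cutoff _ _ _ _))//; last exact: locally_finite_cutoff.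
    have : level 1 (fun _ : 'I_1 => cutoff v Q0) ((F j).1, 5 * (F j).2) <= t.
      rewrite leNgt; apply/negP => tlt; apply: noup.
      exists ((F j).1, 5 * (F j).2); last by apply: cube_center; rewrite mulr_gt0.
      by split => //=; rewrite mulr_gt0.
    rewrite level1E ?mulr_ge0// ler_pdivrMr ?exprn_gt0 ?mulr_gt0//=.
    by rewrite lee_fin mulrCA exprMn => /le_trans; apply; rewrite mulrCA mulrA.
  rewrite nneseriesZl; last by move=> j _; exact: measure_ge0.
  rewrite lee_wpmul2l ?lee_fin ?(ltW fivet0)//.
  apply: mu_disjoint_le => // j x.
  by have [[_ _]|->] := FV j; [apply|rewrite cube0].
have fivetE : (0 <= (5 ^+ n * t)%:E :> \bar R)%E by rewrite lee_fin ltW.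
have := le_trans lower (le_trans upper_bound (lee_wpmul2l fivetE Ue)).
rewrite -(fineK muGfin) -EFinD -!EFinM lee_fin => main.
rewrite -(ler_pM2l t0); move: main; set g := fine _; set f := 5 ^+ n.
by rewrite (_ : (f + 1) * t * g = f * t * g + t * g) ?mulrDr ?lerD2l ?(mulrCA t f e) ?mulrA//; ring.
Qed.

End weak_differentiation.

(** * The reverse Hoelder inequality for A_infty weights *)

Section reverse_hoelder.
Context {R : realType} {n : nat}.
Local Notation mu := (lebesgue_rV R n).
Implicit Types (Q : 'rV[R]_n * R).

(** The quantitative absolute continuity characterising the class A_infty. *)
Definition Ainfty (K tau : R) (v : Rn R n -> R) :=
  forall Q (E : set (Rn R n)), 0 < Q.2 -> measurable E -> (E `<=` cube Q.1 Q.2)%classic ->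
    fine (mu E) `^ tau * cube_mass v Q <= K * ((2 * Q.2) ^+ n) `^ tau * fine (mass mu v E).

Context (v : Rn R n -> R) (K tau : R).
Hypothesis n0 : (0 < n)%N.
Hypothesis vnn : nonneg_fun v.
Hypothesis vloc : locally_finite v.
Hypothesis vpos : forall Q, 0 < Q.2 -> 0 < cube_mass v Q.
Hypothesis tau0 : 0 <= tau.
Hypothesis K0 : 0 < K.
Hypothesis vA : Ainfty K tau v.

Let finv (A : set (Rn R n)) c r : measurable A -> (A `<=` cube c r)%classic ->
  mass mu v A \is a fin_num.
Proof.
move=> mA Ac; rewrite ge0_fin_numE ?mass_ge0//; apply: le_lt_trans (vloc c r).
by apply: mass_le => //; exact: measurable_cube.
Qed.

Lemma Ainfty_doubling (s : R) Q : 1 <= s -> 0 < Q.2 ->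
  cube_mass v (Q.1, s * Q.2) <= K * (s ^+ n) `^ tau * cube_mass v Q.
Proof.
move=> s1 Q0; have s0 : 0 < s by lra.
have sQ0 : 0 < (Q.1, s * Q.2).2 by rewrite /= mulr_gt0.
have := vA (Q.1, s * Q.2) (cube Q.1 Q.2) sQ0 (measurable_cube _ _).
have sub : (cube Q.1 Q.2 `<=` cube (Q.1, s * Q.2).1 (Q.1, s * Q.2).2)%classic.
  by apply: cubeS; rewrite /= ler_peMl// ltW.
move=> /(_ sub); rewrite mu_cube ?(ltW Q0)//=.
rewrite (_ : 2 * (s * Q.2) = s * (2 * Q.2)); last by ring.
have : 0 < (2 * Q.2) ^+ n by rewrite exprn_gt0// mulr_gt0.
rewrite (exprMn _ s) powRM ?exprn_ge0 ?mulr_ge0 ?(ltW s0) ?(ltW Q0)//.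
rewrite -[fine (mass _ _ _)]/(cube_mass v Q); move: (_ ^+ n) => u u0.
rewrite [leRHS](_ : _ = u `^ tau * (K * (s ^+ n) `^ tau * cube_mass v Q)); last by ring.
by rewrite ler_pM2l// powR_gt0.
Qed.

Lemma Ainfty_half Q (E : set (Rn R n)) : 0 < Q.2 -> measurable E ->
  (E `<=` cube Q.1 Q.2)%classic -> (((2 * Q.2) ^+ n / 2)%:E <= mu E)%E ->
  cube_mass v Q <= K * 2 `^ tau * fine (mass mu v E).
Proof.
move=> Q0 mE EQ half; have := vA Q E Q0 mE EQ.
have u0 : 0 < (2 * Q.2) ^+ n by rewrite exprn_gt0// mulr_gt0.
have finE : mu E \is a fin_num.
  by rewrite ge0_fin_numE// (le_lt_trans (mu_le _ _ EQ))// mu_cube_lty.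
move: half; rewrite -(fineK finE) lee_fin => half main.
have m0 : 0 <= cube_mass v Q by exact: cube_mass_ge0.
have h2 : ((2 * Q.2) ^+ n / 2) `^ tau <= fine (mu E) `^ tau.
  by rewrite ge0_ler_powR ?nnegrE ?fine_ge0//; lra.
have := le_trans (ler_wpM2r m0 h2) main.
have e2 : 2^-1 `^ tau = (2 `^ tau)^-1 :> R by rewrite -powR_inv1// powRAC powR_inv1 ?powR_ge0.
rewrite powRM ?(ltW u0) ?invr_ge0// e2 -!mulrA [leRHS]mulrCA ler_pM2l ?powR_gt0//.
by rewrite ler_pdivrMl ?powR_gt0// [X in _ <= X -> _]mulrCA.
Qed.

Definition mean Q : R := cube_mass v Q / (2 * Q.2) ^+ n.

Lemma mean_gt0 Q : 0 < Q.2 -> 0 < mean Q.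
Proof. by move=> Q0; rewrite divr_gt0 ?vpos// exprn_gt0// mulr_gt0. Qed.

Section fixed_cube.
Context (Q0 : 'rV[R]_n * R).
Hypothesis Q00 : 0 < Q0.2.
Let V := cutoff v (cube Q0.1 Q0.2).
Let Om (t : R) := avg_upper V t.
Let mQ0 : measurable (cube Q0.1 Q0.2 : set (Rn R n)). Proof. exact: measurable_cube. Qed.
Let Vnn : nonneg_fun V. Proof. exact: nonneg_fun_cutoff. Qed.
Let Vloc : locally_finite V. Proof. exact: locally_finite_cutoff. Qed.

Let mOm t : measurable (Om t). Proof. exact: measurable_cube_union. Qed.

Let cut_le_mass A : measurable A -> (mass mu V A <= mass mu v A)%E.
Proof. by move=> mA; rewrite mass_cutoff//; apply: mass_le => //; exact: measurableI. Qed.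

(** The cut-off weight vanishes outside of [Q0] and has no more mass than [v] has on
    [Q0]. *)
Let small_cube t Q : mean Q0 <= t -> 0 < Q.2 -> t < level 1 (fun _ : 'I_1 => V) Q ->
  Q.2 < Q0.2 /\ (cube Q.1 Q.2 `<=` cube Q0.1 (3 * Q0.2))%classic.
Proof.
move=> t0 Qpos; have u0 : 0 < (2 * Q.2) ^+ n by rewrite exprn_gt0// mulr_gt0.
rewrite level1E ?(ltW Qpos)// ltr_pdivlMr// => tQ.
have VQ : cube_mass V Q <= cube_mass v Q0.
  rewrite -lee_fin -cube_massE// -cube_massE// mass_cutoff//; last exact: measurable_cube.
  by apply: mass_le => //; apply: measurableI => //; exact: measurable_cube.
have tpos : 0 < t := lt_le_trans (mean_gt0 _ Q00) t0.
have QQ0 : Q.2 < Q0.2.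
  have : t * (2 * Q.2) ^+ n < t * (2 * Q0.2) ^+ n.
    apply: lt_le_trans (le_trans VQ _) => //.
    by rewrite -ler_pdivrMr ?exprn_gt0 ?mulr_gt0.
  by rewrite ltr_pM2l// ltr_pXn2r ?nnegrE ?mulr_ge0 ?(ltW Qpos) ?(ltW Q00)// ltr_pM2l.
split => //; suff meet : (cube Q.1 Q.2 `&` cube Q0.1 Q0.2 !=set0)%classic.
  by apply: subset_trans (cube_engulf _ _ _ _ meet) _; apply: cubeS; lra.
apply/set0P/eqP => disj; move: tQ.
rewrite /cube_mass mass_cutoff//; last exact: measurable_cube.
by rewrite setIC disj /mass integral_set0/= ltNge mulr_ge0 ?(ltW u0) ?(ltW tpos).
Qed.

Let Om_sub t : mean Q0 <= t -> (Om t `<=` cube Q0.1 (3 * Q0.2))%classic.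
Proof. by move=> t0 x [Q [Qpos tQ] Qx]; have [_] := small_cube _ _ t0 Qpos tQ; apply. Qed.

Definition decay_const : R := K * (5 ^+ n) `^ tau * (K * 2 `^ tau) + 2.

(** A stopping cube keeps at least half of its volume outside of the next level set,
    hence a fixed fraction of its [v]-mass, and also of the [v]-mass of its dilation
    by 5. The stopping cubes may be chosen disjoint with dilations covering [Om t]. *)
Let step t : mean Q0 <= t ->
  fine (mass mu v (Om t)) <= decay_const * fine (mass mu v (Om t `\` Om (@jump R n 1 * t))).
Proof.
move=> t0; have tpos : 0 < t := lt_le_trans (mean_gt0 _ Q00) t0.
have n13 := Om_sub _ t0.
have finOm A : measurable A -> (A `<=` Om t)%classic -> mass mu v A \is a fin_num.
  by move=> mA AOm; apply: finv mA (subset_trans AOm n13).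
pose W := [set Q | exists x, stopping 1 (fun _ : 'I_1 => V) t x Q].
have WM Q : W Q -> 0 < Q.2 <= Q0.2.
  move=> [x [Qpos _ tQ _]]; rewrite Qpos ltW//.
  by have [] := small_cube _ _ t0 Qpos tQ.
have [F [FW Fdisj Fcov]] := vitali_sequence n0 W _ WM.
have F0 j : 0 <= (F j).2 by have [/WM/andP[/ltW]|->] := FW j.
have mF j s : measurable (cube (F j).1 s : set (Rn R n)) by exact: measurable_cube.
pose D j := cube (F j).1 (F j).2 `\` Om (@jump R n 1 * t).
have mD j : measurable (D j) by exact: measurableD.
have FOm j : (cube (F j).1 (F j).2 `<=` Om t)%classic.
  by have [[x [Fj0 _ tF _]]|->] := FW j; [move=> y Fy; exists (F j)|rewrite cube0].
have OmF : (Om t `<=` \bigcup_j cube (F j).1 (5 * (F j).2))%classic.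
  move=> x Omx; have [|Q sQ] := stopping_exists 1 (fun _ : 'I_1 => V) t Q0.2 x Omx.
    by move=> Q Qpos _ tQ; apply/ltW; have [] := small_cube _ _ t0 Qpos tQ.
  by apply: Fcov (ex_intro _ x sQ) _ _; have [] := sQ.
have piece j : (mass mu v (cube (F j).1 (5 * (F j).2)) <= decay_const%:E * mass mu v (D j))%E.
  have [[x sF]|Fj0] := FW j; last first.
    rewrite Fj0 mulr0 /mass cube0// integral_set0 mule_ge0 ?mass_ge0//.
    by rewrite lee_fin addr_ge0// !mulr_ge0 ?powR_ge0 ?(ltW K0).
  have Fpos : 0 < (F j).2 by case: sF.
  have DF : (D j `<=` cube (F j).1 (F j).2)%classic by move=> y [].
  rewrite (cube_massE _ ((F j).1, 5 * (F j).2))//.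
  have fD : mass mu v (D j) \is a fin_num by exact: finv DF.
  rewrite -(fineK fD) -EFinM lee_fin.
  have h := stopping_remainder n0 1 (fun _ : 'I_1 => V) t x (F j) (fun _ => Vnn) (fun _ => Vloc)
    tpos ltr01 _ sF.
  rewrite card_ord in h; have := Ainfty_half _ _ Fpos (mD j) DF (h (lexx _)).
  have K5 : 0 <= K * (5 ^+ n) `^ tau by rewrite mulr_ge0 ?powR_ge0 ?(ltW K0).
  move=> /(ler_wpM2l K5); have dbl := Ainfty_doubling 5 (F j) _ Fpos.
  move=> /(le_trans (dbl _)) => /(_ (ler1n _ 5)) /le_trans; apply.
  rewrite mulrA ler_wpM2r ?fine_ge0 ?mass_ge0// /decay_const.
  by rewrite lerDl.
have c0 : 0 <= decay_const.
  by rewrite addr_ge0// !mulr_ge0 ?powR_ge0 ?(ltW K0).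
have mDiff : measurable (Om t `\` Om (@jump R n 1 * t)) by exact: measurableD.
have fOm : mass mu v (Om t) \is a fin_num by exact: finOm.
have fDiff : mass mu v (Om t `\` Om (@jump R n 1 * t)) \is a fin_num.
  by apply: finOm => //; exact: subDsetl.
rewrite -lee_fin EFinM (fineK fOm) (fineK fDiff).
apply: (@le_trans _ _ (mass mu v (\bigcup_j cube (F j).1 (5 * (F j).2)))).
  by apply: mass_le => //; exact: bigcup_measurable.
apply: le_trans (mass_bigcup_le _ _ vnn _ _) _ => //.
apply: (@le_trans _ _ (\sum_(0 <= j <oo) decay_const%:E * mass mu v (D j))%E).
  by apply: lee_nneseries => [j _ _|j _] //; exact: mass_ge0.
rewrite nneseriesZl; last by move=> j _; exact: mass_ge0.
rewrite lee_wpmul2l ?lee_fin//; apply: mass_disjoint_le => //.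
- apply/trivIsetP => i j _ _ ij; have /trivIsetP/(_ i j Logic.I Logic.I ij) := Fdisj.
  by move=> /seteqP[sub _]; apply/seteqP; split => // y [[Fi _] [Fj _]]; exact: (sub y).
- by move=> j; exact: setSD.
Qed.

Definition decay : R := 1 - decay_const^-1.

Let cgt1 : 1 < decay_const.
Proof.
suff : 0 <= K * (5 ^+ n) `^ tau * (K * 2 `^ tau) by rewrite /decay_const; lra.
by rewrite !mulr_ge0 ?powR_ge0 ?(ltW K0).
Qed.

Lemma decay_bounds : 0 < decay < 1.
Proof. by rewrite /decay subr_gt0 invf_lt1 ?(lt_trans ltr01)// cgt1 gtrBl invr_gt0 (lt_trans ltr01). Qed.

Let decay_step t : mean Q0 <= t ->
  fine (mass mu v (Om (@jump R n 1 * t))) <= decay * fine (mass mu v (Om t)).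
Proof.
move=> t0; have tpos : 0 < t := lt_le_trans (mean_gt0 _ Q00) t0.
have j1 : 1 <= @jump R n 1.
  rewrite /jump powRr1 ?mulr_ge0 ?exprn_ge0//.
  by have := @exprn_ege1 R n 15 (ler1n _ 15); lra.
have sub : (Om (@jump R n 1 * t) `<=` Om t)%classic.
  move=> x [Q [Qpos tQ] Qx]; exists Q => //; split => //; apply: le_lt_trans tQ.
  by rewrite ler_peMl// ltW.
have := step t t0; have n13 := Om_sub _ t0.
have finOm A : measurable A -> (A `<=` Om t)%classic -> mass mu v A \is a fin_num.
  by move=> mA AOm; apply: finv mA (subset_trans AOm n13).
have mDiff : measurable (Om t `\` Om (@jump R n 1 * t)) by exact: measurableD.
have fDiff : mass mu v (Om t `\` Om (@jump R n 1 * t)) \is a fin_num.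
  by apply: finOm => //; exact: subDsetl.
have fJ : mass mu v (Om (@jump R n 1 * t)) \is a fin_num by exact: finOm.
have -> : fine (mass mu v (Om t)) = fine (mass mu v (Om (@jump R n 1 * t))) +
    fine (mass mu v (Om t `\` Om (@jump R n 1 * t))).
  rewrite -fineD// -massU//; last by apply/disj_setPS => y [? []].
  by rewrite setDUK.
set a := fine _; set b := fine _ => ab.
have cpos : 0 < decay_const by rewrite (lt_trans ltr01).
have : (a + b) / decay_const <= b by rewrite ler_pdivrMr// mulrC.
by rewrite /decay; lra.
Qed.

Let decay_iter k : mean Q0 <= @jump R n 1 ^+ k * mean Q0 /\
  fine (mass mu v (Om (@jump R n 1 ^+ k * mean Q0))) <=
  decay ^+ k * (K * (3 ^+ n) `^ tau * cube_mass v Q0).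
Proof.
have j1 : 1 <= @jump R n 1.
  rewrite /jump powRr1 ?mulr_ge0 ?exprn_ge0//.
  by have := @exprn_ege1 R n 15 (ler1n _ 15); lra.
have m0 := mean_gt0 _ Q00.
elim: k => [|k [IH1 IH2]].
  rewrite expr0 !mul1r; split => //.
  apply: le_trans (Ainfty_doubling 3 Q0 _ Q00); last by rewrite ler1n.
  have sub := Om_sub _ (lexx (mean Q0)).
  rewrite fine_le ?(finv _ _ _ (mOm _) sub)//.
    by apply: finv; [exact: measurable_cube|exact: subset_refl].
  by apply: mass_le => //; exact: measurable_cube.
rewrite exprS -mulrA; split; first by rewrite (le_trans IH1)// ler_peMl// (le_trans (ltW m0)).
apply: le_trans (decay_step _ IH1) _.
by rewrite exprS -mulrA ler_wpM2l//; have /andP[/ltW] := decay_bounds.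
Qed.

Definition tail_const : R := 5 ^+ n * (1 + K * (3 ^+ n) `^ tau) + 1.

(** The reverse Hoelder inequality in distributional form: Chebyshev's inequality
    alone would give the tail [1 / jump ^+ k], and the factor [decay ^+ k] gained from
    the geometric decay of the [v]-mass of the level sets makes the tails summable against
    [jump ^+ k]. *)
Lemma reverse_hoelder_tail k :
  (mu (cube Q0.1 Q0.2 `&` [set x | (tail_const * @jump R n 1 ^+ k * mean Q0 <= v x)%R]) <=
   (tail_const * (decay / @jump R n 1) ^+ k * (2 * Q0.2) ^+ n)%:E)%E.
Proof.
have [t0 iter] := decay_iter k; set t := _ * mean Q0 in t0 iter.
have tpos : 0 < t := lt_le_trans (mean_gt0 _ Q00) t0.
have K3 : 0 <= K * (3 ^+ n) `^ tau by rewrite mulr_ge0 ?powR_ge0 ?(ltW K0).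
have five0 : 0 <= 5 ^+ n :> R by rewrite exprn_ge0.
set G := cube Q0.1 Q0.2 `&` [set x | (5 ^+ n + 1) * t <= v x].
apply: (@le_trans _ _ (mu (Om t `|` (G `\` Om t)))).
  apply: mu_le => x [Qx vx]; have [?|nOm] := pselect (Om t x); [by left|right].
  split => //; split => //=; apply: le_trans vx.
  rewrite -mulrA -/t ler_wpM2r ?(ltW tpos)// /tail_const lerD2r mulrDr mulr1 lerDl.
  by rewrite mulr_ge0.
have mG : measurable (G `\` Om t).
  apply: measurableD => //; apply: measurableI => //.
  by apply: measurable_ge_set; exact: vnn.1.
apply: le_trans (measureU2 _ _ _) _ => //.
have null : mu (G `\` Om t) = 0%E by exact: weak_differentiation.
rewrite [X in (_ + X <= _)%E]null adde0.
have finOm : mass mu v (Om t) \is a fin_num by apply: finv (mOm _) (Om_sub _ t0).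
have finV : mass mu V (Om t) \is a fin_num.
  by rewrite ge0_fin_numE ?mass_ge0// (le_lt_trans (cut_le_mass _ (mOm _)))// -ge0_fin_numE ?mass_ge0.
apply: le_trans (mu_cube_union_le n0 (fun _ : 'I_1 => V) (fun=> 1) (Om t) t^-1
  [set Q | 0 < Q.2 /\ t < level 1 (fun _ : 'I_1 => V) Q] _ _ _ _ _ _ _) _ => //.
- by move=> _; rewrite -ge0_fin_numE ?mass_ge0.
- by rewrite big_ord1.
- by rewrite invr_ge0 ltW.
- move=> Q [Qpos tQ]; split => //; first by move=> x Qx; exists Q.
  rewrite big_ord1 powRr1; last exact: (cube_mass_ge0 V Q Vnn).
  rewrite ler_pdivlMl// -ler_pdivlMr ?exprn_gt0 ?mulr_gt0//.
  by move: tQ; rewrite level1E ?(ltW Qpos)// => /ltW.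
rewrite lee_fin big_ord1 powRr1 ?fine_ge0 ?mass_ge0//.
have Vle : fine (mass mu V (Om t)) <= decay ^+ k * (K * (3 ^+ n) `^ tau * cube_mass v Q0).
  by apply: le_trans iter; rewrite fine_le// cut_le_mass.
apply: (@le_trans _ _ (5 ^+ n * (t^-1 * (decay ^+ k * (K * (3 ^+ n) `^ tau * cube_mass v Q0))))).
  by rewrite ler_wpM2l// ler_wpM2l// invr_ge0 ltW.
have u0 : 0 < (2 * Q0.2) ^+ n by rewrite exprn_gt0// mulr_gt0.
have -> : cube_mass v Q0 = mean Q0 * (2 * Q0.2) ^+ n by rewrite divfK// gt_eqF.
have j0 : 0 < @jump R n 1 by rewrite /jump powR_gt0// mulr_gt0// exprn_gt0.
have m0 := mean_gt0 _ Q00.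
rewrite (_ : 5 ^+ n * _ = 5 ^+ n * (K * (3 ^+ n) `^ tau) * (decay / @jump R n 1) ^+ k * (2 * Q0.2) ^+ n).
  rewrite ler_wpM2r ?(ltW u0)// ler_wpM2r//.
    rewrite exprn_ge0// divr_ge0 ?(ltW j0)//.
    by have /andP[/ltW] := decay_bounds.
  by rewrite /tail_const mulrDr mulr1; lra.
rewrite /t expr_div_n; field.
by rewrite !gt_eqF// exprn_gt0.
Qed.

End fixed_cube.
End reverse_hoelder.

Section Ainfty_growth.
Context {R : realType} {n : nat}.
Local Notation mu := (lebesgue_rV R n).

(** Each dilation by 3 adds a fixed fraction of the initial mass: the shell
    is at least half of the dilated cube. *)
Lemma Ainfty_unbounded (v : Rn R n -> R) (K tau : R) :
  (0 < n)%N -> nonneg_fun v -> locally_finite v ->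
  (forall Q : 'rV[R]_n * R, 0 < Q.2 -> 0 < cube_mass v Q) ->
  0 <= tau -> 0 < K -> Ainfty K tau v ->
  forall x (M : R), exists2 s, 0 < s & M < cube_mass v (x, s).
Proof.
move=> n0 vn vl vpos tau0 K0 vA x M.
have c0 : 0 < K * 2 `^ tau by rewrite mulr_gt0 ?powR_gt0.
have m1 : 0 < cube_mass v (x, 1) by exact: vpos.
suff growth k : cube_mass v (x, 1) * (1 + k%:R / (K * 2 `^ tau)) <= cube_mass v (x, 3 ^+ k).
  pose k := (Num.trunc (M / cube_mass v (x, 1) * (K * 2 `^ tau))).+1.
  exists (3 ^+ k); first by rewrite exprn_gt0.
  apply: lt_le_trans (growth k).
  have : M / cube_mass v (x, 1) * (K * 2 `^ tau) < k%:R by exact: truncnS_gt.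
  rewrite -ltr_pdivlMr// ltr_pdivrMr// mulrC => /lt_le_trans; apply.
  by rewrite ler_pM2l// lerDr.
elim: k => [|k IHk]; first by rewrite expr0 mul0r addr0 mulr1.
set s := 3 ^+ k in IHk *; have s0 : 0 < s by rewrite exprn_gt0.
rewrite exprS -/s.
have sub : (cube x s `<=` cube x (3 * s))%classic by apply: cubeS; lra.
have mS r : measurable (cube x r : set (Rn R n)) by exact: measurable_cube.
have mD : measurable (cube x (3 * s) `\` cube x s : set (Rn R n)) by exact: measurableD.
have finv A r : measurable A -> (A `<=` cube x r)%classic -> mass mu v A \is a fin_num.
  move=> mA Ac; rewrite ge0_fin_numE ?mass_ge0//; apply: le_lt_trans (vl x r).
  by apply: mass_le.
have split_mass : cube_mass v (x, 3 * s) =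
    cube_mass v (x, s) + fine (mass mu v (cube x (3 * s) `\` cube x s)).
  rewrite /cube_mass/= -fineD; last 2 first.
  - exact: (finv _ s).
  - by apply: (finv _ (3 * s)) => //; exact: subDsetl.
  by rewrite -massU//; [rewrite setDUK|apply/disj_setPS => y [? []]].
have half : (((2 * (3 * s)) ^+ n / 2)%:E <= mu (cube x (3 * s) `\` cube x s))%E.
  have split_mu : (mu (cube x s) + mu (cube x (3 * s) `\` cube x s) = mu (cube x (3 * s)))%E.
    by rewrite -measureU// ?setDUK//; apply/seteqP; split => // y [? []].
  have finD : mu (cube x (3 * s) `\` cube x s) \is a fin_num.
    rewrite ge0_fin_numE// (le_lt_trans _ (mu_cube_lty n0 x (3 * s)))//.
    by apply: mu_le; exact: subDsetl.
  move: split_mu; rewrite !mu_cube// ?(ltW s0) ?mulr_ge0 ?(ltW s0)// -(fineK finD) -EFinD => -[e].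
  rewrite lee_fin; move: e; rewrite (_ : 2 * (3 * s) = 3 * (2 * s)); last by ring.
  rewrite (exprMn _ 3).
  have u0 : 0 < (2 * s) ^+ n by rewrite exprn_gt0// mulr_gt0.
  have t3 : 3 <= 3 ^+ n :> R by rewrite -[leLHS]expr1 ler_weXn2l//; lra.
  have := ler_wpM2r (ltW u0) t3; lra.
have := Ainfty_half v K tau n0 vn tau0 vA (x, 3 * s) _ _ mD _ half.
rewrite /= mulr_gt0// => /(_ isT (@subDsetl _ _ _)).
rewrite -ler_pdivrMl// => shell.
have mono : cube_mass v (x, 1) <= cube_mass v (x, 3 * s).
  apply: cube_massS => //=; apply: cubeS.
  by have := @exprn_ege1 R k 3 (ler1n _ 3); rewrite -/s; lra.
rewrite split_mass; apply: le_trans (lerD IHk shell).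
rewrite -natr1 mulrDl mul1r addrA mulrDr lerD2l.
by rewrite mulrC ler_pM2l// invr_gt0.
Qed.

End Ainfty_growth.

(** * The estimate of the level set *)

Section level_set_estimate.
Context {R : realType} {n : nat} {I : finType}.
Local Notation mu := (lebesgue_rV R n).
Context (v : Rn R n -> R) (K tau : R) (kap q W : R).
Context (f g : I -> Rn R n -> R) (s : I -> R).
Hypothesis n0 : (0 < n)%N.
Hypothesis vnn : nonneg_fun v.
Hypothesis vloc : locally_finite v.
Hypothesis vpos : forall Q : 'rV[R]_n * R, 0 < Q.2 -> 0 < cube_mass v Q.
Hypothesis tau0 : 0 <= tau.
Hypothesis K0 : 0 < K.
Hypothesis vA : Ainfty K tau v.
Hypothesis q0 : 0 < q.
Hypothesis kap0 : 0 < kap.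
Hypothesis kapI : kap <= #|I|%:R.
Hypothesis W0 : 0 <= W.
Hypothesis s0 : forall i, 0 <= s i.
Hypothesis s1 : 1 <= \sum_i s i.
Hypothesis fnn : forall i, nonneg_fun (f i).
Hypothesis floc : forall i, locally_finite (f i).
Hypothesis gnn : forall i, nonneg_fun (g i).
Hypothesis gfin : forall i, (mass mu (g i) setT < +oo)%E.
Hypothesis key : forall Q : 'rV[R]_n * R, 0 < Q.2 ->
  mean v Q * level kap f Q `^ q * (2 * Q.2) ^+ n <= W * \prod_i cube_mass (g i) Q `^ s i.

Local Notation B := (@jump R n kap).
Local Notation b := (@jump R n 1).
Local Notation eta := (@decay R n K tau).
Local Notation Ct := (@tail_const R n K tau).

(** A point of the level set with a stopping cube [Q] of level [t k] has a weight above
    [lam / (B `^ q * t k `^ q)]. If the product of [t k `^ q] and of the mean over [Q] is at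
    most [lam * threshold / b ^+ l], then this is at least [Ct * b ^+ l] times the mean over
    the dilated cube [5Q], as the tail estimate demands. *)
Definition threshold : R := (B `^ q * Ct * (K * (5 ^+ n) `^ tau))^-1.

Let theta : R := \prod_i fine (mass mu (g i) setT) `^ s i.

Let fifteen : 1 <= 15 ^+ n :> R. Proof. by rewrite exprn_ege1// ler1n. Qed.

Let B1 : 1 < B.
Proof.
have : 1 `^ kap < B.
  rewrite /jump gt0_ltr_powR// ?nnegrE ?mulr_ge0 ?exprn_ge0//.
  by move: fifteen; lra.
by rewrite powR1.
Qed.

Let b2 : 2 <= b.
Proof. by rewrite /jump powRr1; move: fifteen; lra. Qed.

Let Ct0 : 0 < Ct.
Proof. by rewrite /tail_const ltr_wpDl// mulr_ge0 ?exprn_ge0// addr_ge0// mulr_ge0 ?powR_ge0 ?(ltW K0). Qed.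

Let K50 : 0 < K * (5 ^+ n) `^ tau.
Proof. by rewrite mulr_gt0// powR_gt0// exprn_gt0. Qed.

Let B0 : 0 < B. Proof. exact: lt_trans B1. Qed.
Let b0 : 0 < b. Proof. by move: b2; lra. Qed.

Lemma threshold_gt0 : 0 < threshold.
Proof. by rewrite invr_gt0 !mulr_gt0// powR_gt0. Qed.

Let theta0 : 0 <= theta.
Proof. by rewrite prodr_ge0// => i _; exact: powR_ge0. Qed.

Let eta01 : 0 < eta < 1. Proof. exact: decay_bounds. Qed.

Let t (k : int) : R := B `^ k%:~R.

Let t0 k : 0 < t k. Proof. exact: powR_gt0. Qed.

Let tS k : B * t k = t (k + 1).
Proof.
rewrite /t intrD powRD; last by rewrite (gt_eqF B0) implybT.
by rewrite powRr1 ?(ltW B0)// mulrC.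
Qed.

Let upS (u u' : R) : u <= u' -> (upper kap f u' `<=` upper kap f u)%classic.
Proof. by move=> uu' x [Q [Q0 uQ] Qx]; exists Q => //; split => //; exact: le_lt_trans uu' uQ. Qed.

Let mup u : measurable (upper kap f u). Proof. exact: measurable_cube_union. Qed.

Let shell k : set (Rn R n) := upper kap f (t k) `\` upper kap f (t (k + 1)).

Let mshell k : measurable (shell k). Proof. exact: measurableD. Qed.

Let shell_disj k k' x : shell k x -> shell k' x -> k = k'.
Proof.
wlog kk' : k k' / k <= k'.
  by move=> wh; have [/wh//|/ltW/wh h ? ?] := leP k k'; apply/esym/h.
move=> [_ xk] [xk' _]; apply/eqP; rewrite eq_le kk'/= leNgt; apply/negP => lt_kk'.
apply: xk; apply: upS xk'; rewrite /t ler_powR ?(ltW B1)// ler_int.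
by rewrite lezD1.
Qed.

Let gprod_le Q : 0 < Q.2 -> \prod_i cube_mass (g i) Q `^ s i <= theta.
Proof.
move=> Q0; apply: ler_prod => i _; rewrite powR_ge0/=.
rewrite ge0_ler_powR ?nnegrE ?cube_mass_ge0 ?fine_ge0 ?mass_ge0//.
have mQ : measurable (cube Q.1 Q.2 : set (Rn R n)) by exact: measurable_cube.
have le : (mass mu (g i) (cube Q.1 Q.2) <= mass mu (g i) setT)%E by exact: mass_le.
apply: fine_le => //; rewrite ge0_fin_numE ?mass_ge0//.
exact: le_lt_trans le (gfin i).
Qed.

Context (lam : R).
Hypothesis lam0 : 0 < lam.

(** The classes increase with [l]. For the cubes of class 0 the covering estimate
    suffices; in a cube of class [l + 1] which is not of class [l] the weight has to exceed
    about [b ^+ l] times its mean. *)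
Let class l : set ('rV[R]_n * R) := [set Q | exists k x,
  stopping kap f (t k) x Q /\ lam * threshold < mean v Q * t k `^ q * b ^+ l].

Let lz0 : 0 < lam * threshold. Proof. by rewrite mulr_gt0// threshold_gt0. Qed.

Let ratio0 l : 0 <= W * b ^+ l / (lam * threshold).
Proof. by rewrite divr_ge0 ?(ltW lz0)// mulr_ge0// exprn_ge0// ltW. Qed.

(** By [key], the volume of a cube of class [l] is controlled by the masses of the
    [g i], so that the covering estimate applies to the union of these cubes. *)
Let class_volume l Q : class l Q -> 0 < Q.2 /\
  (2 * Q.2) ^+ n <= W * b ^+ l / (lam * threshold) * \prod_i cube_mass (g i) Q `^ s i.
Proof.
move=> [k [x [[Q0 Qx tQ _] lQ]]]; split => //.
have m0 : 0 < mean v Q by exact: mean_gt0.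
have u0 : 0 < (2 * Q.2) ^+ n by rewrite exprn_gt0// mulr_gt0.
have tL : t k `^ q <= level kap f Q `^ q.
  rewrite ge0_ler_powR ?nnegrE ?(ltW q0) ?(ltW (t0 k)) ?(ltW tQ)//.
  exact: ltW (lt_trans (t0 k) tQ).
have h1 : mean v Q * t k `^ q * (2 * Q.2) ^+ n <= W * \prod_i cube_mass (g i) Q `^ s i.
  apply: le_trans (key Q Q0); rewrite ler_wpM2r ?(ltW u0)//.
  by rewrite ler_wpM2l// ltW.
rewrite mulrAC ler_pdivlMr// mulrAC.
have bl0 : 0 < b ^+ l by rewrite exprn_gt0.
apply: le_trans (ler_wpM2r (ltW bl0) h1).
by rewrite mulrAC mulrC ler_wpM2r ?(ltW u0)// ltW.
Qed.

Let class_radius l Q : class l Q -> 0 < Q.2 <= 1 + W * b ^+ l / (lam * threshold) * theta.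
Proof.
move=> cQ; have [Q0 vol] := class_volume l Q cQ; rewrite Q0/=.
apply: (radius_le n0); first exact: mulr_ge0.
apply: le_trans vol _.
exact: (ler_wpM2l (ratio0 l) (gprod_le Q Q0)).
Qed.

Let mu_class l :
  (mu (cube_union (class l)) <= (5 ^+ n * (W * b ^+ l / (lam * threshold) * theta))%:E)%E.
Proof.
by apply: mu_cube_union_le => // Q /class_volume[].
Qed.

Let slice k l : set (Rn R n) := [set x | lam < B `^ q * t k `^ q * v x /\
  exists Q, [/\ stopping kap f (t k) x Q,
    lam * threshold < mean v Q * t k `^ q * b ^+ l.+1 &
    mean v Q * t k `^ q * b ^+ l <= lam * threshold]].

Let five_mean Q : 0 < Q.2 -> mean v (Q.1, 5 * Q.2) <= K * (5 ^+ n) `^ tau * mean v Q.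
Proof.
move=> Q0; have u0 : 0 < (2 * Q.2) ^+ n by rewrite exprn_gt0// mulr_gt0.
have := Ainfty_doubling v K tau n0 vA 5 Q (ler1n _ 5) Q0.
rewrite /mean /= => dbl.
have v0 : 0 < (2 * (5 * Q.2)) ^+ n by rewrite exprn_gt0// !mulr_gt0.
rewrite mulrA; apply: (@le_trans _ _ (K * (5 ^+ n) `^ tau * cube_mass v Q / (2 * (5 * Q.2)) ^+ n)).
  by rewrite ler_wpM2r// invr_ge0 ltW.
rewrite ler_wpM2l ?mulr_ge0 ?(ltW K0) ?powR_ge0 ?cube_mass_ge0//.
rewrite lef_pV2 ?posrE// lerXn2r ?nnegrE ?mulr_ge0 ?(ltW Q0)//.
by move: Q0; lra.
Qed.

(** The slice lies in the dilated stopping cubes, where the tail estimate costs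
    [(eta / b) ^+ l] times the volume of the cubes, and at least half of each cube lies in the
    shell between two consecutive level sets. *)
Let mu_slice k l : (mu (slice k l) <= (2 * (Ct * 5 ^+ n * (eta / b) ^+ l))%:E *
  mu (cube_union (class l.+1) `&` shell k))%E.
Proof.
pose V := [set Q | exists x, [/\ stopping kap f (t k) x Q,
    lam * threshold < mean v Q * t k `^ q * b ^+ l.+1 &
    mean v Q * t k `^ q * b ^+ l <= lam * threshold]].
have Vclass Q : V Q -> class l.+1 Q by move=> [x [sQ lQ _]]; exists k, x.
have VM Q : V Q -> 0 < Q.2 <= 1 + W * b ^+ l.+1 / (lam * threshold) * theta.
  by move=> /Vclass/class_radius.
have [F [FV Fdisj Fcov]] := vitali_sequence n0 V _ VM.
have F0 j : 0 <= (F j).2 by have [/VM/andP[/ltW]|->] := FV j.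
have mF j r : measurable (cube (F j).1 r : set (Rn R n)) by exact: measurable_cube.
pose D j := cube (F j).1 (F j).2 `\` upper kap f (t (k + 1)).
have mD j : measurable (D j) by exact: measurableD.
pose T j : set (Rn R n) := cube (F j).1 (5 * (F j).2) `&`
  [set x | Ct * b ^+ l * mean v ((F j).1, 5 * (F j).2) <= v x].
have c0 : 0 <= Ct * 5 ^+ n * (eta / b) ^+ l.
  have /andP[/ltW eta0 _] := eta01.
  by rewrite !mulr_ge0 ?exprn_ge0 ?divr_ge0 ?(ltW Ct0) ?(ltW b0).
apply: (@le_trans _ _ (mu (\bigcup_j T j))).
  apply: mu_le => x [xv [Q [sQ lQ Ql]]].
  have VQ : V Q by exists x.
  have [j _ xj] : (\bigcup_j cube (F j).1 (5 * (F j).2)) x by apply: Fcov VQ _ _; case: sQ.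
  exists j => //; split => //=.
  have [[y [[r0 _ _ _] _ Fl]]|Fj0] := FV j; last by move: xj; rewrite Fj0 mulr0 cube0.
  have bl0 : 0 < b ^+ l by rewrite exprn_gt0.
  have tq0 : 0 < t k `^ q by rewrite powR_gt0.
  have Bq0 : 0 < B `^ q by rewrite powR_gt0.
  rewrite -(ler_pM2l (mulr_gt0 Bq0 tq0)); apply/ltW/(le_lt_trans _ xv).
  apply: (@le_trans _ _ (B `^ q * t k `^ q *
      (Ct * b ^+ l * (K * (5 ^+ n) `^ tau * mean v (F j))))).
    rewrite ler_wpM2l ?mulr_ge0 ?powR_ge0// ler_wpM2l ?five_mean//.
    by rewrite mulr_ge0 ?(ltW Ct0) ?(ltW bl0).
  have := Fl; rewrite /threshold ler_pdivlMr ?mulr_gt0//; apply: le_trans.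
  move: (B `^ q) (t k `^ q) Ct (b ^+ l) (K * (5 ^+ n) `^ tau) (mean v (F j)).
  move=> x1 x2 x3 x4 x5 x6.
  by rewrite (_ : x1 * x2 * (x3 * x4 * (x5 * x6)) = x6 * x2 * x4 * (x1 * x3 * x5))//; ring.
apply: le_trans (mu_bigcup_le _) _.
apply: (@le_trans _ _ (\sum_(0 <= j <oo) (2 * (Ct * 5 ^+ n * (eta / b) ^+ l))%:E * mu (D j))%E).
  apply: lee_nneseries => [j _ _|j _]; first exact: measure_ge0.
  have [[y [sF _ _]]|Fj0] := FV j; last first.
    by rewrite /T Fj0 mulr0 cube0// set0I measure0 mule_ge0// lee_fin mulr_ge0.
  have Fpos : 0 < (F j).2 by case: sF.
  have F5 : 0 < ((F j).1, 5 * (F j).2).2 by rewrite /= mulr_gt0.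
  apply: le_trans (reverse_hoelder_tail v K tau n0 vnn vloc vpos tau0 K0 vA _ F5 l) _.
  have half := stopping_remainder n0 kap f (t k) y (F j) fnn floc (t0 k) kap0 kapI sF.
  rewrite tS in half.
  have -> : (2 * (5 * (F j).2)) ^+ n = 5 ^+ n * (2 * (F j).2) ^+ n.
    by rewrite -exprMn; congr (_ ^+ n); ring.
  have cE : (0 <= (2 * (Ct * 5 ^+ n * (eta / b) ^+ l))%:E :> \bar R)%E.
    by rewrite lee_fin mulr_ge0.
  apply: le_trans (lee_wpmul2l cE half).
  rewrite -EFinM lee_fin le_eqVlt; apply/orP; left; apply/eqP.
  set e := (eta / b) ^+ l; set w := (2 * (F j).2) ^+ n; set d := 5 ^+ n.
  by field.
rewrite nneseriesZl; last by move=> j _; exact: measure_ge0.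
rewrite lee_wpmul2l//; first by rewrite lee_fin (mulr_ge0 (ler0n _ 2) c0).
have Ddisj : trivIset setT D.
  apply/trivIsetP => i j _ _ ij; have /trivIsetP/(_ i j Logic.I Logic.I ij) := Fdisj.
  by move=> /seteqP[sub _]; apply/seteqP; split => // y [[Fi _] [Fj _]]; exact: (sub y).
apply: mu_disjoint_le => // j x [Fx upx].
have [[y [sF lF _]]|Fj0] := FV j; last by move: Fx; rewrite Fj0 cube0.
split; first by exists (F j) => //; exists k, y.
by split => //; exists (F j) => //; case: sF.
Qed.

(** The slices of the different levels are estimated by the measures of disjoint
    shells, so that summing over the levels costs nothing. *)
Let mu_slices l : (mu (\bigcup_k slice k l) <=
  (2 * (Ct * 5 ^+ n * (eta / b) ^+ l) *
   (5 ^+ n * (W * b ^+ l.+1 / (lam * threshold) * theta)))%:E)%E.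
Proof.
have c0 : 0 <= 2 * (Ct * 5 ^+ n * (eta / b) ^+ l).
  have /andP[/ltW eta0 _] := eta01.
  by rewrite !mulr_ge0 ?exprn_ge0 ?divr_ge0 ?(ltW Ct0) ?(ltW b0).
pose E j := if pickle_inv j is Some k then slice k l else set0.
pose S j := if pickle_inv j is Some k then shell k else set0 : set (Rn R n).
have mS j : measurable (S j) by rewrite /S; case: pickle_inv.
apply: (@le_trans _ _ (mu (\bigcup_j E j))).
  apply: mu_le => x [k _ xk]; exists (pickle k); first exact: Logic.I.
  by rewrite /E pickleK_inv; exact: xk.
apply: le_trans (mu_bigcup_le _) _.
set U := cube_union (class l.+1).
have mU : measurable U by exact: measurable_cube_union.
apply: (@le_trans _ _ (\sum_(0 <= j <oo) (2 * (Ct * 5 ^+ n * (eta / b) ^+ l))%:E * mu (U `&` S j))%E).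
  apply: lee_nneseries => [j _ _|j _]; first exact: measure_ge0.
  rewrite /E /S; case: pickle_inv => [k|]; first exact: mu_slice.
  by rewrite measure0 mule_ge0.
rewrite nneseriesZl; last by move=> j _; exact: measure_ge0.
rewrite [leRHS]EFinM lee_wpmul2l ?lee_fin//.
apply: le_trans (mu_class l.+1); rewrite -/U.
have Sdisj : trivIset setT (fun j => U `&` S j).
  apply/trivIsetP => i j _ _; rewrite /S.
  case Ei : (pickle_inv i) => [k|]; last by rewrite setI0 set0I.
  case Ej : (pickle_inv j) => [k'|]; last by rewrite setI0 setI0.
  move=> ij; apply/seteqP; split => // x [[_ xk] [_ xk']].
  have kk' := shell_disj _ _ _ xk xk'.
  have pi := @pickle_invK int i; have pj := @pickle_invK int j; rewrite Ei/= in pi; rewrite Ej/= in pj.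
  by move/eqP: ij; rewrite -pi -pj kk'.
by apply: mu_disjoint_le => // j; exact: measurableI.
Qed.

(** Stopping cubes exist at every level because the total [v]-mass is infinite, so
    that by [key] the functional tends to 0 on the large cubes around a point. *)
Let slice_cover : ([set x | exists Q : 'rV[R]_n * R, [/\ (0 < Q.2)%R, cube Q.1 Q.2 x &
    (lam < level kap f Q `^ q * v x)%R]] `<=`
  cube_union (class 0) `|` \bigcup_l \bigcup_k slice k l)%classic.
Proof.
move=> x [Q [Q0 Qx lQ]].
have L0 : 0 <= level kap f Q by exact: level_ge0.
have Lpos : 0 < level kap f Q.
  rewrite lt0r L0 andbT; apply: contraTneq lQ => ->.
  by rewrite powR0 ?mul0r ?gt_eqF// -leNgt ltW.
have lnB : 0 < ln B by rewrite ln_gt0.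
have LB : level kap f Q = B `^ (ln (level kap f Q) / ln B).
  by rewrite /powR gt_eqF// divfK ?gt_eqF// lnK// posrE.
pose k := Num.ceil (ln (level kap f Q) / ln B) - 1.
have /andP[kl lk] := ceil_itv (ln (level kap f Q) / ln B).
have tL : t k < level kap f Q.
  by rewrite LB /t /powR (gt_eqF B0) ltr_expR ltr_pM2r.
have Lt : level kap f Q <= B * t k.
  by rewrite tS LB /t subrK ler_powR// ltW.
have xv : lam < B `^ q * t k `^ q * v x.
  apply: lt_le_trans lQ _; rewrite -powRM ?(ltW B0) ?(ltW (t0 k))//.
  rewrite ler_wpM2r//; first exact: vnn.2.
  by rewrite ge0_ler_powR ?nnegrE ?(ltW q0)// mulr_ge0 ?(ltW B0) ?(ltW (t0 k)).
have tq0 : 0 < t k `^ q by rewrite powR_gt0.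
(* the level exceeds [t k] only on cubes of bounded [v]-mass *)
have [r r0 rM] := Ainfty_unbounded v K tau n0 vnn vloc vpos tau0 K0 vA x
  (K * (3 ^+ n) `^ tau * (W * theta / t k `^ q)).
have [|P sP] := stopping_exists kap f (t k) r x (ex_intro2 _ _ Q (conj Q0 tL) Qx).
  move=> P P0 Px tP; rewrite leNgt; apply/negP => rP.
  have vP : cube_mass v P <= W * theta / t k `^ q.
    rewrite ler_pdivlMr//.
    have u0 : 0 < (2 * P.2) ^+ n by rewrite exprn_gt0// mulr_gt0.
    apply: le_trans (le_trans (key P P0) (ler_wpM2l W0 (gprod_le P P0))).
    rewrite /mean mulrAC divfK ?gt_eqF//.
    rewrite ler_wpM2l ?cube_mass_ge0// ge0_ler_powR ?nnegrE ?(ltW q0) ?(ltW (t0 k)) ?(ltW tP)//.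
    exact: ltW (lt_trans (t0 k) tP).
  have sub : (cube x r `<=` cube P.1 (3 * P.2))%classic.
    have meet : (cube x P.2 `&` cube P.1 P.2 !=set0)%classic.
      by exists x; split; [exact: cube_center|exact: Px].
    have le3 : 2 * P.2 + P.2 <= 3 * P.2.
      by rewrite (_ : 3 * P.2 = 2 * P.2 + P.2)//; ring.
    exact: (subset_trans (cubeS x r P.2 (ltW rP))
      (subset_trans (cube_engulf _ _ _ _ meet) (cubeS P.1 _ _ le3))).
  have := cube_massS v (x, r) (P.1, 3 * P.2) vnn vloc sub.
  move=> /le_trans/(_ (Ainfty_doubling v K tau n0 vA 3 P (ler1n _ 3) P0)).
  move=> /(lt_le_trans rM); rewrite ltr_pM2l ?mulr_gt0 ?powR_gt0 ?exprn_gt0//.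
  by rewrite ltNge vP.
have m0 : 0 < mean v P * t k `^ q by rewrite mulr_gt0// mean_gt0//; case: sP.
have ex_l : exists l, lam * threshold < mean v P * t k `^ q * b ^+ l.
  pose l := (Num.trunc (lam * threshold / (mean v P * t k `^ q))).+1; exists l.
  have lt_l : lam * threshold / (mean v P * t k `^ q) < l%:R by exact: truncnS_gt.
  rewrite -ltr_pdivrMl// mulrC; apply: lt_le_trans lt_l _.
  apply: (@le_trans _ _ (2 ^+ l)); first by rewrite -natrX ler_nat ltnW// ltn_expl.
  by rewrite lerXn2r ?nnegrE// ltW.
have [[|l] lP lmin] := ex_minnP ex_l.
  by left; exists P; [exists k, x|case: sP].
right; exists l => //; exists k => //; split => //; exists P; split => //.
by rewrite leNgt; apply/negP => /lmin; rewrite ltnn.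
Qed.

Definition weak_const : R := 5 ^+ n * W / threshold +
  2 * Ct * 5 ^+ n * 5 ^+ n * W * b / threshold / (1 - eta).

(** The slices of index [l] contribute at most a multiple of
    [(eta / b) ^+ l * b ^+ l = eta ^+ l], a convergent geometric series. *)
Lemma level_set_estimate :
  (mu [set x | exists Q : 'rV[R]_n * R, [/\ (0 < Q.2)%R, cube Q.1 Q.2 x &
     (lam < level kap f Q `^ q * v x)%R]] <=
   (weak_const * (\prod_i fine (mass mu (g i) setT) `^ s i) / lam)%:E)%E.
Proof.
rewrite -/theta; apply: le_trans (mu_le _ _ slice_cover) _.
have z0 := threshold_gt0; have /andP[eta0 eta1] := eta01.
pose A l : set (Rn R n) := if l is l'.+1 then \bigcup_k slice k l' else cube_union (class 0).
apply: (@le_trans _ _ (mu (\bigcup_l A l))).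
  by apply: mu_le => x [Ux|[l _ Ax]]; [exists 0%N|exists l.+1].
apply: le_trans (mu_bigcup_le _) _; apply: nneseries_le => [j|N]; first exact: measure_ge0.
apply: (@le_trans _ _ (\sum_(j < N.+1) mu (A j))).
  by rewrite big_ord_recr/= leeDl// measure_ge0.
rewrite big_ord_recl/= mulrDl mulrDl EFinD leeD//.
  apply: le_trans (mu_class 0) _; rewrite lee_fin expr0 mulr1 le_eqVlt.
  apply/orP; left; apply/eqP; field.
  by rewrite !gt_eqF.
apply: (@le_trans _ _ (\sum_(l < N) (2 * (Ct * 5 ^+ n * (eta / b) ^+ l) *
   (5 ^+ n * (W * b ^+ l.+1 / (lam * threshold) * theta)))%:E)).
  by apply: lee_sum => l _; exact: mu_slices.
rewrite sumEFin lee_fin.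
pose D := 2 * Ct * 5 ^+ n * 5 ^+ n * W * b / threshold * theta / lam.
rewrite (eq_bigr (fun l : 'I_N => D * eta ^+ l)) => [|l _]; last first.
  rewrite /D exprS expr_div_n; field.
  by rewrite !gt_eqF// exprn_gt0.
rewrite -mulr_sumr.
have D0 : 0 <= D.
  have iz0 : 0 <= threshold^-1 by rewrite invr_ge0 ltW.
  by rewrite /D !mulr_ge0 ?iz0 ?exprn_ge0 ?(ltW Ct0) ?(ltW b0)// invr_ge0 ltW.
have geo : \sum_(l < N) eta ^+ l <= (1 - eta)^-1.
  rewrite -[leRHS]mul1r ler_pdivlMr ?subr_gt0//.
  have := subrX1 eta N; rewrite -opprB -[X in _ = X * _ -> _]opprB mulNr => /oppr_inj.
  rewrite mulrC => <-.
  by rewrite lerBlDr lerDl exprn_ge0// ltW.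
apply: le_trans (ler_wpM2l D0 geo) _.
rewrite /D le_eqVlt; apply/orP; left; apply/eqP; field.
by rewrite !gt_eqF// subr_gt0.
Qed.

End level_set_estimate.

(** * Hoelder's inequality with several factors *)

Section generalized_hoelder.
Context {d : measure_display} {T : measurableType d} {R : realType}.
Context (mu : {measure set T -> \bar R}).

Lemma mass_scale (f : T -> R) (k : R) (E : set T) : measurable E -> nonneg_fun f ->
  0 <= k -> mass mu (fun x => k * f x) E = (k%:E * mass mu f E)%E.
Proof.
move=> mE fn k0; rewrite /mass -ge0_integralZl//; first exact: nonneg_fun_EFin.
by move=> x _; rewrite lee_fin; exact: fn.2.
Qed.

(** Normalising the factors so that each of them has integral [M0], the
    weighted arithmetic-geometric mean inequality bounds their product pointwise by
    a sum whose integral is again at most [M0]. *)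
Lemma generalized_hoelder {J : finType} (u : J -> T -> R) (th M : J -> R) (M0 : R)
    (h : T -> R) (E : set T) :
  measurable E -> nonneg_fun h -> (forall j, nonneg_fun (u j)) ->
  (forall j, 0 <= th j) -> \sum_j th j <= 1 ->
  (forall j, (mass mu (u j) E <= (M j)%:E)%E) -> 0 < M0 -> (mu E <= M0%:E)%E ->
  {ae mu, forall x, E x -> h x <= \prod_j u j x `^ th j} ->
  (mass mu h E <= (M0 * \prod_j (M j / M0) `^ th j)%:E)%E.
Proof.
move=> mE hn un th0 th1 uM M00 EM hle.
have M_ge0 j : 0 <= M j by rewrite -lee_fin (le_trans _ (uM j))// mass_ge0.
have [/existsP[j /andP[/eqP Mj0 thj0]]|] := boolP [exists j, (M j == 0) && (th j != 0)].
  have u0 : mass mu (u j) E = 0%E.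
    by have := uM j; rewrite Mj0 => uj; apply/eqP; rewrite eq_le uj mass_ge0.
  have /ae_eq_integral_abs : measurable_fun E (fun x => (u j x)%:E) by exact: nonneg_fun_EFin.
  move=> /(_ mu mE)[+ _].
  have absE : (\int[mu]_(x in E) `|(u j x)%:E| = 0)%E.
    rewrite -u0; apply: eq_integral => x _.
    by rewrite gee0_abs// lee_fin; exact: (un j).2.
  move=> /(_ absE) uj0.
  suff -> : mass mu h E = 0%E.
    by rewrite lee_fin mulr_ge0 ?(ltW M00)// prodr_ge0// => i _; exact: powR_ge0.
  rewrite -[RHS](integral0 mu E); apply: ae_eq_integral => //.
  - exact: nonneg_fun_EFin.
  - near=> x => Ex; have hx : h x <= \prod_j u j x `^ th j by apply: (near hle x).
    have ux : (u j x)%:E = 0%E by apply: (near uj0 x).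
    apply/eqP; rewrite eqe eq_le (hn.2 x) andbT (le_trans hx)//.
    by case: ux => ux; rewrite (bigD1 j)//= ux powR0// mul0r.
rewrite negb_exists => /forallP Mth.
pose c j := th j * (M0 / M j).
have c_ge0 j : 0 <= c j by rewrite mulr_ge0// divr_ge0// ltW.
pose G x := \sum_j c j * u j x + (1 - \sum_j th j).
pose C := \prod_j (M j / M0) `^ th j.
have C0 : 0 <= C by rewrite prodr_ge0// => j _; exact: powR_ge0.
have pointwise x : \prod_j u j x `^ th j <= C * G x.
  have -> : \prod_j u j x `^ th j = C * \prod_j (u j x * (M0 / M j)) `^ th j.
    rewrite -big_split/=; apply: eq_bigr => j _.
    have := Mth j; rewrite negb_and negbK => /orP[Mj|/eqP ->]; last by rewrite !powRr0 mulr1.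
    have Mj0 : 0 < M j by rewrite lt0r Mj M_ge0.
    rewrite -powRM ?mulr_ge0 ?invr_ge0 ?(ltW M00)//; last exact: (un j).2.
    by congr (_ `^ _); field; rewrite Mj gt_eqF.
  rewrite ler_wpM2l//.
  have := weighted_amgm (fun j => u j x * (M0 / M j)) th _ th0 th1.
  move=> /(_ (fun j => mulr_ge0 ((un j).2 x) (divr_ge0 (ltW M00) (M_ge0 j)))).
  move=> /le_trans; apply; rewrite /G lerD2r ler_sum// => j _.
  by rewrite /c mulrAC -mulrA.
have unn j : nonneg_fun (fun x => c j * u j x).
  split; last by move=> x; rewrite mulr_ge0//; exact: (un j).2.
  by apply: measurable_funM => //; exact: (un j).1.
have sumn : nonneg_fun (fun x => \sum_j c j * u j x).
  split; last by move=> x; rewrite sumr_ge0// => j _; exact: (unn j).2.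
  by apply: measurable_sum => j; exact: (unn j).1.
have r0 : 0 <= 1 - \sum_j th j by rewrite subr_ge0.
have Gn : nonneg_fun G.
  split; last by move=> x; rewrite addr_ge0//; exact: sumn.2.
  by apply: measurable_funD => //; exact: sumn.1.
have CGn : nonneg_fun (fun x => C * G x).
  split; last by move=> x; rewrite mulr_ge0//; exact: Gn.2.
  by apply: measurable_funM => //; exact: Gn.1.
apply: (@le_trans _ _ (mass mu (fun x => C * G x) E)).
  apply: ae_ge0_le_integral => //; try exact: nonneg_fun_EFin.
  - by move=> x _; rewrite lee_fin; exact: hn.2.
  - by move=> x _; rewrite lee_fin; exact: CGn.2.
  - by near=> x => Ex; rewrite lee_fin (le_trans _ (pointwise x))//; apply: (near hle x).
rewrite mass_scale//.
rewrite mulrC EFinM lee_wpmul2l ?lee_fin//.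
have -> : mass mu G E = (\sum_j (c j)%:E * mass mu (u j) E + (1 - \sum_j th j)%:E * mu E)%E.
  rewrite {1}/mass; under eq_integral => x _ do rewrite /G EFinD.
  rewrite ge0_integralD//; last 2 first.
  - by move=> x _; rewrite lee_fin; exact: sumn.2.
  - exact: (nonneg_fun_EFin _ sumn).
  rewrite integral_cst//; congr (_ + _)%E.
  under eq_integral => x _ do rewrite -sumEFin.
  rewrite ge0_integral_sum//; last 2 first.
  - by move=> j; exact: (nonneg_fun_EFin _ (unn j)).
  - by move=> j x _; rewrite lee_fin; exact: (unn j).2.
  by apply: eq_bigr => j _; rewrite -mass_scale.
have bound : (\sum_j (c j)%:E * mass mu (u j) E + (1 - \sum_j th j)%:E * mu E <=
    \sum_j (th j * M0)%:E + (1 - \sum_j th j)%:E * M0%:E)%E.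
  apply: leeD; last by rewrite lee_wpmul2l ?lee_fin.
  apply: lee_sum => j _.
  apply: le_trans (lee_wpmul2l _ (uM j)) _; first by rewrite lee_fin.
  rewrite -EFinM lee_fin /c -mulrA ler_wpM2l//.
  have [->|Mj] := eqVneq (M j) 0; first by rewrite mulr0 ltW.
  by rewrite divfK.
apply: le_trans bound _.
rewrite sumEFin -EFinM -EFinD lee_fin -mulr_suml mulrBl mul1r.
by rewrite addrC subrK.
Unshelve. all: by end_near.
Qed.

End generalized_hoelder.

(** * Consequences of the A_(P,q) condition *)

Section dual_weights.
Context {R : realType} {n m : nat}.
Local Notation mu := (lebesgue_rV R n).
Context (P : 'I_m -> R) (w : 'I_m -> Rn R n -> R) (p q alpha W : R).

(** The numbers [d i] stand for the factors of the A_(P,q) condition and the functions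
    [y i] for the normalised dual weights [w i `^ (- p')]. When [P i = 1] the exponent of
    [y i] is 0, and [d i] bounds the reciprocal of the weight on the cube. *)
Definition dual_data (Q : 'rV[R]_n * R) := exists (d : 'I_m -> R) (y : 'I_m -> Rn R n -> R),
  [/\ forall i, 0 < d i, forall i, nonneg_fun (y i),
    forall i, (mass mu (y i) (cube Q.1 Q.2) <= ((2 * Q.2) ^+ n)%:E)%E,
    {ae mu, forall x, cube Q.1 Q.2 x ->
       forall i, 1 <= w i x * (d i * y i x `^ (1 - (P i)^-1))} &
    (\prod_i d i) `^ q * cube_mass (fun x => nu w x `^ q) Q <= W * (2 * Q.2) ^+ n].

Hypothesis n0 : (0 < n)%N.
Hypothesis m0 : (0 < m)%N.
Hypothesis P1 : forall i, 1 <= P i.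
Hypothesis pE : p^-1 = \sum_i (P i)^-1.
Hypothesis qE : q^-1 = p^-1 - alpha / n%:R.
Hypothesis q0 : 0 < q.
Hypothesis alpha0 : 0 < alpha.
Hypothesis w_nn : forall i, nonneg_fun (w i).

Definition power_weight (x : Rn R n) : R := nu w x `^ q.

Lemma nonneg_fun_power_weight : nonneg_fun power_weight.
Proof.
split=> [|x]; last exact: powR_ge0.
apply: (measurableT_comp (measurable_powR q)).
by apply: measurable_prod => i _; exact: (w_nn i).1.
Qed.

Let v_nn := nonneg_fun_power_weight.

Let nu_ge0 x : 0 <= nu w x.
Proof. by rewrite /nu prodr_ge0// => i _; exact: (w_nn i).2. Qed.

Let Pinv i : 0 <= (P i)^-1 <= 1.
Proof. by rewrite invr_ge0 invf_le1 ?(lt_le_trans ltr01 (P1 i))// P1 (le_trans ler01 (P1 i)). Qed.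

Hypothesis vloc : locally_finite power_weight.
Hypothesis data : forall Q : 'rV[R]_n * R, 0 < Q.2 -> dual_data Q.

(** On the cube, 1 is at most [(\prod_i w i * d i * y i `^ (1 - (P i)^-1)) `^ m%:R^-1];
    Hoelder's inequality on [E] with the exponents [1 / (m * q)] for the power weight and
    [(1 - (P i)^-1) / m] for [y i], whose sum is [1 - alpha / (m * n)], compares the measure
    of [E] with its weighted mass. *)
Lemma dual_Ainfty : Ainfty W (m%:R * q) power_weight.
Proof.
move=> Q E Q0 mE EQ; have [d [y [d0 ynn yQ ae1 dW]]] := data Q Q0.
set u := (2 * Q.2) ^+ n in yQ dW *.
have u0 : 0 < u by rewrite exprn_gt0// mulr_gt0.
have mR : 0 < m%:R :> R by rewrite ltr0n.
have mq0 : 0 < m%:R * q by rewrite mulr_gt0.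
pose D := \prod_i d i; have D0 : 0 < D by rewrite prodr_gt0.
have mQ : measurable (cube Q.1 Q.2 : set (Rn R n)) by exact: measurable_cube.
have finv : mass mu power_weight E \is a fin_num.
  by rewrite ge0_fin_numE ?mass_ge0// (le_lt_trans _ (vloc Q.1 Q.2))// mass_le.
have muEu : (mu E <= u%:E)%E.
  by rewrite -(mu_cube n0 Q.1 Q.2 (ltW Q0)); apply: mu_le.
have finE : mu E \is a fin_num by rewrite ge0_fin_numE// (le_lt_trans muEu)// ltry.
pose uu (j : 'I_1 + 'I_m) := if j is inr i then y i else power_weight.
pose th (j : 'I_1 + 'I_m) := if j is inr i then (1 - (P i)^-1) / m%:R else (m%:R * q)^-1.
pose M (j : 'I_1 + 'I_m) := if j is inr i then u else fine (mass mu power_weight E).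
have sumth : \sum_j th j = 1 - alpha / n%:R / m%:R.
  rewrite big_sumType/= big_ord1 -mulr_suml big_split/= sumr_const card_ord sumrN -pE.
  have -> : p^-1 = q^-1 + alpha / n%:R by rewrite qE subrK.
  by field; rewrite !gt_eqF// ltr0n.
have prodM : u * \prod_j (M j / u) `^ th j =
    u * (fine (mass mu power_weight E) / u) `^ (m%:R * q)^-1.
  rewrite big_sumType/= big_ord1 big1 ?mulr1// => i _.
  by rewrite divff ?gt_eqF// powR1.
have cn : nonneg_fun (fun _ : Rn R n => D `^ (- m%:R^-1)).
  by split => [|x]; [exact: measurable_cst|exact: powR_ge0].
have hoelder : (mass mu (fun _ : Rn R n => (D `^ (- m%:R^-1))%R) E <=
    (u * \prod_j (M j / u) `^ th j)%:E)%E.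
  apply: (generalized_hoelder mu uu th M u) => //.
  - by move=> [j|i]; [exact: v_nn|exact: ynn].
  - move=> [j|i]; first by rewrite invr_ge0 ltW.
    by rewrite divr_ge0 ?(ltW mR)// subr_ge0; have /andP[] := Pinv i.
  - rewrite sumth lerBlDr lerDl !divr_ge0 ?(ltW alpha0)//.
  - move=> [j|i] /=; first by rewrite fineK.
    by apply: le_trans (yQ i); apply: mass_le.
  - near=> x => Ex; have wx : forall i, 1 <= w i x * (d i * y i x `^ (1 - (P i)^-1)).
      by apply: (near ae1 x) => //; exact: EQ.
    rewrite big_sumType/= big_ord1.
    have y_ge0 i : 0 <= y i x := (ynn i).2 x.
    have Y0 : 0 <= \prod_i y i x `^ (1 - (P i)^-1).
      by rewrite prodr_ge0// => i _; exact: powR_ge0.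
    have one : 1 <= nu w x * (D * \prod_i y i x `^ (1 - (P i)^-1)).
      have ones : \prod_(i < m) (1 : R) = 1 by rewrite big1.
      rewrite /nu /D -!big_split/= -[leLHS]ones.
      by apply: ler_prod => i _; rewrite ler01 wx.
    have -> : power_weight x `^ (m%:R * q)^-1 = nu w x `^ m%:R^-1.
      by rewrite /power_weight -powRrM; congr (_ `^ _); field; rewrite !gt_eqF.
    rewrite (eq_bigr (fun i => (y i x `^ (1 - (P i)^-1)) `^ m%:R^-1)) => [|i _]; last first.
      by rewrite powRrM.
    rewrite prod_powR_base => [|i]; last exact: powR_ge0.
    rewrite powRN -[leLHS]mul1r ler_pdivrMr ?powR_gt0// -powRM//.
    rewrite -powRM ?mulr_ge0 ?(ltW D0)// -mulrA [in leRHS](mulrC _ D).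
    by rewrite -[leLHS](powRr0 (nu w x * (D * \prod_i y i x `^ (1 - (P i)^-1)))) ler_powR// invr_ge0 ltW.
move: hoelder; rewrite prodM /mass integral_cst//.
rewrite -[X in (_ * X <= _)%E](fineK finE) -EFinM lee_fin => main.
have mE0 : 0 <= fine (mu E) by rewrite fine_ge0.
have V0 : 0 <= fine (mass mu power_weight E) by rewrite fine_ge0// mass_ge0.
have cm0 : 0 <= cube_mass power_weight Q by exact: cube_mass_ge0.
have {main} : (D `^ (- m%:R^-1) * fine (mu E)) `^ (m%:R * q) <=
    (u * (fine (mass mu power_weight E) / u) `^ (m%:R * q)^-1) `^ (m%:R * q).
  by rewrite ge0_ler_powR ?(ltW mq0) ?nnegrE ?mulr_ge0 ?powR_ge0// ltW.
rewrite powRM ?powR_ge0// (powRM _ (ltW u0)) ?powR_ge0//.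
rewrite powRVK ?gt_eqF ?divr_ge0 ?(ltW u0)//.
rewrite -powRrM (_ : - m%:R^-1 * (m%:R * q) = - q); last by field; rewrite gt_eqF.
rewrite powRN ler_pdivrMl ?powR_gt0// => main.
have := ler_wpM2r cm0 main; move=> /le_trans; apply.
rewrite (_ : _ * cube_mass _ _ = u `^ (m%:R * q) * fine (mass mu power_weight E) / u *
   (D `^ q * cube_mass power_weight Q)); last by ring.
have uV : 0 <= u `^ (m%:R * q) * fine (mass mu power_weight E) / u.
  by rewrite !mulr_ge0 ?powR_ge0 ?invr_ge0 ?(ltW u0).
apply: le_trans (ler_wpM2l uV dW) _.
rewrite le_eqVlt; apply/orP; left; apply/eqP; field.
by rewrite gt_eqF.
Unshelve. all: by end_near.
Qed.

Context (f : 'I_m -> Rn R n -> R).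
Hypothesis f_nn : forall i, nonneg_fun (f i).
Hypothesis floc : forall i, locally_finite (f i).

Definition weighted_power i (x : Rn R n) : R := f i x `^ P i * w i x `^ P i.

Lemma nonneg_fun_weighted_power i : nonneg_fun (weighted_power i).
Proof.
split=> [|x]; last by rewrite mulr_ge0// powR_ge0.
apply: measurable_funM; apply: (measurableT_comp (measurable_powR (P i))).
  exact: (f_nn i).1.
exact: (w_nn i).1.
Qed.

Let g_nn := nonneg_fun_weighted_power.

Let P0 i : 0 < P i. Proof. exact: lt_le_trans (P1 i). Qed.

(** Hoelder's inequality for [f i = (f i * w i) * (w i)^-1], with the reciprocal of the
    weight estimated by the dual data. *)
Lemma dual_cube_mass_le (Q : 'rV[R]_n * R) i (d : R) (y : Rn R n -> R) :
  0 < Q.2 -> 0 < d -> nonneg_fun y -> locally_finite (weighted_power i) ->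
  (mass mu y (cube Q.1 Q.2) <= ((2 * Q.2) ^+ n)%:E)%E ->
  {ae mu, forall x, cube Q.1 Q.2 x -> 1 <= w i x * (d * y x `^ (1 - (P i)^-1))} ->
  cube_mass (f i) Q <= d * ((2 * Q.2) ^+ n *
    (cube_mass (weighted_power i) Q / (2 * Q.2) ^+ n) `^ (P i)^-1).
Proof.
move=> Q0 d0 yn gloc yQ ae1; set u := (2 * Q.2) ^+ n in yQ *.
have u0 : 0 < u by rewrite exprn_gt0// mulr_gt0.
have mQ : measurable (cube Q.1 Q.2 : set (Rn R n)) by exact: measurable_cube.
pose uu (j : 'I_1 + 'I_1) := if j is inr _ then y else weighted_power i.
pose th (j : 'I_1 + 'I_1) := if j is inr _ then 1 - (P i)^-1 else (P i)^-1.
pose M (j : 'I_1 + 'I_1) := if j is inr _ then u else cube_mass (weighted_power i) Q.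
have fd : nonneg_fun (fun x => d^-1 * f i x).
  split=> [|x]; last by rewrite mulr_ge0 ?invr_ge0 ?(ltW d0)//; exact: (f_nn i).2.
  by apply: measurable_funM => //; exact: (f_nn i).1.
have hoelder : (mass mu (fun x => d^-1 * f i x)%R (cube Q.1 Q.2) <=
    (u * \prod_j (M j / u) `^ th j)%:E)%E.
  apply: (generalized_hoelder mu uu th M u) => //.
  - by move=> [j|j]; [exact: g_nn|exact: yn].
  - by move=> [j|j] /=; have /andP[] := Pinv i => // _; rewrite subr_ge0.
  - by rewrite big_sumType/= !big_ord1 addrC subrK.
  - by move=> [j|j] //=; rewrite -cube_massE.
  - by rewrite mu_cube// ltW.
  - near=> x => Qx; have wx : 1 <= w i x * (d * y x `^ (1 - (P i)^-1)).
      exact: (near ae1 x).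
    rewrite big_sumType/= !big_ord1 /weighted_power.
    have fx := (f_nn i).2 x; have wx0 := (w_nn i).2 x.
    rewrite -powRM// powRK ?gt_eqF ?mulr_ge0// ler_pdivrMl//.
    rewrite (_ : d * _ = f i x * (w i x * (d * y x `^ (1 - (P i)^-1)))); last by ring.
    by rewrite ler_peMr.
move: hoelder; rewrite mass_scale ?invr_ge0 ?(ltW d0)// (cube_massE (f i) Q)//.
rewrite -EFinM lee_fin ler_pdivrMl// big_sumType/= !big_ord1.
by rewrite divff ?gt_eqF// powR1 mulr1.
Unshelve. all: by end_near.
Qed.

Hypothesis gfin : forall i, (mass mu (weighted_power i) setT < +oo)%E.

Lemma locally_finite_weighted_power i : locally_finite (weighted_power i).
Proof.
move=> c r; apply: le_lt_trans (gfin i); apply: mass_le => //.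
exact: measurable_cube.
Qed.

Let gloc := locally_finite_weighted_power.

(** The powers of the volume combine to [q * (alpha / n - 1 / p) = - 1]; this is where
    the relation between [p], [q] and [alpha] enters. *)
Lemma dual_key (Q : 'rV[R]_n * R) : 0 < Q.2 ->
  mean power_weight Q * level (m%:R - alpha / n%:R) f Q `^ q * (2 * Q.2) ^+ n <=
  W * \prod_i cube_mass (weighted_power i) Q `^ (q / P i).
Proof.
move=> Q0; have [d [y [d0 ynn yQ ae1 dW]]] := data Q Q0.
have fle i : cube_mass (f i) Q <= d i * ((2 * Q.2) ^+ n *
    (cube_mass (weighted_power i) Q / (2 * Q.2) ^+ n) `^ (P i)^-1).
  apply: (dual_cube_mass_le Q i (d i) (y i)) => //.
  by apply: filterS ae1 => x h Qx; exact: h.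
set u := (2 * Q.2) ^+ n in yQ dW fle *.
have u0 : 0 < u by rewrite exprn_gt0// mulr_gt0.
have un0 : u != 0 by rewrite gt_eqF.
pose D := \prod_i d i; have D0 : 0 < D by rewrite prodr_gt0.
pose G i := cube_mass (weighted_power i) Q.
have G0 i : 0 <= G i by exact: cube_mass_ge0.
have F0 i : 0 <= cube_mass (f i) Q by exact: cube_mass_ge0.
have cm0 : 0 <= cube_mass power_weight Q by exact: cube_mass_ge0.
have PG0 : 0 <= \prod_i G i `^ (P i)^-1.
  by rewrite prodr_ge0// => i _; exact: powR_ge0.
have prod_le : \prod_i cube_mass (f i) Q <=
    D * (u `^ (m%:R - p^-1) * \prod_i G i `^ (P i)^-1).
  apply: (@le_trans _ _ (\prod_i (d i * (u `^ (1 - (P i)^-1) * G i `^ (P i)^-1)))).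
    apply: ler_prod => i _; rewrite F0/=; apply: le_trans (fle i) _.
    rewrite ler_wpM2l ?(ltW (d0 i))// -/(G i) powRM ?invr_ge0 ?(ltW u0)//.
    rewrite -[u^-1]powR_inv1 ?(ltW u0)// -powRrM mulrCA mulrC mulN1r.
    by rewrite powRD ?un0 ?implybT// powRr1 ?(ltW u0).
  rewrite !big_split/= -/D.
  rewrite (_ : \prod_i u `^ (1 - (P i)^-1) = u `^ (m%:R - p^-1))//.
  have -> : m%:R - p^-1 = \sum_i (1 - (P i)^-1).
    by rewrite big_split/= sumr_const card_ord sumrN -pE.
  apply: (big_ind2 (fun a b => a = u `^ b)) => [|a1 b1 a2 b2 -> ->|//].
    by rewrite powRr0.
  by rewrite powRD// un0 implybT.
have level_le : level (m%:R - alpha / n%:R) f Q <=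
    D * (u `^ (- q^-1) * \prod_i G i `^ (P i)^-1).
  rewrite /level -/u ler_pdivrMr ?powR_gt0//; apply: le_trans prod_le _.
  rewrite -mulrA ler_wpM2l ?(ltW D0)// mulrAC ler_wpM2r// -powRD ?un0 ?implybT//.
  by rewrite (_ : - q^-1 + (m%:R - alpha / n%:R) = m%:R - p^-1)// qE; ring.
have Lq : level (m%:R - alpha / n%:R) f Q `^ q <=
    D `^ q * (u^-1 * \prod_i G i `^ (q / P i)).
  apply: le_trans (ge0_ler_powR _ _ _ level_le) _; rewrite ?nnegrE ?(ltW q0)//.
  - by rewrite level_ge0.
  - by rewrite !mulr_ge0 ?powR_ge0 ?(ltW D0).
  rewrite !powRM ?mulr_ge0 ?powR_ge0 ?(ltW D0)// -powRrM mulNr mulVf ?gt_eqF//.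
  rewrite powR_inv1 ?(ltW u0)// -prod_powR_base => [|i]; last exact: powR_ge0.
  rewrite (eq_bigr (fun i => G i `^ (q / P i)))// => i _.
  by rewrite -powRrM mulrC.
have PGq0 : 0 <= \prod_i G i `^ (q / P i).
  by rewrite prodr_ge0// => i _; exact: powR_ge0.
rewrite /mean -/u mulrAC divfK//.
apply: le_trans (ler_wpM2l cm0 Lq) _.
rewrite [leLHS](_ : _ = D `^ q * cube_mass power_weight Q * (u^-1 * \prod_i G i `^ (q / P i))); last by ring.
have h0 : 0 <= u^-1 * \prod_i G i `^ (q / P i) by rewrite mulr_ge0// invr_ge0 ltW.
apply: le_trans (ler_wpM2r h0 dW) _.
by rewrite -mulrA mulVKf.
Qed.

End dual_weights.

Section dual_factor.
Context {R : realType} {n : nat}.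
Local Notation mu := (lebesgue_rV R n).
Context (c : 'rV[R]_n) (r : R).
Hypothesis n0 : (0 < n)%N.
Hypothesis r0 : 0 < r.
Local Notation Q := (cube c r).
Local Notation u := ((2 * r) ^+ n).

Let u0 : 0 < u. Proof. by rewrite exprn_gt0// mulr_gt0. Qed.
Let mQ : measurable (Q : set (Rn R n)). Proof. exact: measurable_cube. Qed.
Let muQ : mu Q = u%:E. Proof. by rewrite mu_cube// ltW. Qed.

Lemma averageE (g : Rn R n -> \bar R) : average Q g = (u^-1%:E * \int[mu]_(x in Q) g x)%E.
Proof. by rewrite /average muQ inver gt_eqF. Qed.

Lemma ae_cube_exists (A : Rn R n -> Prop) :
  {ae mu, forall x, Q x -> A x} -> exists2 x, Q x & A x.
Proof.
move=> [N [mN N0 AN]]; apply: contrapT => no.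
have : (mu Q <= mu N)%E.
  apply: mu_le => x Qx; apply: AN => /= h; apply: no; exists x => //; exact: h.
by rewrite N0 muQ lee_fin leNgt u0.
Qed.

Lemma integral_cube_gt0 (z : Rn R n -> \bar R) : measurable_fun Q z ->
  (forall x, (0 < z x)%E) -> (0 < \int[mu]_(x in Q) z x)%E.
Proof.
move=> mz z0; rewrite lt0e integral_ge0 ?andbT => [|x _]; last exact: ltW.
apply/negP => /eqP zz.
have [+ _] := ae_eq_integral_abs mu mQ mz.
have -> : (\int[mu]_(x in Q) `|z x| = \int[mu]_(x in Q) z x)%E.
  by apply: eq_integral => x _; rewrite gee0_abs// ltW.
move=> /(_ zz) /ae_cube_exists[x _ zx0].
by have := z0 x; rewrite zx0 ltxx.
Qed.

Context (w : Rn R n -> R) (q : R).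
Hypothesis w_nn : nonneg_fun w.
Hypothesis q0 : 0 < q.

Lemma ess_inf_on_ge0 : (0 <= ess_inf_on Q w)%E.
Proof.
apply: ereal_sup_ubound; apply: aeW => x _.
by rewrite lee_fin; exact: w_nn.2.
Qed.

Lemma ess_inf_on_lty : (ess_inf_on Q w < +oo)%E.
Proof.
rewrite ltNge leye_eq; apply/negP => /eqP e.
have large (N : nat) : {ae mu, forall x, Q x -> (N%:R%:E <= (w x)%:E)%E}.
  have : (N%:R%:E < ess_inf_on Q w)%E by rewrite e ltry.
  move=> /ereal_sup_gt[y ae_y Ny].
  by apply: filterS ae_y => x h Qx; rewrite (le_trans (ltW Ny))// h.
have /ae_cube_exists[x _ xN] : {ae mu, forall x, Q x -> forall N : nat, N%:R <= w x}.
  have : {ae mu, forall x, forall N : nat, Q x -> (N%:R%:E <= (w x)%:E)%E}.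
    exact/ae_foralln.
  by apply: filterS => x h Qx N; rewrite -lee_fin; exact: h.
have := xN (Num.trunc (w x)).+1.
by rewrite leNgt truncnS_gt.
Qed.

Definition inv_power (p' : R) (x : Rn R n) : \bar R := ((w x `^ p')%:E^-1)%E.

Lemma inv_powerE p' x : inv_power p' x =
  if w x `^ p' == 0 then +oo%E else (w x `^ (- p'))%:E.
Proof. by rewrite /inv_power inver powRN. Qed.

Lemma measurable_inv_power p' : measurable_fun setT (inv_power p').
Proof.
rewrite (_ : inv_power p' = fun x => if w x `^ p' == 0 then +oo%E else (w x `^ (- p'))%:E).
  apply: measurable_fun_ifT.
  - apply: (measurable_fun_eqr (f := fun x => w x `^ p') (g := cst 0)).
      exact: (measurableT_comp (measurable_powR p') w_nn.1).
    exact: measurable_cst.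
  - exact: measurable_cst.
  - apply/measurable_EFinP.
    exact: (measurableT_comp (measurable_powR (- p')) w_nn.1).
by apply/funext => x; exact: inv_powerE.
Qed.

Lemma inv_power_gt0 p' x : (0 < inv_power p' x)%E.
Proof.
rewrite inv_powerE; case: ifPn => // wx.
rewrite lte_fin powRN invr_gt0 lt0r wx powR_ge0//.
Qed.

Lemma conjugate_exponent (p : R) : 1 < p ->
  fine (hoelder_conjugate p%:E) = p / (p - 1).
Proof.
move=> p1; rewrite /hoelder_conjugate/= eqe gt_eqF ?(lt_trans ltr01)//.
by rewrite -EFinD inver subr_eq0 gt_eqF.
Qed.

Lemma dual_factor_gt0 p : 1 <= p -> (0 < dual_factor p q w Q)%E.
Proof.
move=> p1; rewrite /dual_factor; case: ifPn => [_|pn1].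
  apply: poweR_gt0; rewrite lt0e inve_eq0 inve_ge0 ess_inf_on_ge0 andbT.
  by rewrite -ltey ess_inf_on_lty.
apply: poweR_gt0; rewrite averageE mule_gt0//; first by rewrite lte_fin invr_gt0.
apply: integral_cube_gt0; last by move=> x; exact: inv_power_gt0.
exact: measurable_funTS (measurable_inv_power _).
Qed.

(** The factor [2 `^ q] comes from the case [p = 1], in which half of the essential infimum
    serves as the lower bound of the weight: being below the supremum, it is a lower bound
    almost everywhere by definition. *)
Lemma dual_factor_data p : 1 <= p -> (dual_factor p q w Q < +oo)%E ->
  exists (d : R) (y : Rn R n -> R), [/\ 0 < d, nonneg_fun y, (mass mu y Q <= u%:E)%E,
    {ae mu, forall x, Q x -> 1 <= w x * (d * y x `^ (1 - p^-1))} &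
    ((d `^ q)%:E <= (2 `^ q)%:E * dual_factor p q w Q)%E].
Proof.
move=> p1; rewrite /dual_factor; case: ifPn => [/eqP ->|pn1].
  move=> dfin; have e0 : (ess_inf_on Q w != 0)%E.
    by apply: contraTneq dfin => ->; rewrite inve0 poweRyr// gt_eqF.
  have efin : ess_inf_on Q w \is a fin_num.
    by rewrite ge0_fin_numE ?ess_inf_on_lty ?ess_inf_on_ge0.
  have : ess_inf_on Q w = (fine (ess_inf_on Q w))%:E by rewrite fineK.
  set e := fine _ => eE.
  have epos : 0 < e.
    by rewrite -lte_fin -eE lt0e e0 ess_inf_on_ge0.
  have : ((e / 2)%:E < ess_inf_on Q w)%E.
    by rewrite eE lte_fin ltr_pdivrMr// ltr_pMr// ltr1n.
  move=> /ereal_sup_gt[y ae_y ey].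
  exists (2 / e), (cst 1); split.
  - by rewrite divr_gt0.
  - by split => [|x]; [exact: measurable_cst|rewrite /= ler01].
  - rewrite (_ : mass mu _ Q = (1 * mu Q)%E); last exact: (integral_cst mu mQ 1%E).
    by rewrite mul1e muQ.
  - apply: filterS ae_y => x h Qx; rewrite /= invr1 subrr powRr0 mulr1.
    rewrite mulrA ler_pdivlMr// mul1r mulrC -ler_pdivrMl// mulrC -lee_fin.
    by rewrite (le_trans (ltW ey))// h.
  - rewrite eE inver gt_eqF// poweR_EFin -EFinM lee_fin.
    by rewrite powRM// ?invr_ge0 ltW.
have p_gt1 : 1 < p by rewrite lt_neqAle eq_sym pn1.
have pp0 : 0 < p by rewrite (lt_trans ltr01).
rewrite conjugate_exponent//; set p' := p / (p - 1).
have p'0 : 0 < p' by rewrite divr_gt0// subr_gt0.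
have p'E : 1 - p^-1 = p'^-1.
  by rewrite /p' invf_div mulrBl divff ?gt_eqF// mul1r.
rewrite -[fun x => _]/(inv_power p') averageE => afin.
set Z := (\int[mu]_(x in Q) inv_power p' x)%E in afin *.
have Z0 : (0 < Z)%E.
  apply: integral_cube_gt0; last by move=> x; exact: inv_power_gt0.
  exact: measurable_funTS (measurable_inv_power _).
have Zfin : Z \is a fin_num.
  rewrite ge0_fin_numE ?(ltW Z0)// ltNge leye_eq; apply: contraTN afin => /eqP ->.
  rewrite gt0_muley ?lte_fin ?invr_gt0// poweRyr ?ltxx//.
  by rewrite gt_eqF// divr_gt0.
have a0 : 0 < u^-1 * fine Z by rewrite mulr_gt0 ?invr_gt0 ?fine_gt0// Z0 -ge0_fin_numE ?(ltW Z0).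
have aE : (u^-1%:E * Z = (u^-1 * fine Z)%:E)%E by rewrite EFinM fineK.
have Za : fine Z = u^-1 * fine Z * u by rewrite mulrAC mulVf ?mul1r// gt_eqF.
rewrite aE; move: a0 Za {aE}; move: (_ * fine Z) => a a0 Za.
have yn : nonneg_fun (fun x => a^-1 * w x `^ (- p')).
  split=> [|x]; last by rewrite mulr_ge0 ?powR_ge0// invr_ge0 ltW.
  apply: measurable_funM; first exact: measurable_cst.
  exact: (measurableT_comp (measurable_powR (- p')) w_nn.1).
have wn : nonneg_fun (fun x => w x `^ (- p')).
  split=> [|x]; last exact: powR_ge0.
  exact: (measurableT_comp (measurable_powR (- p')) w_nn.1).
exists (a `^ p'^-1), (fun x => a^-1 * w x `^ (- p')); split => //.
- by rewrite powR_gt0.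
- rewrite mass_scale ?invr_ge0 ?(ltW a0)//.
  apply: (@le_trans _ _ ((a^-1)%:E * Z)%E).
    apply: lee_wpmul2l; first by rewrite lee_fin invr_ge0 ltW.
    apply: ge0_le_integral => //.
    + by move=> x _; rewrite lee_fin powR_ge0.
    + exact: (nonneg_fun_EFin _ wn).
    + exact: measurable_funTS (measurable_inv_power _).
    + by move=> x _; rewrite inv_powerE; case: ifP => // _; rewrite leey.
  by rewrite -(fineK Zfin) -EFinM lee_fin Za mulKf// gt_eqF.
- have intZ : mu.-integrable Q (inv_power p').
    apply/integrableP; split; first exact: measurable_funTS (measurable_inv_power _).
    rewrite (eq_integral (inv_power p')) => [|x _].
      by rewrite -ge0_fin_numE ?(ltW Z0).
    by rewrite gee0_abs// ltW// inv_power_gt0.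
  have := integrable_ae mQ intZ.
  apply: filterS => x h Qx; have := h Qx; rewrite inv_powerE.
  case: ifPn => // wx _.
  have wpos : 0 < w x.
    rewrite lt0r w_nn.2 andbT; apply: contraNneq wx => ->.
    by rewrite powR0// gt_eqF.
  rewrite p'E powRM ?powR_ge0 ?invr_ge0 ?(ltW a0)//.
  rewrite -(powRrM (w x)) mulNr divff ?gt_eqF// powR_inv1 ?(ltW wpos)//.
  rewrite -[a^-1]powR_inv1 ?(ltW a0)// -powRrM mulN1r powRN mulVKf ?gt_eqF ?powR_gt0// divff ?gt_eqF//.
- rewrite poweR_EFin -EFinM lee_fin -powRrM (mulrC p'^-1) ler_peMl ?powR_ge0//.
  by rewrite -[leLHS](powRr0 2) ler_powR ?ler1n// ltW.
Qed.

End dual_factor.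

(** * The maximal function *)

Section maximal_function.
Context {R : realType} {n m : nat}.
Local Notation mu := (lebesgue_rV R n).
Hypothesis n0 : (0 < n)%N.
Hypothesis m0 : (0 < m)%N.

Lemma nonneg_fun_norm (f : Rn R n -> R) : locally_integrable_Rn f ->
  nonneg_fun (fun x => `|f x|).
Proof.
move=> [mf _]; split=> [|x]; last exact: normr_ge0.
exact: (measurableT_comp (@normr_measurable R setT) mf).
Qed.

Lemma locally_finite_norm (f : Rn R n -> R) : locally_integrable_Rn f ->
  locally_finite (fun x => `|f x|).
Proof.
move=> fl; have fn := nonneg_fun_norm f fl; move=> c r.
pose A (i : 'I_n) : set R := `[c ord0 i - r, c ord0 i + r]%classic.
pose K : set (Rn R n) := [set x : 'rV[R]_n | forall i, A i (x ord0 i)].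
have cK : compact (K : set 'rV[R]_n).
  by apply: (@rV_compact R n A) => i; exact: segment_compact.
apply: le_lt_trans (fl.2 _ cK); apply: mass_le => //.
- exact: measurable_cube.
- apply: borel_measurable_Rn.
  rewrite (_ : K = \bigcap_(i in [set: 'I_n]) (rV_coord i @^-1` A i)); last first.
    by apply/seteqP; split => x xK i; [move=> _|]; exact: xK.
  apply: fin_bigcap_measurable; first exact: finite_finset.
  move=> i _; rewrite -[X in measurable X]setTI; apply: measurable_rV_coord => //.
  exact: measurable_itv.
- move=> x xc i; rewrite /A/= in_itv/=; have := xc i.
  by rewrite ltr_distl => /andP[/ltW -> /ltW ->].
Qed.

Context (w : 'I_m -> Rn R n -> R) (q alpha : R).
Hypothesis q0 : 0 < q.
Hypothesis w_nn : forall i, nonneg_fun (w i).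
Context (f : 'I_m -> Rn R n -> R).
Hypothesis f_loc : forall i, locally_integrable_Rn (f i).
Local Notation F := (fun i x => `|f i x|).

Lemma frac_maximal_factor (c : 'rV[R]_n) r : 0 < r ->
  (\prod_(i < m) ((mu (cube c r) `^ (1 - alpha / (m * n)%:R))^-1 *
     \int[mu]_(y in cube c r) `|f i y|%:E) =
   (level (m%:R - alpha / n%:R) F (c, r))%:E)%E.
Proof.
move=> r0; have u0 : 0 < (2 * r) ^+ n by rewrite exprn_gt0// mulr_gt0.
pose e := 1 - alpha / (m * n)%:R.
rewrite (eq_bigr (fun i => ((((2 * r) ^+ n) `^ e)^-1 * cube_mass (F i) (c, r))%:E)) => [|i _]; last first.
  rewrite mu_cube ?(ltW r0)// poweR_EFin inver gt_eqF ?powR_gt0// EFinM.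
  by rewrite -(cube_massE _ (c, r) (nonneg_fun_norm _ (f_loc i)) (locally_finite_norm _ (f_loc i))).
rewrite prodEFin big_split/= prodr_const card_ord mulrC /level; congr EFin; congr (_ * _).
rewrite exprVn -(@powR_mulrn _ (_ `^ _)) ?powR_ge0// -powRrM; congr (_^-1); congr (_ `^ _).
by rewrite /e natrM; field; rewrite !pnatr_eq0 -!lt0n n0 m0.
Qed.

Lemma frac_maximal_level (l : R) (x : Rn R n) : 0 < l ->
  (l%:E < `|frac_maximal alpha f x * (nu w x)%:E|)%E ->
  exists Q : 'rV[R]_n * R, [/\ 0 < Q.2, cube Q.1 Q.2 x &
    l `^ q < level (m%:R - alpha / n%:R) F Q `^ q * power_weight w q x].
Proof.
move=> l0.
have M0 : (0 <= frac_maximal alpha f x)%E.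
  apply: (@le_trans _ _ (level (m%:R - alpha / n%:R) F ((x : 'rV[R]_n), 1))%:E).
    by rewrite lee_fin; apply: level_ge0 => i; apply: nonneg_fun_norm (f_loc i).
  apply: ereal_sup_ubound; exists (cube x 1); last exact: frac_maximal_factor.
  by split; [exists x, 1|exact: cube_center].
have nu0 : 0 <= nu w x by rewrite prodr_ge0// => i _; exact: (w_nn i).2.
rewrite gee0_abs ?mule_ge0//.
have [->|nuN0] := eqVneq (nu w x) 0; first by rewrite mule0 lte_fin ltNge ltW.
have nupos : 0 < nu w x by rewrite lt0r nuN0.
rewrite -lte_pdivrMr// -EFinM => /ereal_sup_gt[_ [_ [[c [r [r0 ->]]] xc] <-]].
rewrite frac_maximal_factor// lte_fin => llev.
exists (c, r); split => //.
have lv0 : 0 < level (m%:R - alpha / n%:R) F (c, r).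
  by apply: lt_trans llev; rewrite divr_gt0.
rewrite /power_weight -powRM ?(ltW lv0)//.
have llt : l < level (m%:R - alpha / n%:R) F (c, r) * nu w x by rewrite -ltr_pdivrMr.
by apply: gt0_ltr_powR; rewrite ?nnegrE ?(ltW l0)// mulr_ge0// ltW.
Qed.

End maximal_function.

(** * The weak-type estimate *)

Lemma prode_gt0 {R : realType} {I : finType} (D : pred I) (F : I -> \bar R) :
  (forall i, 0 < F i)%E -> (0 < \prod_(i | D i) F i)%E.
Proof.
move=> F0; apply: (big_ind (fun x => 0 < x)%E) => //.
exact: mule_gt0.
Qed.

Lemma prode_eqy {R : realType} {I : finType} (F : I -> \bar R) i :
  (forall i, 0 < F i)%E -> F i = +oo%E -> (\prod_i F i)%E = +oo%E.
Proof.
by move=> F0 Fi; rewrite (bigD1 i)//= Fi gt0_mulye// prode_gt0.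
Qed.

Section nondegenerate_weights.
Context {R : realType} {n m : nat}.
Local Notation mu := (lebesgue_rV R n).
Context (P : 'I_m -> R) (w : 'I_m -> Rn R n -> R) (p q alpha W : R).
Hypothesis n0 : (0 < n)%N.
Hypothesis m0 : (0 < m)%N.
Hypothesis P1 : forall i, 1 <= P i.
Hypothesis pE : p^-1 = \sum_i (P i)^-1.
Hypothesis qE : q^-1 = p^-1 - alpha / n%:R.
Hypothesis q0 : 0 < q.
Hypothesis alpha0 : 0 < alpha.
Hypothesis kap0 : 0 < m%:R - alpha / n%:R.
Hypothesis w_nn : forall i, nonneg_fun (w i).
Hypothesis W0 : 0 < W.
Hypothesis vloc : locally_finite (power_weight w q).
Hypothesis vpos : forall Q : 'rV[R]_n * R, 0 < Q.2 -> 0 < cube_mass (power_weight w q) Q.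
Hypothesis data : forall Q : 'rV[R]_n * R, 0 < Q.2 -> dual_data P w q W Q.

Definition bound_const : R :=
  @weak_const R n W (m%:R * q) (m%:R - alpha / n%:R) q W + 1.

Lemma bound_const_gt0 : 0 < bound_const.
Proof.
have /andP[e0 e1] := @decay_bounds R n W (m%:R * q) W0.
have z0 : 0 <= (@threshold R n W (m%:R * q) (m%:R - alpha / n%:R) q)^-1.
  by rewrite invr_ge0 ltW// threshold_gt0.
have Ct0 : 0 <= @tail_const R n W (m%:R * q).
  by rewrite addr_ge0// mulr_ge0 ?exprn_ge0// addr_ge0// mulr_ge0 ?powR_ge0 ?(ltW W0).
have b0 : 0 <= @jump R n 1 by exact: powR_ge0.
have e1' : 0 <= (1 - @decay R n W (m%:R * q))^-1 by rewrite invr_ge0 subr_ge0 ltW.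
have f0 : 0 <= 5 ^+ n :> R by rewrite exprn_ge0.
rewrite ltr_wpDl// /weak_const addr_ge0//.
  exact: (mulr_ge0 (mulr_ge0 f0 (ltW W0)) z0).
apply: mulr_ge0 => //; apply: mulr_ge0 => //; apply: mulr_ge0 => //.
apply: mulr_ge0; last exact: ltW.
apply: mulr_ge0 => //; apply: mulr_ge0 => //; exact: mulr_ge0.
Qed.

Context (f : 'I_m -> Rn R n -> R).
Hypothesis f_loc : forall i, locally_integrable_Rn (f i).
Local Notation F := (fun i x => `|f i x|).

Let F_nn i : nonneg_fun (F i). Proof. exact: nonneg_fun_norm. Qed.
Let F_loc i : locally_finite (F i). Proof. exact: locally_finite_norm. Qed.
Let P0 i : 0 < P i. Proof. exact: lt_le_trans (P1 i). Qed.
Let g_nn i : nonneg_fun (weighted_power P w F i).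
Proof. exact: nonneg_fun_weighted_power. Qed.

Let G i := mass mu (weighted_power P w F i) setT.

Let normE i : weighted_norm (P i) (fun x => w i x `^ P i) (f i) = (G i `^ (P i)^-1)%E.
Proof. by []. Qed.

Let G_ge0 i : (0 <= G i)%E. Proof. by apply: mass_ge0. Qed.

(** A vanishing norm must not be multiplied with an infinite one: in that case the
    maximal function itself vanishes. *)
Lemma level_eq0 i (Q : 'rV[R]_n * R) : 0 < Q.2 -> G i = 0%E ->
  level (m%:R - alpha / n%:R) F Q = 0.
Proof.
move=> Q0 Gi; have gloc : locally_finite (weighted_power P w F i).
  move=> c r; apply: (@le_lt_trans _ _ (G i)); last by rewrite Gi ltry.
  by apply: mass_le => //; exact: measurable_cube.
have gQ : cube_mass (weighted_power P w F i) Q = 0.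
  apply/eqP; rewrite eq_le cube_mass_ge0// andbT -lee_fin -cube_massE//.
  by rewrite -[leRHS]Gi; apply: mass_le => //; exact: measurable_cube.
have [d [y [d0 ynn yQ ae1 _]]] := data Q Q0.
have fi : cube_mass (F i) Q <= 0.
  have := dual_cube_mass_le P w n0 P1 w_nn F F_nn F_loc Q i (d i) (y i) Q0 (d0 i) (ynn i) gloc (yQ i).
  have -> : (cube_mass (weighted_power P w F i) Q / (2 * Q.2) ^+ n) `^ (P i)^-1 = 0.
    by rewrite gQ mul0r powR0// invr_neq0// gt_eqF.
  rewrite !mulr0; apply.
  by apply: filterS ae1 => x h Qx; exact: h.
rewrite /level (bigD1 i)//= (_ : cube_mass (F i) Q = 0) ?mul0r//.
by apply/eqP; rewrite eq_le fi cube_mass_ge0.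
Qed.

Lemma sum_exponents : 1 <= \sum_i q / P i.
Proof.
rewrite -mulr_sumr -pE -(mulfV (lt0r_neq0 q0)) ler_pM2l// qE.
by rewrite gerBl divr_ge0// ltW.
Qed.

Lemma weak_norm_le :
  (weak_norm q (fun x => frac_maximal alpha f x * (nu w x)%:E) <=
   (bound_const `^ q^-1)%:E *
   \prod_(i < m) weighted_norm (P i) (fun x => (w i x `^ P i)%R) (f i))%E.
Proof.
have bc0 := bound_const_gt0.
have norm_ge0 i : (0 <= weighted_norm (P i) (fun x => (w i x `^ P i)%R) (f i))%E.
  by rewrite normE poweR_ge0.
apply: ub_ereal_sup => _ [l /= l0 <-].
set E := [set x | _].
pose L := [set x | exists Q : 'rV[R]_n * R, [/\ (0 < Q.2)%R, cube Q.1 Q.2 x &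
    (l `^ q < level (m%:R - alpha / n%:R) F Q `^ q * power_weight w q x)%R]].
have EL : (E `<=` L)%classic.
  by move=> x Ex; exact: (frac_maximal_level n0 m0 w q alpha q0 w_nn f f_loc l x l0 Ex).
have lq0 : 0 < l `^ q by rewrite powR_gt0.
have [[i Gi]|noG0] := pselect (exists i, G i = 0%E).
  have E0 : E = set0.
    apply/seteqP; split => // x /EL[Q [Q0 _]].
    by rewrite (level_eq0 i Q Q0 Gi) powR0 ?gt_eqF// mul0r ltNge (ltW lq0).
  rewrite E0 measure0 poweR0r ?invr_neq0 ?gt_eqF// mule0 mule_ge0 ?lee_fin ?powR_ge0//.
  by apply: prode_ge0 => i' _; exact: norm_ge0.
have Gpos i : (0 < G i)%E.
  by rewrite lt0e G_ge0 andbT; apply/eqP => Gi; apply: noG0; exists i.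
have npos i : (0 < weighted_norm (P i) (fun x => (w i x `^ P i)%R) (f i))%E.
  by rewrite normE poweR_gt0.
have [[i Gi]|noGy] := pselect (exists i, G i = +oo%E).
  rewrite (prode_eqy _ i)//; last by rewrite normE Gi poweRyr// invr_neq0// gt_eqF.
  by rewrite gt0_muley ?leey// lte_fin powR_gt0.
have Gfin i : (G i < +oo)%E.
  by rewrite ltey; apply/eqP => Gi; apply: noGy; exists i.
have GE i : G i = (fine (G i))%:E by rewrite fineK// ge0_fin_numE.
have est := level_set_estimate (power_weight w q) W (m%:R * q) (m%:R - alpha / n%:R) q W
  F (weighted_power P w F) (fun i => q / P i) n0
  (nonneg_fun_power_weight w q w_nn) vloc vpos.
have {est} := est _ W0 (dual_Ainfty P w p q alpha W n0 m0 P1 pE qE q0 alpha0 w_nn vloc data) q0 kap0.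
rewrite mulr_ge0 ?(ltW q0)// card_ord => /(_ isT).
rewrite gerBl divr_ge0 ?(ltW alpha0)// => /(_ isT (ltW W0)).
move=> /(_ (fun i => divr_ge0 (ltW q0) (ltW (P0 i))) sum_exponents F_nn F_loc g_nn Gfin).
move=> /(_ (dual_key P w p q alpha W n0 P1 pE qE q0 w_nn data F F_nn F_loc Gfin) _ lq0).
rewrite -/L => muL.
have prodE : (\prod_(i < m) weighted_norm (P i) (fun x => (w i x `^ P i)%R) (f i) =
    (\prod_(i < m) fine (G i) `^ (P i)^-1)%:E)%E.
  by rewrite -prodEFin; apply: eq_bigr => i _; rewrite normE GE poweR_EFin.
set Th := (\prod_i _ `^ (q / P i)) in muL.
have Th0 : 0 <= Th by rewrite prodr_ge0// => i _; exact: powR_ge0.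
have muE : (mu E <= (bound_const * Th / l `^ q)%:E)%E.
  apply: le_trans (mu_le _ _ EL) (le_trans muL _); rewrite lee_fin ler_wpM2r//.
    by rewrite invr_ge0 ltW.
  by rewrite ler_wpM2r// /bound_const lerDl.
apply: (@le_trans _ _ (l%:E * ((bound_const * Th / l `^ q)%:E `^ q^-1))%E).
  apply: lee_wpmul2l; first by rewrite lee_fin ltW.
  apply: gt0_ler_poweR => //; rewrite ?in_itv/= ?measure_ge0 ?leey ?andbT//.
    by rewrite invr_ge0 ltW.
  by rewrite lee_fin !mulr_ge0 ?invr_ge0 ?(ltW bc0) ?(ltW lq0).
rewrite poweR_EFin prodE -!EFinM lee_fin.
rewrite !powRM ?mulr_ge0 ?invr_ge0 ?(ltW bc0) ?(ltW lq0)//.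
rewrite -powRN -powRrM mulNr mulfV ?gt_eqF// powR_inv1 ?(ltW l0)//.
rewrite mulrCA mulfV ?gt_eqF// mulr1 ler_wpM2l ?powR_ge0//.
rewrite /Th -prod_powR_base => [|i]; last exact: powR_ge0.
rewrite le_eqVlt; apply/orP; left; apply/eqP; apply: eq_bigr => i _.
by rewrite -powRrM mulrAC mulfV ?gt_eqF// mul1r.
Qed.

End nondegenerate_weights.

Section weight_class.
Context {R : realType} {n m : nat}.
Local Notation mu := (lebesgue_rV R n).
Context (P : 'I_m -> R) (w : 'I_m -> Rn R n -> R) (q : R).
Hypothesis n0 : (0 < n)%N.
Hypothesis P1 : forall i, 1 <= P i.
Hypothesis q0 : 0 < q.
Hypothesis w_nn : forall i, nonneg_fun (w i).
Hypothesis wA : Apq P q w.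

Local Notation v := (power_weight w q).
Let v_nn : nonneg_fun v. Proof. exact: nonneg_fun_power_weight. Qed.

Let Apq_ge c r : 0 < r -> (average (cube c r) (fun x => (v x)%:E) *
  \prod_(i < m) dual_factor (P i) q (w i) (cube c r) <= Apq_char P q w)%E.
Proof. by move=> r0; apply: ereal_sup_ubound; exists (cube c r) => //; exists c, r. Qed.

Let averageE c r : 0 < r ->
  average (cube c r) (fun x => (v x)%:E) = ((((2 * r) ^+ n)^-1)%:E * mass mu v (cube c r))%E.
Proof. by move=> r0; rewrite (averageE c r n0 r0). Qed.

Let dual_gt0 i c r : 0 < r -> (0 < dual_factor (P i) q (w i) (cube c r))%E.
Proof. by move=> r0; exact: dual_factor_gt0. Qed.

Let average_gt0 c r : 0 < r -> (0 < mass mu v (cube c r))%E ->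
  (0 < average (cube c r) (fun x => (v x)%:E))%E.
Proof.
move=> r0 V0; rewrite averageE// mule_gt0// lte_fin invr_gt0 exprn_gt0// mulr_gt0//.
Qed.

Lemma Apq_dual_lty i c r : 0 < r -> (0 < mass mu v (cube c r))%E ->
  (dual_factor (P i) q (w i) (cube c r) < +oo)%E.
Proof.
move=> r0 V0; rewrite ltey; apply/eqP => Di.
have := le_lt_trans (Apq_ge c r r0) wA.
rewrite (prode_eqy _ i) => [|j|//]; last exact: dual_gt0.
by rewrite gt0_muley ?ltxx// average_gt0.
Qed.

Lemma Apq_mass_lty c r : 0 < r -> (mass mu v (cube c r) < +oo)%E.
Proof.
move=> r0; rewrite ltey; apply/eqP => V.
have := le_lt_trans (Apq_ge c r r0) wA.
rewrite averageE// V gt0_muley ?lte_fin ?invr_gt0 ?exprn_gt0 ?mulr_gt0//.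
by rewrite gt0_mulye ?ltxx// prode_gt0// => i; exact: dual_gt0.
Qed.

Lemma Apq_locally_finite : locally_finite v.
Proof.
move=> c r; have [r0|r0] := ltP 0 r; first exact: Apq_mass_lty.
by rewrite cube0// /mass integral_set0 ltry.
Qed.

Lemma Apq_char_gt0 c r : 0 < r -> (0 < mass mu v (cube c r))%E -> (0 < Apq_char P q w)%E.
Proof.
move=> r0 V0; apply: lt_le_trans (Apq_ge c r r0); apply: mule_gt0.
  exact: average_gt0.
by apply: prode_gt0 => i; exact: dual_gt0.
Qed.

(** All the factors of the characteristic are positive, so that a positive mass of the
    weight forces each dual factor to be finite. *)
Lemma Apq_dual_data c r : 0 < r -> (0 < mass mu v (cube c r))%E ->
  dual_data P w q ((2 `^ q) ^+ m * fine (Apq_char P q w)) (c, r).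
Proof.
move=> r0 V0.
have u0 : 0 < (2 * r) ^+ n by rewrite exprn_gt0// mulr_gt0.
have /choice[d /choice[y dy]] : forall i, exists (d : R) (y : Rn R n -> R),
   [/\ 0 < d, nonneg_fun y, (mass mu y (cube c r) <= ((2 * r) ^+ n)%:E)%E,
    {ae mu, forall x, cube c r x -> 1 <= w i x * (d * y x `^ (1 - (P i)^-1))} &
    ((d `^ q)%:E <= (2 `^ q)%:E * dual_factor (P i) q (w i) (cube c r))%E].
  by move=> i; apply: dual_factor_data => //; exact: Apq_dual_lty.
exists d, y; split => /=.
- by move=> i; have [] := dy i.
- by move=> i; have [] := dy i.
- by move=> i; have [] := dy i.
- have : {ae mu, forall x, forall i : 'I_m, cube c r x ->
      1 <= w i x * (d i * y i x `^ (1 - (P i)^-1))}.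
    by apply: filter_forall => i; have [] := dy i.
  by apply: filterS => x h Qx i; exact: h.
- have d0 i : 0 <= d i by have [/ltW] := dy i.
  have Afin : Apq_char P q w \is a fin_num.
    by rewrite ge0_fin_numE// ltW// (Apq_char_gt0 c r).
  rewrite -lee_fin EFinM -(cube_massE v (c, r))//; last exact: Apq_locally_finite.
  rewrite -prod_powR_base//.
  have DE i : dual_factor (P i) q (w i) (cube c r) =
      (fine (dual_factor (P i) q (w i) (cube c r)))%:E.
    by rewrite fineK// ge0_fin_numE ?Apq_dual_lty// ltW// dual_gt0.
  apply: (@le_trans _ _ ((\prod_(i < m) (2 `^ q * fine (dual_factor (P i) q (w i) (cube c r))))%:E *
      mass mu v (cube c r))%E).
    apply: lee_wpmul2r; first exact: mass_ge0.
    rewrite lee_fin; apply: ler_prod => i _; rewrite powR_ge0/=.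
    by rewrite -lee_fin EFinM -DE; have [] := dy i.
  rewrite big_split/= prodr_const card_ord EFinM -prodEFin -muleA.
  rewrite (eq_bigr (fun i => dual_factor (P i) q (w i) (cube c r))) => [|i _]; last by rewrite -DE.
  rewrite [leRHS](_ : _ = ((2 `^ q) ^+ m)%:E * (Apq_char P q w * ((2 * r) ^+ n)%:E))%E; last first.
    by rewrite -[in RHS](fineK Afin) -!EFinM mulrA.
  apply: lee_wpmul2l; first by rewrite lee_fin exprn_ge0// powR_ge0.
  have uE : (0 <= ((2 * r) ^+ n)%:E :> \bar R)%E by rewrite lee_fin ltW.
  apply: le_trans (lee_wpmul2r uE (Apq_ge c r r0)).
  rewrite averageE// le_eqVlt; apply/orP; left; apply/eqP.
  rewrite [RHS]muleAC [X in (_ = X * _)%E]muleAC -EFinM mulVf ?gt_eqF// mul1e.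
  by rewrite muleC.
Qed.

Let v_null c r : 0 < r -> mass mu v (cube c r) = 0%E ->
  {ae mu, forall x, cube c r x -> v x = 0}.
Proof.
move=> r0 V0.
have mQ : measurable (cube c r : set (Rn R n)) by exact: measurable_cube.
have [+ _] := ae_eq_integral_abs mu mQ (nonneg_fun_EFin v v_nn (cube c r)).
have -> : (\int[mu]_(x in cube c r) `|(v x)%:E| = mass mu v (cube c r))%E.
  by apply: eq_integral => x _; rewrite gee0_abs// lee_fin; exact: v_nn.2.
by move=> /(_ V0); apply: filterS => x h Qx; have [] := h Qx.
Qed.

(** If the weight vanishes on one cube then it vanishes on every larger one:
    otherwise the dual factors of the larger cube would be finite, and all the [w i]
    positive almost everywhere on it. *)
Lemma Apq_degenerate c r : 0 < r -> mass mu v (cube c r) = 0%E ->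
  mu [set x | nu w x != 0] = 0%E.
Proof.
move=> r0 V0.
have grow (k : nat) : mass mu v (cube c (r + k%:R)) = 0%E.
  apply/eqP; apply: contrapT => /negP Vk.
  have rk0 : 0 < r + k%:R by rewrite ltr_wpDr.
  have Vpos : (0 < mass mu v (cube c (r + k%:R)))%E by rewrite lt0e Vk mass_ge0.
  have [d [y [_ _ _ ae1 _]]] := Apq_dual_data c (r + k%:R) rk0 Vpos.
  have : {ae mu, forall x, cube c r x -> False}.
    apply: filterS2 ae1 (v_null c r r0 V0) => x w1 vx Qx.
    have Qkx : cube c (r + k%:R) x by apply: cubeS Qx; rewrite lerDl.
    have /eqP := vx Qx; rewrite /power_weight powR_eq0 (gt_eqF q0) andbT.
    rewrite /nu prodf_seq_eq0 => /hasP[i _ /= /eqP wi].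
    by have := w1 Qkx i; rewrite wi mul0r ler10.
  by move=> /(ae_cube_exists c r n0 r0)[].
apply/eqP; rewrite eq_le measure_ge0 andbT.
apply: (@le_trans _ _ (mu (\bigcup_k (cube c (r + k%:R) `&` [set x | nu w x != 0])))).
  apply: mu_le => x nux; pose s := \sum_i `|x ord0 i - c ord0 i|.
  exists (Num.trunc s).+1 => //; split => // i.
  apply: (@le_lt_trans _ _ s); first by rewrite /s (bigD1 i)//= lerDl sumr_ge0.
  by apply: (lt_le_trans (truncnS_gt s)); rewrite lerDr ltW.
apply: le_trans (mu_bigcup_le _) _; rewrite eseries0// => k _ _.
have rk0 : 0 < r + k%:R by rewrite ltr_wpDr.
have [N [mN N0 AN]] := v_null c _ rk0 (grow k).
apply/eqP; rewrite eq_le measure_ge0 andbT -N0; apply: mu_le => x [Qx nux].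
apply: AN => /= /(_ Qx) /eqP.
by rewrite /power_weight powR_eq0 (negPf nux).
Qed.

End weight_class.

Theorem theorem1p5 (R : realType) (n m : nat) (alpha p q : R) (P : 'I_m -> R)
    (w : 'I_m -> Rn R n -> R)
    (alpha_bounds : 0 < alpha < (m * n)%:R)
    (P_ge1 : forall i, 1 <= P i)
    (p_def : p^-1 = \sum_(i < m) (P i)^-1)
    (p_bounds : m%:R^-1 < p < n%:R / alpha)
    (q_def : q^-1 = p^-1 - alpha / n%:R)
    (w_weight : forall i, weight (w i))
    (w_Apq : Apq P q w) :
  exists2 C : R, 0 < C &
    forall f : 'I_m -> Rn R n -> R, (forall i, locally_integrable_Rn (f i)) ->
      (weak_norm q (fun x => frac_maximal alpha f x * (nu w x)%:E) <=
        C%:E * Apq_char P q w `^ q^-1 *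
        \prod_(i < m) weighted_norm (P i) (fun x => (w i x `^ P i)%R) (f i))%E.
Proof.
have /andP[alpha0 alpha_mn] := alpha_bounds.
have mn0 : (0 < m * n)%N by rewrite -(ltr0n R) (lt_trans alpha0).
have m0 : (0 < m)%N by move: mn0; rewrite muln_gt0 => /andP[].
have n0 : (0 < n)%N by move: mn0; rewrite muln_gt0 => /andP[].
have nR : 0 < n%:R :> R by rewrite ltr0n.
have /andP[mp pn] := p_bounds.
have p0 : 0 < p by apply: le_lt_trans mp; rewrite invr_ge0.
have q0 : 0 < q.
  rewrite -invr_gt0 q_def subr_gt0 -[alpha / _]invf_div ltf_pV2 ?posrE//.
  by rewrite divr_gt0.
have kap0 : 0 < m%:R - alpha / n%:R.
  by rewrite subr_gt0 ltr_pdivrMr// -natrM.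
have w_nn i : nonneg_fun (w i) by have [] := w_weight i.
have norm_ge0 (f : 'I_m -> Rn R n -> R) :
    (0 <= \prod_(i < m) weighted_norm (P i) (fun x => (w i x `^ P i)%R) (f i))%E.
  by apply: prode_ge0 => i _; exact: poweR_ge0.
have [[c [r [r0 V0]]]|nondeg] := pselect (exists c r, 0 < r /\
    mass (lebesgue_rV R n) (power_weight w q) (cube c r) = 0%E).
  exists 1 => // f f_loc; apply: ub_ereal_sup => _ [l /= l0 <-].
  have null := Apq_degenerate P w q n0 P_ge1 q0 w_nn w_Apq c r r0 V0.
  rewrite (_ : lebesgue_rV R n _ = 0%E).
    rewrite poweR0r ?invr_neq0 ?gt_eqF// mule0 mule_ge0//.
    by rewrite mul1e poweR_ge0.
  apply/eqP; rewrite eq_le measure_ge0 andbT -null; apply: mu_le => x /=.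
  by apply: contraTneq => ->; rewrite mule0 abse0 -leNgt lee_fin ltW.
have Vpos c r : 0 < r -> (0 < mass (lebesgue_rV R n) (power_weight w q) (cube c r))%E.
  move=> r0; rewrite lt0e mass_ge0 ?andbT; last exact: nonneg_fun_power_weight.
  by apply/eqP => V0; apply: nondeg; exists c, r.
have A0 : (0 < Apq_char P q w)%E.
  exact: (Apq_char_gt0 P w q n0 P_ge1 w_nn 0 1 ltr01 (Vpos 0 1 ltr01)).
have AE : Apq_char P q w = (fine (Apq_char P q w))%:E.
  by rewrite fineK// ge0_fin_numE// ltW.
have fA0 : 0 < fine (Apq_char P q w) by rewrite -lte_fin -AE.
pose W := (2 `^ q) ^+ m * fine (Apq_char P q w).
have W0 : 0 < W by rewrite mulr_gt0// exprn_gt0// powR_gt0.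
have vloc := Apq_locally_finite P w q n0 P_ge1 w_nn w_Apq.
have vpos (Q : 'rV[R]_n * R) : 0 < Q.2 -> 0 < cube_mass (power_weight w q) Q.
  move=> Q0; rewrite -lte_fin -cube_massE//; first exact: Vpos.
  exact: nonneg_fun_power_weight.
have data (Q : 'rV[R]_n * R) : 0 < Q.2 -> dual_data P w q W Q.
  case: Q => c r /= r0.
  exact: (Apq_dual_data P w q n0 P_ge1 q0 w_nn w_Apq c r r0 (Vpos _ _ r0)).
pose C0 := @bound_const R n m q alpha W.
have C00 : 0 < C0 by exact: bound_const_gt0.
exists (C0 `^ q^-1 / fine (Apq_char P q w) `^ q^-1).
  by rewrite divr_gt0// powR_gt0.
move=> f f_loc.
have -> : ((C0 `^ q^-1 / fine (Apq_char P q w) `^ q^-1)%:E * Apq_char P q w `^ q^-1 =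
    (C0 `^ q^-1)%:E)%E.
  rewrite [X in (_ * X `^ _)%E]AE poweR_EFin -EFinM divfK//.
  by rewrite gt_eqF// powR_gt0.
exact: weak_norm_le P w p q alpha W n0 m0 P_ge1 p_def q_def q0 alpha0 kap0 w_nn W0 vloc vpos data f f_loc.
Qed.
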